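(* Let $P_u$ be a flexible cross-polytope of the simplest type in $\mathbb{X}^n$ corresponding to data $(G,\boldsymbol\lambda,\mathbf{s})$ with $0<\lambda_1<\dots<\lambda_n$, and let $Y$ be one of the two subsets $Y_+=\{i\in[n]:s_is_i'=1\}$ and $Y_-=\{i\in[n]:s_is_i'=-1\}$ of $[n]$. Then $$\sum_{A\sqcup B=[n]}(-1)^{|B\cap Y|}V_{A,B}=\begin{cases}0&\text{if }\mathbb{X}^n=\mathbb{E}^n\text{ or }\Lambda^n,\\0&\text{if }\mathbb{X}^n=\mathbb{S}^n\text{ and }Y\ne\emptyset,\\ \sigma_{n-1}&\text{if }\mathbb{X}^n=\mathbb{S}^n\text{ and }Y=\emptyset,\end{cases}$$ where the sum is over all ordered pairs $(A,B)$ of disjoint subsets with union $[n]$.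
   Context: Spaces. $\mathbb{X}^n$ is Euclidean space $\mathbb{E}^n=\mathbb{R}^n$, or the unit sphere $\mathbb{S}^n\subset\mathbb{R}^{n+1}$, or the Lobachevsky space $\Lambda^n=\{\mathbf{x}\in\mathbb{R}^{n,1}:\langle\mathbf{x},\mathbf{x}\rangle=-1,\ x_0>0\}$, where $\langle\mathbf{x},\mathbf{y}\rangle=-x_0y_0+x_1y_1+\dots+x_ny_n$ ($n\ge2$); $\mathbb{V}$ denotes $\mathbb{R}^n,\mathbb{R}^{n+1},\mathbb{R}^{n,1}$ respectively. Planes in $\mathbb{S}^n$ are great spheres. $[n]=\{1,\dots,n\}$, and $u\in\mathbb{R}\cup\{\infty\}$. Cross-polytopes. $K_n$ is the simplicial complex with vertices $\mathbf{a}_1,\dots,\mathbf{a}_n,\mathbf{b}_1,\dots,\mathbf{b}_n$ whose simplices are the vertex sets containing no pair $\{\mathbf{a}_i,\mathbf{b}_i\}$. A cross-polytope is a polyhedron $P\colon K_n\to\mathbb{X}^n$ of type $K_n$: each simplex is mapped homeomorphically onto the convex hull of the images of its vertices. It is non-degenerate if for every simplex the images of its vertices are independent, and $K_n$ is not the union of two $(n-1)$-dimensional subcomplexes whose intersection is mapped into an $(n-2)$-plane. Images of vertices are again denoted $\mathbf{a}_i,\mathbf{b}_i$. For disjoint $I,J\subset[n]$, $\Delta_{I,J}$ is the face spanned by $\mathbf{a}_i$ ($i\in I$) and $\mathbf{b}_j$ ($j\in J$), and $V_{I,J}$ is its $(|I|+|J|-1)$-dimensional volume (independent of $u$). Flexible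 cross-polytopes of the simplest type. Data: a symmetric $n\times n$ matrix $G=(g_{ij})$ with units on the diagonal, all of whose principal minors of sizes $2\times2,\dots,(n-1)\times(n-1)$ are positive, with $\det G>0$, $=0$, $<0$ for $\mathbb{S}^n,\mathbb{E}^n,\Lambda^n$ respectively; a row $\boldsymbol\lambda=(\lambda_1,\dots,\lambda_n)$ with (standing assumption) $0<\lambda_1<\dots<\lambda_n$; a row of signs $\mathbf{s}=(s_1,\dots,s_n,s_1',\dots,s_n')$. Take $\mathbf{n}_1,\dots,\mathbf{n}_n\in\mathbb{V}$ with Gram matrix $G$ and $\mathbf{m}\in\mathbb{V}$ orthogonal to them with $\langle\mathbf{m},\mathbf{m}\rangle=1$. Put $h_{ii}=1$, $h_{ij}=\frac{2\lambda_i(\lambda_ig_{ij}-\lambda_j)}{\lambda_i^2-\lambda_j^2}$ for $i\ne j$. For $\mathbb{S}^n,\Lambda^n$: let $\mathbf{c}_1,\dots,\mathbf{c}_n$ be the basis of $\mathrm{span}(\mathbf{n}_1,\dots,\mathbf{n}_n)$ dual to $\mathbf{n}_1,\dots,\mathbf{n}_n$, let $\mathbf{d}_i(u)=\sum_jh_{ij}\mathbf{c}_j-\frac{2\lambda_i^2u^2}{\lambda_i^2u^2+1}\mathbf{n}_i+\frac{2\lambda_iu}{\lambda_i^2u^2+1}\mathbf{m}$, and $\mathbf{a}_i(u)=s_i\mathbf{c}_i/|\mathbf{c}_i|$, $\mathbf{b}_i(u)=s_i'\mathbf{d}_i(u)/|\mathbf{d}_i(u)|$ with $|\mathbf{x}|=\sqrt{|\langle\mathbf{x},\mathbf{x}\rangle|}$;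 the signs are arbitrary for $\mathbb{S}^n$, and for $\Lambda^n$ they are chosen so that the points lie in $\Lambda^n$ (the $\mathbf{d}_i(u)$ are required to be time-like). For $\mathbb{E}^n$: take a hyperplane $\Pi$ orthogonal to $\mathbf{m}$ and a simplex $[\mathbf{a}_1\dots\mathbf{a}_n]$ in $\Pi$ whose facet opposite to $\mathbf{a}_i$ is orthogonal to $\mathbf{n}_i$ for each $i$; $s_i=1$ if $\mathbf{n}_i$ is the interior normal to this facet (in $\Pi$), $s_i=-1$ if exterior; $a_i$ is $s_i$ times the altitude from $\mathbf{a}_i$; $b_i=\bigl(\sum_jh_{ij}/a_j\bigr)^{-1}$ (required to be well defined), $s_i'$ is the sign of $b_i$; $\mathbf{a}_i(u)=\mathbf{a}_i$, $\mathbf{b}_i(u)=b_i\Bigl(\sum_j\frac{h_{ij}\mathbf{a}_j}{a_j}-\frac{2\lambda_i^2u^2}{\lambda_i^2u^2+1}\mathbf{n}_i+\frac{2\lambda_iu}{\lambda_i^2u^2+1}\mathbf{m}\Bigr)$. At $u=\infty$ limits are taken. When everything is well defined and $P_u$ is non-degenerate for all but finitely many $u$, the polyhedron $P_u$ with these vertices has constant edge lengths and is called a flexible cross-polytope of the simplest type. $\sigma_n=2\pi^{(n+1)/2}/\Gamma\bigl(\tfrac{n+1}{2}\bigr)$ is the $n$-dimensional volume of $\mathbb{S}^n$. *)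

(* Defs.v *)
From HB Require Import structures.
From mathcomp Require Import all_boot all_order all_algebra.
From mathcomp Require Import all_classical all_reals all_analysis.

Set Implicit Arguments.
Unset Strict Implicit.
Unset Printing Implicit Defensive.

Import Order.TTheory GRing.Theory Num.Theory.
Import numFieldNormedType.Exports.

Local Open Scope ring_scope.

Inductive geometry := Euclidean | Spherical | Lobachevsky.

Definition ambient_dim (X : geometry) (n : nat) : nat :=
  if X is Euclidean then n else n.+1.

Definition signature (R : realType) (X : geometry) (k : nat) : R :=
  match X, k with Lobachevsky, 0%N => -1 | _, _ => 1 end.

Section Space.
Variables (R : realType) (X : geometry) (n : nat).

Implicit Types x y : 'rV[R]_(ambient_dim X n).

Definition form x y : R := \sum_(k < ambient_dim X n) signature R X k * (x 0 k * y 0 k).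

Definition vnorm x : R := Num.sqrt `|form x x|.

Definition on_space x : Prop :=
  match X with
  | Euclidean => True
  | Spherical => form x x = 1
  | Lobachevsky =>
      form x x = -1 /\
      (forall k : 'I_(ambient_dim X n), k = 0%N :> nat -> 0 < x 0 k)
  end.

Definition normalize x : 'rV[R]_(ambient_dim X n) :=
  if X is Euclidean then x else (vnorm x)^-1 *: x.

(* A k-plane is a translate of a k-dimensional subspace in the Euclidean case,
   and a nonempty section by a (k+1)-dimensional subspace otherwise. *)
Definition is_plane (k : nat) (Q : set 'rV[R]_(ambient_dim X n)) : Prop :=
  if X is Euclidean then
    exists p (W : 'M[R]_(k, ambient_dim X n)),
      \rank W = k /\ (forall x, Q x <-> (x - p <= W)%MS)
  else
    exists W : 'M[R]_(k.+1, ambient_dim X n),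
      [/\ \rank W = k.+1,
          forall x, Q x <-> on_space x /\ (x <= W)%MS
        & exists x, Q x].

Section Points.
Variables (T : finType) (p : T -> 'rV[R]_(ambient_dim X n)).

(* Affine independence in the Euclidean case, linear independence otherwise. *)
Definition independent (S : {set T}) : Prop :=
  forall c : T -> R,
    \sum_(v in S) c v *: p v = 0 ->
    (if X is Euclidean then \sum_(v in S) c v = 0 else True) ->
    forall v, v \in S -> c v = 0.

Definition hull (S : {set T}) (x : 'rV[R]_(ambient_dim X n)) : Prop :=
  exists w : T -> R,
    [/\ forall v, v \in S -> 0 <= w v, \sum_(v in S) w v = 1
      & x = normalize (\sum_(v in S) w v *: p v)].

End Points.

(* Riemannian volume density of a parametrized k-dimensional surface. *)
Definition volume_density (k : nat)
    (phi : 'rV[R]_k -> 'rV[R]_(ambient_dim X n)) (t : 'rV[R]_k) : R :=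
  Num.sqrt (\det (\matrix_(i, j) form ('D_'e_i phi t) ('D_'e_j phi t))).

(* The simplex with vertices q_0, ..., q_k, parametrized by
   {t in R^k | t_i >= 0, t_1 + ... + t_k <= 1}. *)
Definition simplex_param (q : seq 'rV[R]_(ambient_dim X n))
    (t : 'rV[R]_(size q).-1) : 'rV[R]_(ambient_dim X n) :=
  normalize (q`_0 + \sum_i t 0 i *: (q`_i.+1 - q`_0)).

End Space.

(* Integral over R^k of a nonnegative measurable function (Tonelli). *)
Fixpoint iterated_integral (R : realType) (k : nat) :
    (k.-tuple R -> \bar R) -> \bar R :=
  match k with
  | 0 => fun f => f [tuple]
  | k'.+1 => fun f =>
      (\int[lebesgue_measure]_x
         iterated_integral (fun t : k'.-tuple R => f [tuple of x :: t]))%E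
  end.

Definition simplex_volume (R : realType) (X : geometry) (n : nat)
    (q : seq 'rV[R]_(ambient_dim X n)) : R :=
  fine (iterated_integral (fun tt : (size q).-1.-tuple R =>
    let t := \row_i tnth tt i in
    if [forall i, 0 <= t 0 i] && (\sum_i t 0 i <= 1)
    then (volume_density (@simplex_param R X n q) t)%:E else 0%E)).

Definition Gamma (R : realType) (x : R) : R :=
  (\int[lebesgue_measure]_(t in `]0, +oo[%classic) (t `^ (x - 1) * expR (- t)))%R.

Definition sphere_volume (R : realType) (n : nat) : R :=
  2 * pi `^ (n.+1%:R / 2) / Gamma (n.+1%:R / 2).

(* inl i is the vertex a_i and inr i is the vertex b_i. *)
Definition vertex (n : nat) : finType := ('I_n + 'I_n)%type.

Definition cross_complex (n : nat) : {set {set vertex n}} :=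
  [set S | (S != finset.set0) &&
           [forall i, ~~ ((inl i \in S) && (inr i \in S))]].

(* An (n-1)-dimensional simplex has n vertices. *)
Definition full_dim_subcomplex (n : nat) (L : {set {set vertex n}}) : Prop :=
  [/\ L \subset cross_complex n,
      forall S S', S \in L -> S' != finset.set0 -> S' \subset S -> S' \in L
    & exists2 S, S \in L & #|S| = n].

Section CrossPolytope.
Variables (R : realType) (X : geometry) (n : nat).

Definition nondegenerate (p : vertex n -> 'rV[R]_(ambient_dim X n)) : Prop :=
  (forall S, S \in cross_complex n -> independent p S) /\
  ~ (exists L1 L2 : {set {set vertex n}},
       [/\ full_dim_subcomplex L1, full_dim_subcomplex L2,
           L1 :|: L2 = cross_complex n
         & exists2 Q, is_plane n.-2 Q &
             forall S x, S \in L1 :&: L2 -> hull p S x -> Q x]).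

Definition face_volume (p : vertex n -> 'rV[R]_(ambient_dim X n))
    (I J : {set 'I_n}) : R :=
  simplex_volume ([seq p (inl i) | i <- enum I] ++ [seq p (inr j) | j <- enum J]).

Variables (G : 'M[R]_n) (lam s s' : 'I_n -> R).

Definition principal_minor (I : {set 'I_n}) : R :=
  \det (\matrix_(i < #|I|, j < #|I|) G (enum_val i) (enum_val j)).

Definition is_sign (e : R) : Prop := e = 1 \/ e = -1.

Definition admissible_data : Prop :=
  [/\ G^T = G,
      forall i, G i i = 1,
      forall I : {set 'I_n}, (2 <= #|I| <= n.-1)%N -> 0 < principal_minor I,
      match X with
      | Spherical => 0 < \det G
      | Euclidean => \det G = 0
      | Lobachevsky => \det G < 0
      end
    & [/\ forall i, 0 < lam i,
          forall i j : 'I_n, (i < j)%N -> lam i < lam j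
        & forall i, is_sign (s i) /\ is_sign (s' i)]].

Definition hcoef (i j : 'I_n) : R :=
  if i == j then 1
  else 2 * lam i * (lam i * G i j - lam j) / (lam i ^+ 2 - lam j ^+ 2).

(* The parameter u ranges over the one-point compactification of R, None being
   the point at infinity; 2 and 0 are the limits of the coefficients there. *)
Definition ncoef (l : R) (u : option R) : R :=
  if u is Some x then 2 * l ^+ 2 * x ^+ 2 / (l ^+ 2 * x ^+ 2 + 1) else 2.

Definition mcoef (l : R) (u : option R) : R :=
  if u is Some x then 2 * l * x / (l ^+ 2 * x ^+ 2 + 1) else 0.

Definition normal_frame (nn : 'I_n -> 'rV[R]_(ambient_dim X n))
    (m : 'rV[R]_(ambient_dim X n)) : Prop :=
  [/\ forall i j, form (nn i) (nn j) = G i j,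
      forall i, form m (nn i) = 0 & form m m = 1].

Definition dvec (nn c : 'I_n -> 'rV[R]_(ambient_dim X n))
    (m : 'rV[R]_(ambient_dim X n)) (i : 'I_n) (u : option R) :
    'rV[R]_(ambient_dim X n) :=
  \sum_j hcoef i j *: c j - ncoef (lam i) u *: nn i + mcoef (lam i) u *: m.

(* In the Lobachevsky case, P u v in the space forces the signs. *)
Definition simplest_curved
    (P : option R -> vertex n -> 'rV[R]_(ambient_dim X n)) : Prop :=
  exists (nn c : 'I_n -> 'rV[R]_(ambient_dim X n)) (m : 'rV[R]_(ambient_dim X n)),
    [/\ normal_frame nn m,
        (forall i, (c i <= \matrix_j nn j)%MS) /\
        (forall i j, form (c i) (nn j) = (i == j)%:R),
        (if X is Lobachevsky then
           forall u i, form (dvec nn c m i u) (dvec nn c m i u) < 0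
         else True),
        forall u i,
          P u (inl i) = (s i / vnorm (c i)) *: c i /\
          P u (inr i) = (s' i / vnorm (dvec nn c m i u)) *: dvec nn c m i u
      & forall u v, on_space (P u v)].

(* h is the length of the perpendicular dropped from a_i to the affine hull
   of the other vertices; f is its foot. *)
Definition is_altitude (a : 'I_n -> 'rV[R]_(ambient_dim X n)) (i : 'I_n)
    (h : R) : Prop :=
  exists f : 'rV[R]_(ambient_dim X n),
    [/\ exists w : 'I_n -> R,
          \sum_(j | j != i) w j = 1 /\ f = \sum_(j | j != i) w j *: a j,
        forall j k, j != i -> k != i -> form (a i - f) (a j - a k) = 0
      & h = vnorm (a i - f)].

(* n_i is the interior (s_i = 1) or exterior (s_i = -1) normal to the facet
   opposite to a_i. *)
Definition facet_sign (a nn : 'I_n -> 'rV[R]_(ambient_dim X n)) (i : 'I_n) :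
    Prop :=
  (s i = 1 /\ forall j, j != i -> 0 < form (nn i) (a i - a j)) \/
  (s i = -1 /\ forall j, j != i -> form (nn i) (a i - a j) < 0).

(* alt i is the unsigned altitude, so that s i * alt i is the number a_i. *)
Definition simplest_euclidean
    (P : option R -> vertex n -> 'rV[R]_(ambient_dim X n)) : Prop :=
  exists (nn a : 'I_n -> 'rV[R]_(ambient_dim X n)) (m : 'rV[R]_(ambient_dim X n))
         (alt : 'I_n -> R),
    let b i := (\sum_j hcoef i j / (s j * alt j))^-1 in
    [/\ normal_frame nn m,
        [/\ exists r, forall i, form m (a i) = r,
            independent a [set: 'I_n]
          & forall i j k, j != i -> k != i -> form (nn i) (a j - a k) = 0],
        (forall i, facet_sign a nn i) /\ (forall i, is_altitude a i (alt i)),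
        forall i, \sum_j hcoef i j / (s j * alt j) != 0 /\ s' i = Num.sg (b i)
      & forall u i,
          P u (inl i) = a i /\
          P u (inr i) = b i *: (\sum_j (hcoef i j / (s j * alt j)) *: a j
            - ncoef (lam i) u *: nn i + mcoef (lam i) u *: m)].

Definition flexible_simplest_type
    (P : option R -> vertex n -> 'rV[R]_(ambient_dim X n)) : Prop :=
  [/\ admissible_data,
      if X is Euclidean then simplest_euclidean P else simplest_curved P
    & finite_set (fun u => ~ nondegenerate (P u))].

End CrossPolytope.

(* Main.v *)
From Pilot Require Import Defs.
From mathcomp Require Import all_boot all_order all_algebra.
From mathcomp Require Import all_classical all_reals all_analysis.
From mathcomp Require Import perm measurable_realfun.
From mathcomp Require Import ring lra.
Set Implicit Arguments.
Unset Strict Implicit.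
Unset Printing Implicit Defensive.
Import Order.TTheory GRing.Theory Num.Theory.
Import numFieldNormedType.Exports.
Import Pilot.Defs.

Local Open Scope ring_scope.

(** The faces keep their volumes during the flex, so these can be computed at
    u = 0 or u = oo, where the cross-polytope collapses: every b_i becomes a
    multiple of sum_k h_ik c_k (at u = oo, of sum_k h_ki c_k), where c_k is
    parallel to a_k.  As h_ij lam_j^2 + h_ji lam_i^2 = 2 lam_i lam_j, the form
    with matrix (h_ij lam_j^2) is nonnegative; hence the determinant of the
    simplex with vertices b_i (i in B) and a_i (i not in B), relatively to that
    of the a_i, has sign prod_(i in B) s_i s_i' (opposite factors at u = oo).
    So (-1)^|B :&: Y| is (-1)^|B| times an orientation sign, where Y = Y_+ is
    read off at u = 0 and Y = Y_- at u = oo.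
    In E^n the sum becomes a multiple of sum_B (-1)^|B| det N_B, with N_B the
    barycentric coordinates of the vertices.  By multilinearity this is a
    determinant whose rows have zero sum.
    In S^n and L^n the volume of a simplex is, up to a constant, the integral of
    exp(- |<x,x>|) over the cone that it spans.  The cones of B and of B with i
    toggled share a facet, so the signed number of cones covering x does not
    change along a generic line, and it is determined by the cones containing
    the direction of the line.  In L^n no cone contains - a_0; in S^n no cone
    contains - a_i for i in Y, and if Y is empty only the cone of the a_i
    contains a given interior direction, so that the sum is the Gaussian
    integral over the whole hyperplane. *)

(** * Iterated integrals *)

(** The two collapsed positions are not assumed nondegenerate: nondegeneracy is granted only up to
    finitely many u. What is carried over from a good u is the linear independence of the vertices
    of a facet in S^n and L^n. A face never contains both a_i and b_i, so its Gram matrix does not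
    depend on u, and a vector orthogonal to all vertices of a facet and isotropic must vanish. The
    identity h_ij + h_ji = 2 g_ij makes u = oo the transposed picture of u = 0: there n_i
    contributes -2 sum_j g_ij c_j, which leaves - sum_j h_ji c_j. One argument thus serves the
    matrix H, and its transpose with all signs reversed. A sign of a determinant has two sources:
    the nonnegative form excludes one sign, independence excludes zero. In E^n a vanishing
    determinant is harmless, being a vanishing volume. Curved volumes are not polynomial in the
    vertices, which is why cones are used. The volume density of x/|x| is proportional to
    |x|^-(k+1), and this is exactly what integrating r^k exp(- r^2 |x|^2) over r > 0 produces. *)

Section IteratedIntegral.
Context {R : realType}.
Local Open Scope ereal_scope.
Local Notation mu := (@lebesgue_measure R).
Local Notation I := (@iterated_integral R _).

Lemma iterated_integral_ge0 k (F : k.-tuple R -> \bar R) :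
  (forall t, 0 <= F t) -> 0 <= I F.
Proof.
elim: k F => [|k IH] F F0 /=; first exact: F0.
by apply: integral_ge0 => x _; apply: IH.
Qed.

Lemma eq_iterated_integral k (F H : k.-tuple R -> \bar R) :
  F =1 H -> I F = I H.
Proof. by move=> /funext ->. Qed.

Lemma measurable_consp d (T : measurableType d) k :
  measurable_fun setT
    (fun p : T * R * k.-tuple R => (p.1.1, [tuple of p.1.2 :: p.2])).
Proof.
apply: measurable_fun_pair => /=.
  exact: (measurableT_comp measurable_fst measurable_fst).
apply: measurable_cons => //.
exact: (measurableT_comp measurable_snd measurable_fst).
Qed.

(** The parameter space [T] varies in the induction: each integration turns one coordinate of the
    tuple into a parameter. *)
Lemma measurable_iterated_integral d (T : measurableType d) k
    (F : T * k.-tuple R -> \bar R) :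
  measurable_fun setT F -> (forall p, 0 <= F p) ->
  measurable_fun setT (fun x => I (fun t => F (x, t))).
Proof.
elim: k d T F => [|k IH] d T F mF F0 /=.
  apply: (measurableT_comp mF).
  by apply: measurable_fun_pair => //; exact: measurable_cst.
pose H (p : T * R) := I (fun t : k.-tuple R => F (p.1, [tuple of p.2 :: t])).
have mH : measurable_fun setT H.
  have := @IH _ (T * R)%type (fun p => F (p.1.1, [tuple of p.1.2 :: p.2])).
  apply => [|p]; last exact: F0.
  apply: (measurableT_comp mF); exact: measurable_consp.
have H0 p : 0 <= H p by apply: iterated_integral_ge0 => t; exact: F0.
exact: (measurable_fun_fubini_tonelli_F (m2 := mu) H mH H0).
Qed.

Lemma measurable_tcons k (F : k.+1.-tuple R -> \bar R) :
  measurable_fun setT F ->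
  measurable_fun setT (fun p : R * k.-tuple R => F [tuple of p.1 :: p.2]).
Proof.
move=> mF; apply: (measurableT_comp mF); exact: measurable_cons.
Qed.

Lemma measurable_tcons1 k (F : k.+1.-tuple R -> \bar R) (x : R) :
  measurable_fun setT F ->
  measurable_fun setT (fun t : k.-tuple R => F [tuple of x :: t]).
Proof.
move=> mF; apply: (measurableT_comp mF); apply: measurable_cons => //.
Qed.

Lemma measurable_inner k (F : k.+1.-tuple R -> \bar R) :
  measurable_fun setT F -> (forall p, 0 <= F p) ->
  measurable_fun setT
    (fun x : R => I (fun t : k.-tuple R => F [tuple of x :: t])).
Proof.
move=> mF F0.
apply: (@measurable_iterated_integral _ R k
  (fun p => F [tuple of p.1 :: p.2])) => [|p]; last exact: F0.
exact: measurable_tcons.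
Qed.

Lemma ge0_le_iterated_integral k (F H : k.-tuple R -> \bar R) :
  measurable_fun setT F -> measurable_fun setT H ->
  (forall t, 0 <= F t) -> (forall t, F t <= H t) -> I F <= I H.
Proof.
elim: k F H => [|k IH] F H mF mH F0 FH /=; first exact: FH.
have H0 t : 0 <= H t by apply: le_trans (FH t).
apply: ge0_le_integral => //.
- by move=> x _; apply: iterated_integral_ge0 => t; exact: F0.
- exact: measurable_inner.
- exact: measurable_inner.
- by move=> x _; apply: IH => //; exact: measurable_tcons1.
Qed.

Lemma ge0_iterated_integralD k (F H : k.-tuple R -> \bar R) :
  measurable_fun setT F -> measurable_fun setT H ->
  (forall t, 0 <= F t) -> (forall t, 0 <= H t) ->
  I (fun t => F t + H t) = I F + I H.
Proof.
elim: k F H => [|k IH] F H mF mH F0 H0 //=.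
rewrite -ge0_integralD//; last 4 first.
- by move=> x _; apply: iterated_integral_ge0 => t; exact: F0.
- exact: measurable_inner.
- by move=> x _; apply: iterated_integral_ge0 => t; exact: H0.
- exact: measurable_inner.
apply: eq_integral => x _; rewrite IH//; exact: measurable_tcons1.
Qed.

(** The factor is an extended real because it will be [+oo] for null sets, and a radial integral at
    a stage where its finiteness is not yet in question. *)
Lemma ge0_iterated_integralZ k (c : \bar R) (F : k.-tuple R -> \bar R) :
  0 <= c ->
  measurable_fun setT F -> (forall t, 0 <= F t) ->
  I (fun t => c * F t) = c * I F.
Proof.
move=> c0; elim: k F => [|k IH] F mF F0 //=.
transitivity (\int[mu]_x (c * I (fun t : k.-tuple R => F [tuple of x :: t]))).
  apply: eq_integral => x _; rewrite IH//; exact: measurable_tcons1.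
have i0 x : setT x -> 0 <= I (fun t : k.-tuple R => F [tuple of x :: t]).
  by move=> _; apply: iterated_integral_ge0 => t; exact: F0.
by rewrite ge0_integralZl//; exact: measurable_inner.
Qed.

Lemma iterated_integral0 k : I (fun _ : k.-tuple R => 0) = 0.
Proof.
elim: k => [|k IH] //=; by rewrite (eq_integral (fun=> 0)) ?integral0.
Qed.

(** Tonelli, one coordinate at a time: the outermost variable is moved innermost past the whole
    tuple. *)
Lemma iterated_integral_swap d (T : measurableType d) k
    (m : {sigma_finite_measure set T -> \bar R})
    (F : T * k.-tuple R -> \bar R) :
  measurable_fun setT F -> (forall p, 0 <= F p) ->
  \int[m]_x I (fun t => F (x, t)) = I (fun t => \int[m]_x F (x, t)).
Proof.
elim: k F => [|k IH] F mF F0 //=.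
pose H (p : T * R) := I (fun t : k.-tuple R => F (p.1, [tuple of p.2 :: t])).
have mF' : measurable_fun setT
    (fun p : T * R * k.-tuple R => F (p.1.1, [tuple of p.1.2 :: p.2])).
  apply: (measurableT_comp mF); exact: measurable_consp.
have mH : measurable_fun setT H.
  exact: (measurable_iterated_integral mF').
have H0 p : 0 <= H p by apply: iterated_integral_ge0 => t; exact: F0.
rewrite (fubini_tonelli (m1 := m) (m2 := mu) H mH H0).
apply: eq_integral => y _.
rewrite -(IH (fun p => F (p.1, [tuple of y :: p.2])))//=.
apply: (measurableT_comp mF'
  (g := fun p : T * k.-tuple R => ((p.1, y), p.2))).
by do 2 apply: measurable_fun_pair => //.
Qed.

End IteratedIntegral.

(** * Affine substitutions on the line *)

Section Affine1.
Context {R : realType}.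
Local Open Scope ereal_scope.
Local Notation mu := (@lebesgue_measure R).

Lemma ge0_integral_opp (f : R -> \bar R) :
  measurable_fun setT f -> (forall x, 0 <= f x) ->
  \int[mu]_x f (- x)%R = \int[mu]_x f x.
Proof.
move=> mf f0.
rewrite -[RHS](@eq_measure_integral _ _ _ _ (lebesgue_measure)
  (pushforward mu (-%R : measurableTypeR R -> measurableTypeR R))); last first.
  by move=> A mA _; exact/lebesgue_measureN.
by rewrite ge0_integral_pushforward// preimage_setT.
Qed.

Lemma measurable_affine (a b : R) :
  measurable_fun setT (fun x : measurableTypeR R => (a * x + b : measurableTypeR R)%R).
Proof. by apply: measurable_funD => //; exact: measurable_funM. Qed.

(** By uniqueness of Lebesgue measure it is enough to compare lengths of half-open intervals. A
    negative slope would exchange their open and closed ends; it is obtained later by reflection. *)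
Lemma lebesgue_measure_affine (a b : R) (a0 : (0 < a)%R)
    (m : {measure set (measurableTypeR R) -> \bar R}) :
  (m : set (measurableTypeR R) -> \bar R) = pushforward mu
     (fun x : measurableTypeR R => (a * x + b : measurableTypeR R)%R) ->
  forall A, measurable A -> mu A = mscale (NngNum (ltW a0)) m A.
Proof.
move=> mE; apply: lebesgue_measure_unique => _ [[c d]] _ <- /=.
rewrite /mscale mE /pushforward /=.
rewrite (_ : (_ @^-1` _)%classic = `](c - b) / a, (d - b) / a]%classic)%R; last first.
  apply/seteqP; split => x /=; rewrite !in_itv/=;
  by rewrite ltr_pdivrMr// ler_pdivlMr// ltrBlDr lerBrDr mulrC.
rewrite !lebesgue_measure_itv/= !lte_fin ltr_pM2r ?invr_gt0// ltrD2r.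
case: ifP => _; last by rewrite mule0.
by rewrite -!EFinB -EFinM -mulrBl mulrCA divff ?gt_eqF// mulr1; congr EFin; ring.
Qed.

Lemma ge0_integral_affine (a b : R) (f : R -> \bar R) :
  a != 0%R -> measurable_fun setT f -> (forall x, 0 <= f x) ->
  `|a|%:E * \int[mu]_x f (a * x + b)%R = \int[mu]_x f x.
Proof.
wlog a0 : a b f / (0 < a)%R.
  move=> wl aN0 mf f0.
  have [a0|] := ltrP 0%R a; first exact: wl.
  rewrite le_eqVlt (negbTE aN0)/= => a0.
  have ma : measurable_fun setT (fun x : R => f (a * x + b)%R).
    exact: (measurableT_comp mf (measurable_affine a b)).
  rewrite -ge0_integral_opp// -normrN.
  rewrite -(@wl (- a)%R b f)//; [|by rewrite oppr_gt0|by rewrite oppr_eq0].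
  by congr (_ * _); apply: eq_integral => x _; rewrite mulNr mulrN.
move=> _ mf f0; rewrite gtr0_norm//.
pose phi := (fun x : measurableTypeR R => (a * x + b : measurableTypeR R)%R).
have [m mE] : exists m : {measure set (measurableTypeR R) -> \bar R},
    (m : set (measurableTypeR R) -> \bar R) = pushforward mu phi.
  unshelve eexists (pushforward mu phi : {measure set _ -> \bar R}); last by [].
  exact: measurable_affine.
rewrite -[RHS](@eq_measure_integral _ _ _ setT mu (mscale (NngNum (ltW a0)) m)).
  rewrite ge0_integral_mscale//= mE ge0_integral_pushforward ?preimage_setT//.
  exact: measurable_affine.
by move=> A mA _; apply: esym; apply: (lebesgue_measure_affine a0 mE).
Qed.

End Affine1.

(** * Linear change of variables for iterated integrals *)

Section RowIntegral.
Context {R : realType}.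
Local Notation mu := (@lebesgue_measure R).

Definition row_of_tuple k (t : k.-tuple R) : 'rV[R]_k := \row_i tnth t i.

Definition row_integral k (F : 'rV[R]_k -> \bar R) : \bar R :=
  iterated_integral (fun t => F (row_of_tuple t)).

(** Measurability is tested through tuples, which carry the product sigma-algebra, while rows are
    what matrices act on. *)
Definition row_measurable d (T : measurableType d) k (F : 'rV[R]_k -> T) : Prop :=
  measurable_fun setT (fun t => F (row_of_tuple t)).

Lemma measurable_coord k (i : 'I_k) :
  measurable_fun setT (fun t => row_of_tuple t 0 i).
Proof.
rewrite (_ : (fun _ => _) = (fun t : k.-tuple R => tnth t i)).
  exact: measurable_tnth.
by apply/funext => t; rewrite mxE.
Qed.

Lemma row_measurable_comp d (T : measurableType d) d' (T' : measurableType d')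
    k (F : 'rV[R]_k -> T') (phi : T -> 'rV[R]_k) :
  row_measurable F -> (forall i, measurable_fun setT (fun t => phi t 0 i)) ->
  measurable_fun setT (fun t => F (phi t)).
Proof.
move=> mF mphi.
rewrite (_ : (fun t => _) = (fun t => F (row_of_tuple t)) \o
    (fun t => [tuple phi t 0 i | i < k])).
  apply: (measurableT_comp mF); apply/measurable_fun_tnthP => i.
  apply: eq_measurable_fun (mphi i) => t _ /=; by rewrite tnth_mktuple.
apply/funext => t /=; congr F; apply/rowP => i; by rewrite mxE tnth_mktuple.
Qed.

Lemma row_of_tuple_cons k x (t : k.-tuple R) :
  row_of_tuple [tuple of x :: t] = row_mx (x%:M : 'M[R]_1) (row_of_tuple t).
Proof.
apply/rowP => i; rewrite !mxE; case: split_ordP => j ->.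
  by rewrite (ord1 j) !mxE.
rewrite !mxE (_ : rshift 1 j = lift ord0 j); last exact/val_inj.
by rewrite tnthS.
Qed.

Lemma row_integralS k (F : 'rV[R]_(1 + k) -> \bar R) :
  row_integral F =
  (\int[mu]_x row_integral (fun y => F (row_mx (x%:M : 'M[R]_1) y)))%E.
Proof.
rewrite /row_integral /=; apply: eq_integral => x _.
by apply: eq_iterated_integral => t; rewrite row_of_tuple_cons.
Qed.

Lemma eq_row_integral k (F H : 'rV[R]_k -> \bar R) :
  F =1 H -> row_integral F = row_integral H.
Proof. by move=> /funext ->. Qed.

Lemma row_integral_ge0 k (F : 'rV[R]_k -> \bar R) :
  (forall x, (0 <= F x)%E) -> (0 <= row_integral F)%E.
Proof. by move=> F0; apply: iterated_integral_ge0. Qed.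

Lemma row_measurable_linear d (T : measurableType d) k m (F : 'rV[R]_m -> T) (M : 'M[R]_(k, m)) v :
  row_measurable F -> row_measurable (fun x => F (x *m M + v)%R).
Proof.
move=> mF; apply: (row_measurable_comp mF) => i.
rewrite (_ : (fun _ => _) =
  (fun t : k.-tuple R => \sum_j (row_of_tuple t 0 j * M j i) + v 0 i)%R).
  apply: measurable_funD => //; apply: measurable_sum => j.
  apply: measurable_funM => //; exact: measurable_coord.
by apply/funext => t; rewrite !mxE.
Qed.

Lemma row_measurable_mulmx d (T : measurableType d) k m (F : 'rV[R]_m -> T) (M : 'M[R]_(k, m)) :
  row_measurable F -> row_measurable (fun x => F (x *m M)%R).
Proof.
move=> /(row_measurable_linear M 0); congr row_measurable.
by apply/funext => x; rewrite addr0.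
Qed.

Lemma row_measurable_pair d (T : measurableType d) k (F : 'rV[R]_(1 + k) -> T) :
  row_measurable F ->
  measurable_fun setT (fun p : R * k.-tuple R =>
    F (row_mx (p.1%:M : 'M[R]_1) (row_of_tuple p.2))).
Proof.
move=> mF; apply: (row_measurable_comp mF) => i.
case: (split_ordP i) => j ->.
  rewrite (_ : (fun _ => _) = fst) //.
  by apply/funext => p; rewrite row_mxEl (ord1 j) mxE.
rewrite (_ : (fun _ => _) = (fun t => row_of_tuple t 0 j) \o snd).
  by apply: measurableT_comp => //; exact: measurable_coord.
by apply/funext => p; rewrite row_mxEr.
Qed.

Lemma row_measurable_row d (T : measurableType d) k (F : 'rV[R]_(1 + k) -> T) x :
  row_measurable F -> row_measurable (fun y => F (row_mx (x%:M : 'M[R]_1) y)).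
Proof.
move=> /row_measurable_pair mF.
exact: (measurableT_comp mF (measurable_fun_pair (measurable_cst x) (@measurable_id _ _ setT))).
Qed.

Lemma row_measurable_inner k (F : 'rV[R]_(1 + k) -> \bar R) :
  row_measurable F -> (forall x, (0 <= F x)%E) ->
  measurable_fun setT
    (fun x : R => row_integral (fun y => F (row_mx (x%:M : 'M[R]_1) y))).
Proof.
move=> /row_measurable_pair mF F0.
exact: (measurable_iterated_integral mF).
Qed.

Lemma row_integral_swap k (F : 'rV[R]_(1 + k) -> \bar R) :
  row_measurable F -> (forall x, (0 <= F x)%E) ->
  row_integral F =
  row_integral (fun y : 'rV[R]_k => (\int[mu]_x F (row_mx (x%:M : 'M[R]_1) y))%E).
Proof.
move=> /row_measurable_pair mF F0; rewrite row_integralS.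
pose F' := (fun p : measurableTypeR R * k.-tuple R =>
  F (row_mx (p.1%:M : 'M[R]_1) (row_of_tuple p.2))).
by have := @iterated_integral_swap _ _ (measurableTypeR R) k mu F' mF (fun p => F0 _); rewrite /F'.
Qed.

Lemma row_integral_translate k (F : 'rV[R]_k -> \bar R) v :
  row_measurable F -> (forall x, (0 <= F x)%E) ->
  row_integral (fun x => F (x + v)%R) = row_integral F.
Proof.
elim: k F v => [|k IH] F v mF F0.
  by apply: eq_row_integral => x; congr F; rewrite [LHS]thinmx0 [RHS]thinmx0.
move: F v mF F0; change (k.+1) with (1 + k)%N => F v mF F0.
rewrite !row_integralS.
rewrite -[v]hsubmxK; set v1 := lsubmx v; set v2 := rsubmx v.
transitivity (\int[mu]_x
   row_integral (fun y => F (row_mx ((x + v1 0 0)%R%:M : 'M[R]_1) y)))%E.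
  apply: eq_integral => x _.
  rewrite -(IH (fun y => F (row_mx ((x + v1 0 0)%R%:M : 'M[R]_1) y)) v2)//.
    apply: eq_row_integral => y; rewrite add_row_mx; congr (F (row_mx _ _)).
    by apply/matrixP => i j; rewrite !ord1 !mxE eqxx.
  exact: row_measurable_row.
rewrite -[RHS](@ge0_integral_affine _ 1 (v1 0 0)) ?oner_eq0//.
- by rewrite normr1 mul1e; apply: eq_integral => x _; rewrite mul1r.
- exact: row_measurable_inner.
- by move=> x; apply: row_integral_ge0.
Qed.

(** The change of variables formula for [M], quantified over all integrands so that it is stable
    under products of matrices. *)
Definition integral_rescales k (M : 'M[R]_k) : Prop :=
  forall F, row_measurable F -> (forall x, (0 <= F x)%E) ->
  (`|\det M|%:E * row_integral (fun x => F (x *m M)))%E = row_integral F.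

Lemma integral_rescales_mul k (M N : 'M[R]_k) :
  integral_rescales M -> integral_rescales N -> integral_rescales (M *m N)%R.
Proof.
move=> gM gN F mF F0; rewrite det_mulmx normrM mulrC EFinM -muleA.
rewrite -[RHS]gN//; congr (_ * _)%E.
rewrite -(gM (fun x => F (x *m N)))//; last exact: row_measurable_mulmx.
by congr (_ * _)%E; apply: eq_row_integral => x; rewrite mulmxA.
Qed.

Lemma integral_rescales_ur k (r : 'rV[R]_k) :
  integral_rescales (block_mx (1%:M : 'M[R]_1) r 0 1%:M).
Proof.
move=> F mF F0; rewrite det_ublock !det1 mulr1 normr1 mul1e !row_integralS.
apply: eq_integral => x _.
rewrite -[RHS](@row_integral_translate _ _ (x *: r)%R)//; last first.
  exact: row_measurable_row.
apply: eq_row_integral => y; congr F.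
by rewrite mul_row_block mulmx0 !mulmx1 mul_scalar_mx addr0 addrC.
Qed.

(** This shear translates the first coordinate by an amount depending on the others, so the first
    coordinate has to be integrated innermost. *)
Lemma integral_rescales_dl k (c : 'cV[R]_k) :
  integral_rescales (block_mx (1%:M : 'M[R]_1) 0 c 1%:M).
Proof.
move=> F mF F0; rewrite det_lblock !det1 mulr1 normr1 mul1e.
rewrite !row_integral_swap//; last exact: row_measurable_mulmx.
apply: eq_row_integral => y.
rewrite -[RHS](@ge0_integral_affine _ 1 ((y *m c) 0 0)%R) ?oner_eq0//.
- rewrite normr1 mul1e; apply: eq_integral => x _; congr F.
  rewrite mul_row_block mulmx0 !mulmx1 add0r; congr row_mx.
  by apply/matrixP => i j; rewrite !ord1 !mxE mul1r mulr1n.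
- apply: (row_measurable_comp mF) => i.
  case: (split_ordP i) => j ->.
    rewrite (_ : (fun _ => _) = id) //.
    by apply/funext => p; rewrite row_mxEl (ord1 j) mxE.
  rewrite (_ : (fun _ => _) = cst (y 0 j)) //.
  by apply/funext => p; rewrite row_mxEr.
Qed.

Lemma integral_rescales_diag k (a : R) (D : 'M[R]_k) :
  a != 0%R -> integral_rescales D -> integral_rescales (block_mx (a%:M : 'M[R]_1) 0 0 D).
Proof.
move=> a0 gD F mF F0; rewrite det_ublock det_scalar1 normrM !row_integralS.
rewrite -[RHS](@ge0_integral_affine _ a 0)//; last 2 first.
- exact: row_measurable_inner.
- by move=> x; apply: row_integral_ge0.
rewrite EFinM -muleA; congr (_ * _)%E.
rewrite -ge0_integralZl//; last 2 first.
- apply: (@row_measurable_inner _ (fun x => F (x *m block_mx a%:M 0 0 D))) => //.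
  exact: row_measurable_mulmx.
- by move=> x _; apply: row_integral_ge0.
apply: eq_integral => x _.
rewrite -[RHS]gD//; last exact: row_measurable_row.
congr (_ * _)%E; apply: eq_row_integral => y; congr F.
rewrite mul_row_block !mulmx0 !addr0 add0r; congr row_mx.
by rewrite -scalar_mxM mulrC.
Qed.

(** Block elimination: when the corner entry is nonzero, [M] is the product of a lower shear, a
    block diagonal matrix containing the Schur complement, and an upper shear. *)
Theorem integral_rescalesT k (M : 'M[R]_k) :
  M \in unitmx -> integral_rescales M.
Proof.
elim: k M => [|k IH] M uM.
  move=> F mF F0; rewrite det_mx00 normr1 mul1e; apply: eq_row_integral => x.
  by congr F; rewrite [LHS]thinmx0 [RHS]thinmx0.
move: M uM; change (k.+1) with (1 + k)%N => M uM.
wlog a0 : M uM / M 0 0 != 0%R.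
  move=> wl; have [a0|a0] := eqVneq (M 0 0) 0%R; last exact: wl.
  have [i Mi0] : exists i, M i 0 != 0%R.
    apply/existsP; apply: contraLR uM => /existsPn M0.
    rewrite unitmxE unitfE negbK (expand_det_col _ 0) big1// => i _.
    by move: (M0 i); rewrite negbK => /eqP ->; rewrite mul0r.
  case: (split_ordP i) Mi0 => j -> Mi0.
    by move: Mi0; rewrite (ord1 j) (_ : lshift k 0 = 0%R) ?a0 ?eqxx//; exact/val_inj.
  pose T (r : 'rV[R]_k) : 'M[R]_(1 + k) := block_mx (1%:M : 'M[R]_1) r 0 1%:M.
  have TT r s : (T r *m T s = T (r + s))%R.
    rewrite /T mulmx_block !mulmx1 !mul1mx !mul0mx !mulmx0 !addr0 !add0r addrC.
    by [].
  have T0 : T 0%R = 1%:M by rewrite /T -scalar_mx_block.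
  (* The corner is zero but the entry below it in row j is not: adding that row to the first one, an
     upper shear, repairs the corner. *)
  pose r : 'rV[R]_k := delta_mx 0 j.
  rewrite -[M]mul1mx -T0 -(addNr r) -TT -mulmxA.
  apply: integral_rescales_mul; first exact: integral_rescales_ur.
  apply: wl.
    by rewrite unitmx_mul uM andbT unitmxE det_ublock !det1 mulr1 unitr1.
  have <- : M (rshift 1 j) 0%R = (T r *m M) 0%R 0%R => //.
  rewrite -{2}[M]submxK mulmx_block; set z := (X in X 0%R 0%R).
  rewrite /z (_ : 0%R = lshift k (0%R : 'I_1) :> 'I_(1 + k)); last exact/val_inj.
  rewrite block_mxEul mul1mx -rowE !mxE.
  by rewrite (_ : lshift k (0%R : 'I_1) = 0%R) ?a0 ?add0r//; exact/val_inj.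
set a := M 0 0.
have aE : ulsubmx M = a%:M.
  apply/matrixP => i j; rewrite !ord1 !mxE /a mulr1n; congr (M _ _); exact/val_inj.
pose r := ursubmx M; pose c := dlsubmx M; pose D := drsubmx M.
pose D' := (D - a^-1 *: (c *m r))%R.
have ME : M = (block_mx (1%:M : 'M[R]_1) 0 (a^-1 *: c) 1%:M *m
   block_mx (a%:M : 'M[R]_1) 0 0 D' *m
   block_mx (1%:M : 'M[R]_1) (a^-1 *: r) 0 1%:M)%R.
  rewrite !mulmx_block !mulmx1 !mul1mx !mul0mx !mulmx0 !addr0 !add0r.
  rewrite -{1}[M]submxK aE mul_scalar_mx mul_mx_scalar !scalerA divff// !scale1r.
  by rewrite -scalemxAr /D' addrC subrK.
have uD : D' \in unitmx.
  move: uM; rewrite ME !unitmx_mul => /andP[/andP[_ +] _].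
  by rewrite unitmxE det_ublock unitrM => /andP[].
rewrite ME; apply: integral_rescales_mul; last exact: integral_rescales_ur.
apply: integral_rescales_mul; first exact: integral_rescales_dl.
by apply: integral_rescales_diag => //; exact: IH.
Qed.

End RowIntegral.

(** * Hyperplanes are negligible *)

Section NullHyperplanes.
Context {R : realType}.
Local Notation mu := (@lebesgue_measure R).

Lemma measurable_forallb d (T : measurableType d) (I : finType)
    (b : I -> T -> bool) :
  (forall i, measurable_fun setT (b i)) ->
  measurable_fun setT (fun x => [forall i, b i x]).
Proof.
move=> mb; rewrite (_ : (fun _ => _) = fun x => all (b^~ x) (enum I)).
  elim: (enum I) => [|i s IH] /=; first exact: measurable_cst.
  exact: measurable_and.
apply/funext => x; apply/forallP/allP => [bx i _|bx i]; first exact: bx.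
by apply: bx; rewrite mem_enum.
Qed.

Lemma row_measurable_if d (T : measurableType d) k (b : 'rV[R]_k -> bool)
    (f g : 'rV[R]_k -> T) :
  row_measurable b ->
  row_measurable f -> row_measurable g ->
  row_measurable (fun x => if b x then f x else g x).
Proof. by move=> mb mf mg; apply: measurable_fun_ifT. Qed.

Lemma row_measurable_cst d (T : measurableType d) k (c : T) :
  row_measurable (fun _ : 'rV[R]_k => c).
Proof. exact: measurable_cst. Qed.

Lemma measurable_form k (w : 'cV[R]_k) :
  row_measurable (fun x => (x *m w) 0 0).
Proof.
rewrite /row_measurable (_ : (fun _ => _) =
  (fun t => \sum_j (row_of_tuple t 0 j * w j 0))).
  apply: measurable_sum => j; apply: measurable_funM => //.
  exact: measurable_coord.
by apply/funext => t; rewrite !mxE.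
Qed.

(** Expresses null sets through the iterated integral alone. Added to an upper bound, this function
    makes an inequality trivial on the hyperplane without changing the integral of the bound. The
    constant [c] is there for induction on the dimension: slices of a linear hyperplane are
    affine. *)
Definition hyperplane_infty k (w : 'cV[R]_k) (c : R) (x : 'rV[R]_k) : \bar R :=
  if (x *m w) 0 0 + c == 0 then +oo%E else 0%E.

Lemma hyperplane_infty_ge0 k (w : 'cV[R]_k) c x : (0 <= hyperplane_infty w c x)%E.
Proof. by rewrite /hyperplane_infty; case: ifP => // _; rewrite leey. Qed.

Lemma row_measurable_hyperplane_infty k (w : 'cV[R]_k) c :
  row_measurable (hyperplane_infty w c).
Proof.
apply: row_measurable_if; [|exact: row_measurable_cst..].
apply: measurable_fun_eqr => //; apply: measurable_funD => //.
exact: measurable_form.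
Qed.

Lemma integral_point_infty (a b : R) : a != 0 ->
  (\int[mu]_x (if (a * x + b)%R == 0%R then +oo else 0))%E = 0%E.
Proof.
move=> a0; rewrite -[RHS](integral_set1 (fun=> +oo%E) (- b / a)).
rewrite [RHS]integral_mkcond; apply: eq_integral => x _.
rewrite patchE; have -> : (x \in [set (- b / a)]%classic) = (a * x + b == 0).
  apply/idP/eqP => [/set_mem ->|]; first by field.
  move=> /eqP; rewrite addr_eq0 => /eqP xE; apply/mem_set => /=.
  by rewrite -xE; field.
by [].
Qed.

Lemma row_integral_hyperplane_infty k (w : 'cV[R]_k) c :
  w != 0 -> row_integral (hyperplane_infty w c) = 0%E.
Proof.
elim: k w c => [|k IH] w c; first by rewrite [w]flatmx0 eqxx.
move: w; change (k.+1) with (1 + k)%N => w w0.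
rewrite row_integralS -[w]vsubmxK; set w1 := usubmx w; set w2 := dsubmx w.
have split_w x (y : 'rV_k) :
    ((row_mx x%:M y *m col_mx w1 w2) 0 0 + c = (y *m w2) 0 0 + (w1 0 0 * x + c))%R.
  by rewrite mul_row_col mul_scalar_mx mxE [(x *: w1)%R 0 0]mxE; ring.
have [w20|w20] := eqVneq w2 0; last first.
  transitivity (\int[mu]_x 0)%E; last exact: integral0.
  apply: eq_integral => x _; rewrite -[RHS](IH w2 (w1 0 0 * x + c) w20).
  by apply: eq_row_integral => y; rewrite /hyperplane_infty split_w.
have w10 : w1 0 0 != 0.
  apply: contra_neq w0 => w10; rewrite -[w]vsubmxK -/w1 -/w2 w20.
  by rewrite (_ : w1 = 0) ?col_mx0//; apply/matrixP => i j; rewrite !ord1 w10 mxE.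
(* Here the condition involves the first coordinate only: the inner integral is possibly infinite,
   but it is multiplied by the indicator of one point, and [+oo * 0] is 0. *)
transitivity (\int[mu]_x (row_integral (fun _ : 'rV[R]_k => +oo) *
    (if (w1 0 0 * x + c)%R == 0%R then +oo else 0)))%E.
  apply: eq_integral => x _; rewrite /hyperplane_infty.
  under eq_row_integral do rewrite split_w w20 mulmx0 mxE add0r.
  case: ifP => _; last by rewrite mule0 /row_integral iterated_integral0.
  have yy : (+oo = +oo * +oo :> \bar R)%E by rewrite mulyy.
  by rewrite muleC -ge0_iterated_integralZ// -yy.
rewrite ge0_integralZl//.
- by rewrite integral_point_infty// mule0.
- apply: measurable_fun_ifT => //; apply: measurable_fun_eqr => //.
  by apply: measurable_funD => //; apply: measurable_funM.
- by move=> x _; case: ifP => // _; rewrite leey.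
- by apply: row_integral_ge0 => x; rewrite leey.
Qed.

(** Each functional of [L] is removed by adding its [hyperplane_infty] to the larger function, so on
    that hyperplane nothing remains to be compared. *)
Lemma row_integral_le_off_hyperplanes k (L : seq ('cV[R]_k))
    (F H : 'rV[R]_k -> \bar R) :
  (forall w, w \in L -> w != 0) ->
  row_measurable F -> row_measurable H ->
  (forall x, 0 <= F x)%E -> (forall x, 0 <= H x)%E ->
  (forall x, (forall w, w \in L -> (x *m w) 0 0 != 0) -> (F x <= H x)%E) ->
  (row_integral F <= row_integral H)%E.
Proof.
elim: L H => [|w L IH] H L0 mF mH F0 H0 FH.
  by apply: ge0_le_iterated_integral => // t; apply: FH.
have <- : row_integral (fun x => H x + hyperplane_infty w 0 x)%E = row_integral H.
  rewrite /row_integral ge0_iterated_integralD//.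
  - rewrite [X in (_ + X)%E](_ : _ = row_integral (hyperplane_infty w 0)) //.
    by rewrite row_integral_hyperplane_infty ?adde0// L0// mem_head.
  - exact: row_measurable_hyperplane_infty.
  - by move=> t; exact: hyperplane_infty_ge0.
apply: IH => //.
- by move=> v vL; apply: L0; rewrite inE vL orbT.
- apply: emeasurable_funD => //; exact: row_measurable_hyperplane_infty.
- by move=> x; rewrite adde_ge0// hyperplane_infty_ge0.
move=> x xL; rewrite /hyperplane_infty addr0; case: ifPn => [_|xw].
  by rewrite addey ?leey// gt_eqF// (lt_le_trans _ (H0 x)).
rewrite adde0; apply: FH => v; rewrite inE => /orP[/eqP ->//|]; exact: xL.
Qed.

Lemma eq_row_integral_off_hyperplanes k (L : seq ('cV[R]_k))
    (F H : 'rV[R]_k -> \bar R) :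
  (forall w, w \in L -> w != 0) ->
  row_measurable F -> row_measurable H ->
  (forall x, 0 <= F x)%E -> (forall x, 0 <= H x)%E ->
  (forall x, (forall w, w \in L -> (x *m w) 0 0 != 0) -> F x = H x) ->
  row_integral F = row_integral H.
Proof.
move=> L0 mF mH F0 H0 FH; apply/eqP; rewrite eq_le.
by apply/andP; split; apply: row_integral_le_off_hyperplanes L0 _ _ _ _ _ => // x xL;
  rewrite FH.
Qed.

End NullHyperplanes.

(** * Cones over simplices and Gaussian integrals *)

Section Radial.
Context {R : realType}.
Local Notation mu := (@lebesgue_measure R).

Lemma measurable_fun_expR d (T : measurableType d) (f : T -> R) :
  measurable_fun setT f -> measurable_fun setT (fun x => expR (f x)).
Proof. by move=> mf; apply: measurableT_comp. Qed.

(** Its integral is half of the Gamma function at (k+1)/2. *)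
Definition radial_integrand k (r : R) : R :=
  if 0 < r then r ^+ k * expR (- r ^+ 2) else 0.

Definition radial_integral k : \bar R :=
  (\int[mu]_r (radial_integrand k r)%:E)%E.

Lemma radial_integrand_ge0 k r : 0 <= radial_integrand k r.
Proof.
rewrite /radial_integrand; case: ifP => // r0.
by rewrite mulr_ge0 ?expR_ge0// exprn_ge0// ltW.
Qed.

Lemma measurable_radial_integrand k : measurable_fun setT (radial_integrand k).
Proof.
apply: measurable_fun_ifT => //.
  by apply: measurable_fun_ltr.
apply: measurable_funM; first exact: measurable_funX.
apply: measurable_fun_expR.
by apply: measurable_funN; exact: measurable_funX.
Qed.

Lemma radial_integral_scale k (s : R) : 0 < s ->
  (radial_integral k * (s ^- k.+1)%:E =
   \int[mu]_r (if 0 < r then r ^+ k * expR (- (r * s) ^+ 2) else 0)%R%:E)%E.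
Proof.
move=> s0; have sN0 : s != 0 by rewrite gt_eqF.
rewrite /radial_integral -(@ge0_integral_affine _ s 0)//; last 2 first.
- by apply/measurable_EFinP; exact: measurable_radial_integrand.
- by move=> r; rewrite lee_fin radial_integrand_ge0.
rewrite gtr0_norm// muleAC -EFinM -ge0_integralZl//; last 3 first.
- apply/measurable_EFinP; apply: (measurableT_comp (measurable_radial_integrand k)).
  exact: measurable_affine.
- by move=> r _; rewrite lee_fin radial_integrand_ge0.
- by rewrite lee_fin mulr_ge0 ?invr_ge0 ?exprn_ge0 ?ltW.
apply: eq_integral => r _; rewrite -EFinM; congr EFin.
rewrite addr0 /radial_integrand pmulr_rgt0//; case: ifP => _; last by rewrite mulr0.
by rewrite exprSr invfM mulrA exprMn [s * r]mulrC; field; rewrite sN0 expf_neq0.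
Qed.

Definition simplex_dom k (t : 'rV[R]_k) : bool :=
  [forall i, 0 <= t 0 i] && (\sum_i t 0 i <= 1).

(** The closed orthant without its apex, so that a definite form is strictly positive on it. *)
Definition orthant k (z : 'rV[R]_k) : bool :=
  [forall i, 0 <= z 0 i] && (0 < \sum_i z 0 i).

Definition barycentric k (t : 'rV[R]_k) : 'rV[R]_(1 + k) :=
  row_mx (1 - \sum_i t 0 i)%:M t.

Lemma row_measurable_sum k : row_measurable (fun t : 'rV[R]_k => \sum_i t 0 i).
Proof. by apply: measurable_sum => i; exact: measurable_coord. Qed.

Lemma row_measurable_nonneg k :
  row_measurable (fun t : 'rV[R]_k => [forall i, 0 <= t 0 i]).
Proof.
apply: measurable_forallb => i; apply: measurable_fun_ler => //.
exact: measurable_coord.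
Qed.

Lemma row_measurable_simplex k : row_measurable (@simplex_dom k).
Proof.
apply: measurable_and; first exact: row_measurable_nonneg.
by apply: measurable_fun_ler => //; exact: row_measurable_sum.
Qed.

Lemma row_measurable_orthant k : row_measurable (@orthant k).
Proof.
apply: measurable_and; first exact: row_measurable_nonneg.
by apply: measurable_fun_ltr => //; exact: row_measurable_sum.
Qed.

Lemma barycentric_linear k (t : 'rV[R]_k) :
  barycentric t = t *m row_mx (const_mx (-1)) 1%:M + row_mx 1%:M 0.
Proof.
rewrite mul_mx_row mulmx1 add_row_mx addr0 /barycentric; congr row_mx.
apply/matrixP => i j; rewrite !ord1 !mxE eqxx addrC; congr (_ + _).
by rewrite -sumrN; apply: eq_bigr => l _; rewrite mxE mulrN1.
Qed.

Lemma row_measurable_barycentric d (T : measurableType d) k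
    (F : 'rV[R]_(1 + k) -> T) :
  row_measurable F -> row_measurable (fun t => F (barycentric t)).
Proof.
move=> mF; rewrite (_ : (fun _ => _) = fun t : 'rV[R]_k =>
    F (t *m row_mx (const_mx (-1)) 1%:M + row_mx 1%:M 0)).
  exact: row_measurable_linear.
by apply/funext => t; rewrite barycentric_linear.
Qed.

Lemma row_measurable_rsub d (T : measurableType d) k (F : 'rV[R]_k -> T) :
  row_measurable F -> row_measurable (fun z : 'rV[R]_(1 + k) => F (rsubmx z)).
Proof.
move=> mF; rewrite (_ : (fun _ => _) = fun z : 'rV[R]_(1 + k) =>
    F (z *m col_mx 0 1%:M)).
  exact: row_measurable_mulmx.
apply/funext => z.
by rewrite -{2}[z]hsubmxK mul_row_col mulmx0 mulmx1 add0r.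
Qed.

Variables (k : nat) (rho : 'rV[R]_(1 + k) -> R).
Hypothesis rho_meas : row_measurable rho.
Hypothesis rho_hom : forall c x, rho (c *: x) = c ^+ 2 * rho x.
Hypothesis rho_pos : forall t, simplex_dom t -> 0 < rho (barycentric t).

Let G (z : 'rV[R]_(1 + k)) : \bar R :=
  (if orthant z then expR (- rho z) else 0)%:E.

(** Maps (r, y) to the point with coordinates r - sum y, y. Thus r becomes the sum of the
    coordinates, at Jacobian 1. *)
Let M : 'M[R]_(1 + k) := block_mx 1%:M 0 (const_mx (-1)) 1%:M.

Let H z := G (z *m M).

Let K (z : 'rV[R]_(1 + k)) : \bar R :=
  (if (0 < z 0 0) && simplex_dom (rsubmx z)
   then z 0 0 ^+ k * expR (- ((z 0 0) ^+ 2 * rho (barycentric (rsubmx z))))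
   else 0)%:E.

Let G_ge0 z : (0 <= G z)%E.
Proof. by rewrite /G lee_fin; case: ifP => // _; exact: expR_ge0. Qed.

Let K_ge0 z : (0 <= K z)%E.
Proof.
rewrite /K lee_fin; case: ifP => // /andP[z0 _].
by rewrite mulr_ge0 ?expR_ge0// exprn_ge0// ltW.
Qed.

Let mG : row_measurable G.
Proof.
apply/measurable_EFinP; apply: measurable_fun_ifT.
- exact: row_measurable_orthant.
- apply: measurable_fun_expR; exact: measurable_funN.
- exact: measurable_cst.
Qed.

Let mK : row_measurable K.
Proof.
apply/measurable_EFinP; apply: measurable_fun_ifT.
- apply: measurable_and.
    by apply: measurable_fun_ltr => //; exact: measurable_coord.
  exact: (row_measurable_rsub (@row_measurable_simplex k)).
- apply: measurable_funM.
    by apply: measurable_funX; exact: measurable_coord.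
  apply: measurable_fun_expR; apply: measurable_funN.
  apply: measurable_funM; first by apply: measurable_funX; exact: measurable_coord.
  exact: (row_measurable_rsub (row_measurable_barycentric rho_meas)).
- exact: measurable_cst.
Qed.

Let row0 (r : R) (y : 'rV[R]_k) : (row_mx r%:M y : 'rV[R]_(1 + k)) 0 0 = r.
Proof.
have -> : (0 : 'I_(1 + k)) = lshift k (0 : 'I_1) by exact/val_inj.
by rewrite row_mxEl mxE.
Qed.

Let HE (r : R) (y : 'rV[R]_k) :
  H (row_mx r%:M y) = (if [&& 0 < r, [forall i, 0 <= y 0 i] & \sum_i y 0 i <= r]
    then expR (- rho (row_mx (r - \sum_i y 0 i)%:M y)) else 0)%:E.
Proof.
rewrite /H /G /M mul_row_block mulmx0 !mulmx1 add0r.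
have -> : r%:M + y *m const_mx (-1) = (r - \sum_i y 0 i)%:M :> 'M[R]_1.
  apply/matrixP => i j; rewrite !ord1 !mxE eqxx !mulr1n; congr (_ + _).
  by rewrite -sumrN; apply: eq_bigr => l _; rewrite mxE mulrN1.
congr (if _ then _ else _)%:E; rewrite /orthant.
have -> : \sum_i row_mx (r - \sum_j y 0 j)%:M y 0 i = r.
  rewrite big_split_ord big_ord1 row_mxEl mxE eqxx mulr1n /=.
  rewrite -[RHS](subrK (\sum_i y 0 i)); congr (_ + _).
  by apply: eq_bigr => i _; rewrite row_mxEr.
rewrite andbC; congr (_ && _).
apply/forallP/andP => [y0|[/forallP y0 yr] i].
  split; first by apply/forallP => i; have := y0 (rshift 1 i); rewrite row_mxEr.
  by have := y0 (lshift k 0); rewrite row_mxEl mxE eqxx mulr1n subr_ge0.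
case: (split_ordP i) => j ->; first by rewrite row_mxEl ord1 mxE eqxx mulr1n subr_ge0.
by rewrite row_mxEr.
Qed.

Lemma measurable_radial_density :
  row_measurable (fun t =>
    if simplex_dom t then Num.sqrt (rho (barycentric t)) ^- k.+1 else 0).
Proof.
rewrite /row_measurable (_ : (fun _ => _) =
  (fun t : k.-tuple R => if simplex_dom (row_of_tuple t)
     then (rho (barycentric (row_of_tuple t))) `^ (- (k.+1%:R / 2)) else 0)).
  apply: measurable_fun_ifT.
  - exact: row_measurable_simplex.
  - apply: (measurableT_comp (measurable_powR _)).
    exact: (row_measurable_barycentric rho_meas).
  - exact: measurable_cst.
apply/funext => t; case: ifP => // /rho_pos r0.
by rewrite powRN -powR12_sqrt ?ltW// -powR_mulrn ?powR_ge0// -powRrM mulrC.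
Qed.

(** Polar coordinates adapted to a simplex: z = r * [barycentric t] with r the sum of the
    coordinates of z. The Jacobian is r^k; by homogeneity of [rho], the integral over r is the
    standard radial integral times [rho] to the power -(k+1)/2. *)
Lemma radial_decomposition :
  (row_integral (fun z => (if orthant z then expR (- rho z) else 0)%R%:E) =
  radial_integral k *
  row_integral (fun t =>
    (if simplex_dom t then Num.sqrt (rho (barycentric t)) ^- k.+1 else 0)%R%:E))%E.
Proof.
transitivity (row_integral H).
  rewrite -(integral_rescales_dl (const_mx (-1)) mG)//.
  by rewrite det_lblock !det1 mulr1 normr1 mul1e.
transitivity (row_integral K).
  rewrite !row_integralS; apply: eq_integral => r _.
  (* For r <= 0 both integrands vanish. For r > 0 the substitution y = r t has Jacobian r^k. *)
  have [r0|r0] := ltP 0 r; last first.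
    apply: eq_row_integral => y; rewrite HE /K row0.
    by rewrite ltNge r0.
  have ur : (r%:M : 'M[R]_k) \in unitmx.
    by rewrite unitmxE det_scalar unitfE expf_neq0// gt_eqF.
  rewrite -(integral_rescalesT ur); last 2 first.
  - by apply: row_measurable_row; exact: row_measurable_mulmx.
  - by move=> y; exact: G_ge0.
  rewrite /row_integral -ge0_iterated_integralZ//; last 2 first.
  - have := @row_measurable_mulmx _ _ _ _ _ (fun y => H (row_mx r%:M y)) r%:M.
    apply; apply: row_measurable_row; exact: row_measurable_mulmx.
  - by move=> y; exact: G_ge0.
  apply: eq_iterated_integral => t; move: (row_of_tuple t) => y.
  rewrite HE /K row0 row_mxKr r0 /= mul_mx_scalar det_scalar -EFinM; congr EFin.
  have sumE : \sum_i (r *: y) 0 i = r * \sum_i y 0 i.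
    by rewrite mulr_sumr; apply: eq_bigr => i _; rewrite mxE.
  have -> : [forall i, 0 <= (r *: y) 0 i] && (\sum_i (r *: y) 0 i <= r) =
            simplex_dom y.
    rewrite /simplex_dom sumE -[X in _ * _ <= X]mulr1 ler_pM2l//; congr (_ && _).
    by apply: eq_forallb => i; rewrite mxE pmulr_rge0.
  case: ifP => _; last by rewrite mulr0.
  rewrite normrX gtr0_norm//; congr (_ * expR (- _)).
  rewrite -rho_hom sumE; congr rho; rewrite /barycentric scale_row_mx.
  congr row_mx; apply/matrixP => i j; rewrite !ord1 !mxE; ring.
rewrite row_integral_swap//.
rewrite /row_integral -ge0_iterated_integralZ//.
- apply: eq_iterated_integral => t; move: (row_of_tuple t) => y.
  have [sy|sy] := boolP (simplex_dom y); last first.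
    rewrite mule0; under eq_integral do rewrite /K row_mxKr (negbTE sy) andbF.
    by rewrite integral0.
  rewrite radial_integral_scale ?sqrtr_gt0 ?rho_pos//.
  apply: eq_integral => r _; rewrite /K row_mxKr sy row0 andbT.
  by rewrite exprMn sqr_sqrtr// ltW// rho_pos.
- by apply: integral_ge0 => r _; rewrite lee_fin radial_integrand_ge0.
- by apply/measurable_EFinP; exact: measurable_radial_density.
- by move=> t; rewrite lee_fin; case: ifP => // _; rewrite invr_ge0 exprn_ge0.
Qed.

End Radial.

(** * Gaussian integrals over the whole space *)

Section Gauss.
Context {R : realType}.
Local Notation mu := (@lebesgue_measure R).

Lemma measurable_fun_sumsq k :
  row_measurable (fun x : 'rV[R]_k => expR (- \sum_i x 0 i ^+ 2)).
Proof.
apply: measurable_fun_expR; apply: measurable_funN; apply: measurable_sum => i.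
by apply: measurable_funX; exact: measurable_coord.
Qed.

Lemma row_integral_product k (f : R -> R) (g : 'rV[R]_k -> R) :
  measurable_fun setT f -> row_measurable g -> (forall x, 0 <= f x) ->
  (forall y, 0 <= g y) ->
  row_integral (fun z : 'rV[R]_(1 + k) => (f (z 0 0) * g (rsubmx z))%:E) =
  ((\int[mu]_x (f x)%:E) * row_integral (fun y => (g y)%:E))%E.
Proof.
move=> mf mg f0 g0; rewrite row_integralS muleC -ge0_integralZl//; last 3 first.
- exact/measurable_EFinP.
- by move=> x _; rewrite lee_fin.
- by apply: row_integral_ge0 => y; rewrite lee_fin.
apply: eq_integral => x _; rewrite muleC /row_integral -ge0_iterated_integralZ//.
- apply: eq_iterated_integral => t; rewrite row_mxKr EFinM; congr ((f _)%:E * _)%E.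
  have -> : (0 : 'I_(1 + k)) = lshift k (0 : 'I_1) by exact/val_inj.
  by rewrite row_mxEl mxE eqxx mulr1n.
- by rewrite lee_fin.
- exact/measurable_EFinP.
- by move=> t; rewrite lee_fin.
Qed.

Lemma row_integral_gauss k :
  row_integral (fun x : 'rV[R]_k => (expR (- \sum_i x 0 i ^+ 2))%:E) =
  (Num.sqrt pi ^+ k)%:E.
Proof.
elim: k => [|k IH]; first by rewrite /row_integral /= big_ord0 oppr0 expR0 expr0.
change (k.+1) with (1 + k)%N.
rewrite (eq_row_integral (H := fun z : 'rV[R]_(1 + k) =>
  (gauss_fun (z 0 0) * expR (- \sum_i rsubmx z 0 i ^+ 2))%:E)); last first.
  move=> z; rewrite /gauss_fun -expRD; congr (expR _)%:E.
  rewrite big_split_ord big_ord1 opprD; congr (- z _ _ ^+ 2 - _).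
    exact/val_inj.
  by apply: eq_bigr => i _; rewrite mxE.
rewrite (row_integral_product (f := @gauss_fun R)
  (g := fun y => expR (- \sum_i y 0 i ^+ 2))).
- by rewrite IH integralT_gauss -EFinM -exprS.
- exact: measurable_gauss_fun.
- exact: measurable_fun_sumsq.
- exact: gauss_fun_ge0.
- by move=> y; exact: expR_ge0.
Qed.

Lemma row_measurable_quadratic k (S : 'M[R]_k) :
  row_measurable (fun y : 'rV[R]_k => (y *m S *m y^T) 0 0).
Proof.
rewrite /row_measurable (_ : (fun _ => _) = fun t => \sum_j
  (row_of_tuple t *m (S *m delta_mx j 0 : 'cV_k)) 0 0 * (row_of_tuple t) 0 j).
  apply: measurable_sum => j; apply: measurable_funM.
    exact: measurable_form.
  exact: measurable_coord.
apply/funext => t; rewrite mxE; apply: eq_bigr => j _; rewrite mulmxA -colE.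
by rewrite !mxE.
Qed.

(** [S] is the Gram matrix of k vectors of a (k+1)-dimensional space. Adding a unit normal as an
    extra row makes the matrix of vectors square, with determinant of absolute value
    [Num.sqrt (\det S)]. The substitution takes place in dimension k+1, and the Gaussian integral
    along the normal is cancelled at the end. *)
Lemma row_integral_gauss_gram k (S : 'M[R]_k) (A : 'M[R]_(1 + k)) :
  0 < \det S -> A *m A^T = block_mx 1%:M 0 0 S ->
  ((Num.sqrt (\det S))%:E *
    row_integral (fun y : 'rV[R]_k => (expR (- (y *m S *m y^T) 0 0))%:E))%E =
  (Num.sqrt pi ^+ k)%:E.
Proof.
move=> S0 AA.
have detA : `|\det A| = Num.sqrt (\det S).
  rewrite -sqrtr_sqr expr2 -{2}[\det A]det_tr -det_mulmx AA det_ublock det1 mul1r.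
  by [].
have uA : A \in unitmx.
  by rewrite unitmxE unitfE -normr_eq0 detA sqrtr_eq0 -ltNge.
have mS : row_measurable (fun y : 'rV[R]_k => expR (- (y *m S *m y^T) 0 0)).
  apply: measurable_fun_expR; apply: measurable_funN.
  exact: row_measurable_quadratic.
have mF : row_measurable (fun x : 'rV[R]_(1 + k) => (expR (- \sum_i x 0 i ^+ 2))%:E).
  by apply/measurable_EFinP; exact: measurable_fun_sumsq.
have F0 (x : 'rV[R]_(1 + k)) : (0 <= (expR (- \sum_i x 0 i ^+ 2))%:E)%E.
  by rewrite lee_fin expR_ge0.
have := integral_rescalesT uA mF F0.
rewrite row_integral_gauss detA.
rewrite (eq_row_integral (F := fun x => (expR (- \sum_i (x *m A) 0 i ^+ 2))%:E)
  (H := fun z : 'rV[R]_(1 + k) =>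
  (gauss_fun (z 0 0) * expR (- (rsubmx z *m S *m (rsubmx z)^T) 0 0))%:E)); last first.
  move=> z; rewrite /gauss_fun -expRD; congr (expR _)%:E.
  transitivity (- (z *m (A *m A^T) *m z^T) 0 0).
    rewrite -mulmxA -mulmxA mulmxA -trmx_mul [X in - X = _](_ : _ =
      (z *m A *m (z *m A)^T) 0 0)//; last first.
      by rewrite [RHS]mxE; apply: eq_bigr => i _; rewrite [_^T _ _]mxE expr2.
  rewrite AA -{1 2}[z]hsubmxK mul_row_block !mulmx0 addr0 add0r mulmx1.
  rewrite tr_row_mx mul_row_col mxE opprD; congr (- _ - _).
  rewrite mxE big_ord1 !mxE expr2.
  by rewrite (_ : lshift k (0 : 'I_1) = 0 :> 'I_(1 + k)) //; exact/val_inj.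
rewrite (row_integral_product (f := @gauss_fun R)
  (g := fun y => expR (- (y *m S *m y^T) 0 0)))//; last 2 first.
- exact: measurable_gauss_fun.
- exact: gauss_fun_ge0.
have sp : 0 < Num.sqrt pi :> R by rewrite sqrtr_gt0 pi_gt0.
rewrite integralT_gauss muleCA exprS EFinM => H.
have := congr1 (fun x => ((Num.sqrt pi)^-1%:E * x)%E) H.
by rewrite !muleA -!EFinM mulVf ?gt_eqF// !mul1r.
Qed.

End Gauss.

(** * The radial integral: positivity, finiteness, relation to Gamma *)

Section RadialGamma.
Context {R : realType}.
Local Notation mu := (@lebesgue_measure R).

Lemma radial_integral_itv k :
  @radial_integral R k =
  (\int[mu]_(r in `]0%R, +oo[) (r ^+ k * expR (- r ^+ 2))%R%:E)%E.
Proof.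
rewrite [RHS]integral_mkcond; apply: eq_integral => r _.
rewrite patchE /radial_integrand.
have -> : (r \in `]0%R, +oo[%classic) = (0 < r).
  by rewrite mem_setE in_itv/= andbT.
by case: ifP.
Qed.

Lemma radial_integral_gt0 k : (0 < @radial_integral R k)%E.
Proof.
rewrite radial_integral_itv.
have mf : measurable_fun setT (fun r : R => (r ^+ k * expR (- r ^+ 2))%:E).
  apply/measurable_EFinP; apply: measurable_funM; first exact: measurable_funX.
  by apply: measurable_fun_expR; apply: measurable_funN; exact: measurable_funX.
apply: (@lt_le_trans _ _ (\int[mu]_(r in `[1%R, 2%R]) (expR (- 4))%R%:E)%E).
  rewrite integral_cst//= lebesgue_measure_itv/= lte_fin ltr1n/= -EFinB -EFinM.
  by rewrite lte_fin mulr_gt0 ?expR_gt0//; lra.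
apply: (@le_trans _ _ (\int[mu]_(r in `[1%R, 2%R]) (r ^+ k * expR (- r ^+ 2))%R%:E)%E).
  apply: ge0_le_integral => //.
  - exact: measurable_funTS.
  - move=> r /=; rewrite in_itv/= => /andP[r1 r2]; rewrite lee_fin.
    rewrite -[leLHS]mul1r ler_pM// ?expR_ge0//; first exact: exprn_ege1.
    by rewrite ler_expR lerN2; nra.
apply: ge0_subset_integral => //.
- exact: measurable_funTS.
- move=> r /=; rewrite in_itv/= andbT => r0; rewrite lee_fin.
  by rewrite mulr_ge0 ?expR_ge0// exprn_ge0// ltW.
- by move=> r /=; rewrite !in_itv/= andbT => /andP[r1 _]; lra.
Qed.

(** For k > 0 one has r <= k + r^2/2 = k (1 + r^2/(2k)) <= k exp(r^2/(2k)); then take k-th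
    powers. *)
Lemma exprn_le_expR k (r : R) : 0 <= r ->
  r ^+ k <= (k%:R) ^+ k * expR (r ^+ 2 / 2).
Proof.
move=> r0; case: k => [|k]; first by rewrite !expr0 mul1r -expR0 ler_expR mulr_ge0 ?sqr_ge0.
have k0 : 0 < k.+1%:R :> R by rewrite ltr0n.
have -> : expR (r ^+ 2 / 2) = expR (r ^+ 2 / 2 / k.+1%:R) ^+ k.+1.
  by rewrite -expRM_natl; congr expR; field; rewrite ?nat1r gt_eqF.
rewrite -exprMn ler_pXn2r ?nnegrE//.
apply: (@le_trans _ _ (k.+1%:R * (1 + r ^+ 2 / 2 / k.+1%:R))); last first.
  by rewrite ler_pM2l// expR_ge1Dx.
rewrite mulrDr mulr1 mulrC divfK ?gt_eqF//.
have : 1 <= k.+1%:R :> R by rewrite ler1n.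
nra.
Qed.

(** The integrand is at most k^k exp(- r^2/2), a Gaussian rescaled by the square root of 2. *)
Lemma radial_integral_lty k : (@radial_integral R k < +oo)%E.
Proof.
have mg : measurable_fun setT (fun x : R => (gauss_fun x)%:E).
  by apply/measurable_EFinP; exact: measurable_gauss_fun.
have mgs : measurable_fun setT
    (fun x : R => (gauss_fun ((Num.sqrt 2)^-1 * x + 0))%:E).
  apply/measurable_EFinP; apply: measurable_fun_expR; apply: measurable_funN.
  by apply: measurable_funX; apply: measurable_funD => //; apply: measurable_funM.
have fin : ((k%:R ^+ k)%:E * \int[mu]_x (gauss_fun ((Num.sqrt 2)^-1 * x + 0))%:E < +oo :> \bar R)%E.
  have s0 : 0 < (Num.sqrt 2)^-1 :> R by rewrite invr_gt0 sqrtr_gt0.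
  have := @ge0_integral_affine R (Num.sqrt 2)^-1 0 (fun x : R => (gauss_fun x)%:E).
  rewrite gt_eqF// => /(_ isT mg (fun x => gauss_fun_ge0 x)).
  rewrite integralT_gauss.
  case: (\int[mu]_x _)%E => [x|/=|/=].
  - by move=> _; rewrite -EFinM ltry.
  - by rewrite gt0_muley// lte_fin gtr0_norm.
  - by rewrite gt0_muleNy// lte_fin gtr0_norm.
apply: le_lt_trans fin.
rewrite -ge0_integralZl ?lee_fin ?exprn_ge0//; last first.
  by move=> x _; rewrite lee_fin gauss_fun_ge0.
apply: ge0_le_integral => //.
- by move=> r _; rewrite lee_fin radial_integrand_ge0.
- by apply/measurable_EFinP; exact: measurable_radial_integrand.
- apply: measurable_funeM.
  exact: mgs.
move=> r _; rewrite -EFinM lee_fin /radial_integrand; case: ifP => [r0|_]; last first.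
  by rewrite mulr_ge0 ?gauss_fun_ge0 ?exprn_ge0.
rewrite /gauss_fun addr0 exprMn exprVn sqr_sqrtr//.
apply: le_trans (_ : (k%:R ^+ k * expR (r ^+ 2 / 2)) * expR (- r ^+ 2) <= _).
  by rewrite ler_pM2r ?expR_gt0// exprn_le_expR// ltW.
rewrite -mulrA -expRD ler_wpM2l ?exprn_ge0//.
by rewrite ler_expR; lra.
Qed.

(** Substitution t = r^2. With argument (k+2)/2 the Gamma integrand contains t^(k/2), which is
    continuous at 0, so the substitution can be made on compact intervals [0, n] and passed to the
    limit. *)
Lemma Gamma_radial k :
  Gamma (k.+2%:R / 2 : R) = 2 * fine (@radial_integral R k.+1).
Proof.
pose G (t : R) := Num.sqrt t ^+ k * expR (- t).
have cG : continuous G.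
  move=> x; apply: cvgM.
    apply: (@continuous_comp _ _ _ Num.sqrt (fun y => y ^+ k)).
      exact: sqrt_continuous.
    exact: exprn_continuous.
  apply: (@continuous_comp _ _ _ -%R expR); first exact: opp_continuous.
  exact: continuous_expR.
have mG : measurable_fun setT G by exact: continuous_measurable_fun.
have sq' : derive1 (fun r : R => r ^+ 2) = (fun r => 2 * r).
  by apply/funext => r; rewrite derive1E exp_derive scaler1 -mulr_natl expr1.
rewrite /Gamma /Rintegral.
transitivity (fine (\int[mu]_(t in `[0%R, +oo[) (G t)%:E)%E).
  congr fine; rewrite -integral_itv_obnd_cbnd; last first.
    by apply/measurable_EFinP; exact: measurable_funTS.
  apply: eq_integral => t; rewrite mem_setE in_itv/= andbT => t0.
  rewrite /G -powR12_sqrt ?ltW// -powR_mulrn ?powR_ge0// -powRrM.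
  by congr ((_ `^ _ * _)%:E); rewrite -[k.+2%:R]natr1 -[k.+1%:R]natr1; lra.
(* The absolute value makes [f] nonnegative on the whole line, as the monotone limit over [0, n]
   asks. *)
pose f (r : R) := 2 * (`|r| ^+ k.+1 * expR (- r ^+ 2)).
have mf : measurable_fun setT f.
  apply: measurable_funM => //; apply: measurable_funM.
    by apply: measurable_funX; apply: (@normr_measurable R setT).
  by apply: measurable_fun_expR; apply: measurable_funN; exact: measurable_funX.
have G0 t : 0 <= G t by rewrite mulr_ge0 ?expR_ge0// exprn_ge0// sqrtr_ge0.
have f0 r : 0 <= f r by rewrite !mulr_ge0 ?expR_ge0// exprn_ge0.
have step n : (\int[mu]_(t in `[0%R, (n ^ 2)%:R]) (G t)%:E =
    \int[mu]_(r in `[0%R, n%:R]) (f r)%:E)%E.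
  transitivity (\int[mu]_(r in `[0%R, n%:R])
      (((G \o (fun r : R => r ^+ 2)) * derive1 (fun r : R => r ^+ 2)) r)%:E)%E.
    have <- := @integration_by_substitution_increasing R (fun r => r ^+ 2) G 0 n%:R.
    - by rewrite expr0n natrX.
    - by [].
    - move=> x y; rewrite !in_itv/= => /andP[x0 _] /andP[y0 _] xy.
      by rewrite ltr_pXn2r ?nnegrE.
    - by rewrite sq' => x _; apply: cvgM; [exact: cvg_cst|exact: cvg_id].
    - rewrite sq'; apply/cvg_ex; exists (2 * 0); apply: cvg_at_right_filter.
      by apply: cvgM; [exact: cvg_cst|exact: cvg_id].
    - rewrite sq'; apply/cvg_ex; exists (2 * n%:R); apply: cvg_at_left_filter.
      by apply: cvgM; [exact: cvg_cst|exact: cvg_id].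
    - split; first by move=> x _; exact: exprn_derivable.
      + by apply: cvg_at_right_filter; exact: exprn_continuous.
      + by apply: cvg_at_left_filter; exact: exprn_continuous.
    - exact: continuous_subspaceT.
  apply: eq_integral => r; rewrite mem_setE in_itv/= => /andP[r0 _].
  rewrite fctE sq' /= /G /f sqrtr_sqr ger0_norm// [r ^+ k.+1]exprS; congr EFin; ring.
have lim1 := ge0_cvgn_integral (mu := lebesgue_measure) f0 mf.
have lim2 := ge0_cvgn_integral (mu := lebesgue_measure) G0 mG.
have lim3 : ((\int[mu]_(x in `[0%R, (n ^ 2)%:R]) (G x)%:E)%E @[n --> \oo] -->
    (\int[mu]_(x in `[0%R, +oo[) (G x)%:E)%E)%classic.
  apply: (cvg_comp (fun n => n ^ 2)%N) lim2.
  apply/cvgnyPge => A; near=> n; rewrite (@leq_trans n)//.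
    by near: n; exact: nbhs_infty_ge.
  by rewrite -mulnn leq_pmull//; near: n; exact: nbhs_infty_gt.
have -> : (\int[mu]_(x in `[0%R, +oo[) (G x)%:E =
    \int[mu]_(x in `[0%R, +oo[) (f x)%:E)%E.
  move: lim3; rewrite (_ : (fun n : nat => _) =
    (fun n : nat => (\int[mu]_(r in `[0%R, n%:R]) (f r)%:E)%E)).
    by move=> lim3; apply: cvg_unique lim3 lim1.
  by apply/funext => n; exact: step.
rewrite -integral_itv_obnd_cbnd; last first.
  by apply/measurable_EFinP; exact: measurable_funTS.
transitivity (fine (\int[mu]_(r in `]0%R, +oo[)
  (2%:E * (r ^+ k.+1 * expR (- r ^+ 2))%:E))%E).
  congr fine; apply: eq_integral => r; rewrite mem_setE in_itv/= andbT => r0.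
  by rewrite -EFinM /f gtr0_norm.
rewrite ge0_integralZl//.
- rewrite -radial_integral_itv fineM//.
  rewrite ge0_fin_numE ?radial_integral_lty//; exact/ltW/radial_integral_gt0.
- apply: measurable_funTS; apply/measurable_EFinP; apply: measurable_funM.
    exact: measurable_funX.
  by apply: measurable_fun_expR; apply: measurable_funN; exact: measurable_funX.
- move=> r /=; rewrite in_itv/= andbT => r0; rewrite lee_fin.
  by rewrite mulr_ge0 ?expR_ge0// exprn_ge0// ltW.
Unshelve. all: by end_near. Qed.

End RadialGamma.

(** * Volumes of spherical and hyperbolic simplices *)

Section Density.
Variables (R : realType) (X : geometry) (n : nat).
Local Notation V := 'rV[R]_(ambient_dim X n).
Implicit Types x y z w : V.

Definition form_mx : 'M[R]_(ambient_dim X n) :=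
  diag_mx (\row_k signature R X k).

Lemma formE x y : form x y = (x *m form_mx *m y^T) 0 0.
Proof.
rewrite /form mxE; apply: eq_bigr => k _.
by rewrite mul_mx_diag !mxE mulrA [signature _ _ _ * _]mulrC.
Qed.

Lemma gram_mxE p q (A : 'M[R]_(p, ambient_dim X n)) (B : 'M[R]_(q, ambient_dim X n)) i j :
  (A *m form_mx *m B^T) i j = form (row i A) (row j B).
Proof.
rewrite formE -row_mul [RHS]mxE [LHS]mxE; apply: eq_bigr => k _.
by rewrite !mxE.
Qed.

Lemma formC x y : form x y = form y x.
Proof. by apply: eq_bigr => k _; rewrite [x _ _ * _]mulrC. Qed.

Lemma formDl x y z : form (x + y) z = form x z + form y z.
Proof. by rewrite !formE !mulmxDl mxE. Qed.

Lemma formZl a x z : form (a *: x) z = a * form x z.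
Proof. by rewrite !formE -!scalemxAl mxE. Qed.

Lemma formDr x y z : form z (x + y) = form z x + form z y.
Proof. by rewrite ![form z _]formC formDl. Qed.

Lemma formZr a x z : form z (a *: x) = a * form z x.
Proof. by rewrite ![form z _]formC formZl. Qed.

Lemma formNl x z : form (- x) z = - form x z.
Proof. by rewrite -scaleN1r formZl mulN1r. Qed.

Lemma formNr x z : form z (- x) = - form z x.
Proof. by rewrite ![form z _]formC formNl. Qed.

Lemma formBl x y z : form (x - y) z = form x z - form y z.
Proof. by rewrite formDl formNl. Qed.

Lemma formBr x y z : form z (x - y) = form z x - form z y.
Proof. by rewrite formDr formNr. Qed.

Lemma form0l z : form 0 z = 0.
Proof. by rewrite -[X in form X](scale0r 0) formZl mul0r. Qed.

Lemma form0r z : form z 0 = 0.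
Proof. by rewrite formC form0l. Qed.

Lemma form_suml I (s : seq I) (P : pred I) (F : I -> V) z :
  form (\sum_(i <- s | P i) F i) z = \sum_(i <- s | P i) form (F i) z.
Proof.
exact: (big_morph (fun x => form x z) (fun x y => formDl x y z) (form0l z)).
Qed.

Lemma form_sumr I (s : seq I) (P : pred I) (F : I -> V) z :
  form z (\sum_(i <- s | P i) F i) = \sum_(i <- s | P i) form z (F i).
Proof. by rewrite formC form_suml; apply: eq_bigr => i _; rewrite formC. Qed.

Lemma form_line x w (h : R) :
  form (x + h *: w) (x + h *: w) = form x x + 2 * form x w * h + form w w * h ^+ 2.
Proof. by rewrite !(formDl, formDr, formZl, formZr) [form w x]formC; ring. Qed.

Lemma form_tangent x w w' (a b b' : R) :
  form (a *: w - b *: x) (a *: w' - b' *: x) =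
  a ^+ 2 * form w w' - a * b' * form x w - a * b * form x w' + b * b' * form x x.
Proof.
rewrite !(formBl, formBr, formZl, formZr) [form w x]formC; ring.
Qed.

(** With nu = |x|, f = <x,x> of sign s, B = <x,e_i>, B' = <x,e_j> and C = <e_i,e_j>, this says that
    two partial derivatives of x/|x| have the product of the projections of e_i and e_j orthogonal
    to x, divided by |x|^2. Time-like and space-like x are treated together. *)
Lemma tangent_scalar (nu s f B B' C : R) :
  nu != 0 -> s ^+ 2 = 1 -> f = s * nu ^+ 2 ->
  nu^-1 ^+ 2 * C - nu^-1 * (s * B' * nu ^- 3) * B - nu^-1 * (s * B * nu ^- 3) * B'
    + (s * B * nu ^- 3) * (s * B' * nu ^- 3) * f =
  nu ^- 2 * (C - f^-1 * (B * B')).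
Proof.
move=> nu0 s2 ->; have /orP[/eqP->|/eqP->] : (s == 1) || (s == -1).
- by rewrite -sqrf_eq1 s2.
- by field.
- by field.
Qed.

Lemma derive_line (W : normedModType R) k (f : 'rV[R]_k -> W) (a v : 'rV[R]_k) :
  'D_v f a = 'D_1 (fun h : R => f (a + h *: v)) 0.
Proof.
rewrite /derive; have -> // : (fun h : R => h^-1 *: ((f \o shift a) (h *: v) - f a)) =
  (fun h : R => h^-1 *:
    (((fun h : R => f (a + h *: v)) \o shift 0) (h *: 1) - f (a + 0 *: v))).
apply/funext => h /=.
congr (_ *: (f _ - f _)); last by rewrite scale0r addr0.
by rewrite addr0 addrC; congr (_ + _ *: _); rewrite -[LHS]mulr1.
Qed.

Lemma is_derive_normalized_line (A B C a b : R) : A != 0 ->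
  is_derive (0 : R) (1 : R)
    (fun h : R => (Num.sqrt `|A + 2 * B * h + C * h ^+ 2|)^-1 * (a + h * b))
    ((Num.sqrt `|A|)^-1 * b - Num.sg A * B * (Num.sqrt `|A|) ^- 3 * a).
Proof.
move=> A0.
have sA : `|A| = Num.sg A * A by rewrite normrEsg.
(* A polynomial that agrees near 0 with the absolute value under the root, since the sign of a
   nonzero quantity is locally constant. *)
pose q : {poly R} := Num.sg A *: (A%:P + (2 * B) *: 'X + C *: 'X^2).
have qE h : q.[h] = Num.sg A * (A + 2 * B * h + C * h ^+ 2) by rewrite !hornerE.
have q0 : q.[0] = `|A| by rewrite qE sA; ring.
have dq : is_derive (0 : R) (1 : R) (horner q) (Num.sg A * (2 * B)).
  apply: (is_derive_eq (is_derive_poly q 0)).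
  rewrite /q derivZ !derivD derivC !derivZ derivX derivXn !hornerE; ring.
have A1 : 0 < `|A| by rewrite normr_gt0.
have s0 : 0 < Num.sqrt `|A| by rewrite sqrtr_gt0.
apply: (near_eq_is_derive
    (f := (fun h : R => (Num.sqrt q.[h])^-1) * (fun h : R => a + h * b))).
  near=> h; rewrite fctE; congr ((Num.sqrt _)^-1 * _).
  have ph : 0 < q.[h].
    near: h; apply: (cvgr_gt q.[0]); last by rewrite q0.
    exact: continuous_horner.
  move: ph; rewrite qE; case: (sgrP A) A0 => [->|A0 _|A0 _]; rewrite ?eqxx// ?mul1r ?mulN1r.
    by move=> ph; rewrite gtr0_norm.
  by rewrite oppr_gt0 => ph; rewrite ltr0_norm.
have dsq : is_derive (0 : R) (1 : R) (Num.sqrt \o horner q)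
    ((2 * Num.sqrt `|A|)^-1 * (Num.sg A * (2 * B))).
  apply: is_derive1_comp; rewrite q0; exact: is_derive1_sqrt.
have sq0 : (Num.sqrt \o horner q) 0 != 0 by rewrite /= q0 gt_eqF.
have dV := is_deriveV sq0 dsq.
have dL : is_derive (0 : R) (1 : R) (fun h : R => a + h * b) b.
  have -> : (fun h : R => a + h * b) = horner (a%:P + b *: 'X).
    by apply/funext => h; rewrite !hornerE mulrC.
  apply: (is_derive_eq (is_derive_poly _ 0)).
  by rewrite derivD derivC derivZ derivX !hornerE.
apply: is_derive_eq (is_deriveM dV dL) _.
rewrite /= q0 mul0r addr0 -[_ *: b]/(_ * b) -![_ *: (_ : R)]/(_ * _).
have sN : Num.sqrt `|A| != 0 by rewrite gt_eqF.
by field.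
Unshelve. all: by end_near. Qed.

Section Curved.
Hypothesis curved : X <> Euclidean.

Lemma normalize_curved x : normalize x = (vnorm x)^-1 *: x.
Proof. by move: x curved; rewrite /normalize; case: X. Qed.

Variables (k : nat) (q : seq V).

Definition points_mx : 'M[R]_(1 + k, ambient_dim X n) :=
  \matrix_(i, j) q`_i 0 j.

Definition simplex_point (t : 'rV[R]_k) : V :=
  q`_0 + \sum_i t 0 i *: (q`_i.+1 - q`_0).

Lemma simplex_pointE t : simplex_point t = barycentric t *m points_mx.
Proof.
rewrite /simplex_point /barycentric; apply/rowP => j.
rewrite !mxE summxE big_split_ord big_ord1 row_mxEl !mxE eqxx mulr1n /=.
rewrite mulrBl mul1r mulr_suml -addrA; congr (_ + _).
rewrite addrC -sumrB; apply: eq_bigr => i _.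
by rewrite row_mxEr !mxE mulrBr.
Qed.

Definition gram : 'M[R]_(1 + k) := points_mx *m form_mx *m points_mx^T.

Lemma gramE i j : gram i j = form q`_i q`_j.
Proof.
by rewrite gram_mxE; congr form; apply/rowP => l; rewrite !mxE.
Qed.

Let e i : V := q`_i.+1 - q`_0.

Lemma form_simplex_point t :
  form (simplex_point t) (simplex_point t) =
  (barycentric t *m gram *m (barycentric t)^T) 0 0.
Proof. by rewrite formE simplex_pointE /gram trmx_mul !mulmxA. Qed.

Lemma simplex_point_line (t : 'rV[R]_k) (i : 'I_k) (h : R) :
  simplex_point (t + h *: 'e_i) = simplex_point t + h *: e i.
Proof.
rewrite /simplex_point -addrA; congr (_ + _).
rewrite (bigD1 i)//= [in RHS](bigD1 i)//= !mxE !eqxx mulr1 scalerDl.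
rewrite [RHS]addrAC; congr (_ + _).
apply: eq_bigr => j ji; rewrite !mxE.
by rewrite (negbTE ji) andbF mulr0 addr0.
Qed.

Lemma derive_simplex_param (t : 'rV[R]_k) (i : 'I_k) :
  let x := simplex_point t in
  form x x != 0 ->
  'D_'e_i (fun t : 'rV[R]_k => normalize (simplex_point t)) t =
  (vnorm x)^-1 *: e i - (Num.sg (form x x) * form x (e i) * (vnorm x) ^- 3) *: x.
Proof.
move=> x x0; rewrite derive_line.
have dj l j : is_derive (0 : R) (1 : R)
    (fun h : R => normalize (simplex_point (t + h *: 'e_i)) l j)
    (((vnorm x)^-1 *: e i - (Num.sg (form x x) * form x (e i) * (vnorm x) ^- 3) *: x) l j).
  rewrite (_ : (fun _ => _) = (fun h : R => (Num.sqrt `|form x x +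
      2 * form x (e i) * h + form (e i) (e i) * h ^+ 2|)^-1 * (x l j + h * e i l j))).
    apply: is_derive_eq (is_derive_normalized_line _ _ _ _ x0) _.
    by rewrite !mxE.
  apply/funext => h; rewrite normalize_curved simplex_point_line !mxE; congr (_^-1 * _).
  rewrite /vnorm; congr (Num.sqrt `|_|).
  by rewrite form_line.
rewrite derive_mx; last first.
  by apply/derivable_mxP => l j; have [] := dj l j.
by apply/matrixP => l j; rewrite mxE; have [_ ->] := dj l j.
Qed.

Lemma det_schur (c : R) (v : 'cV[R]_k) (S : 'M[R]_k) : c != 0 ->
  \det (block_mx c%:M v^T v S) = c * \det (S - c^-1 *: (v *m v^T)).
Proof.
move=> c0.
have -> : block_mx c%:M v^T v S = block_mx 1%:M 0 (c^-1 *: v) 1%:M *m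
    block_mx c%:M v^T 0 (S - c^-1 *: (v *m v^T)).
  rewrite mulmx_block !mul1mx !mul0mx !addr0 mul_mx_scalar scalerA.
  by rewrite divff// scale1r -scalemxAl addrC subrK.
by rewrite det_mulmx det_lblock det_ublock !det1 !mul1r det_scalar1.
Qed.

(** Replaces the vertices q_0, ..., q_k by the point of parameter [t] and the edge vectors from
    q_0. *)
Definition frame_mx (t : 'rV[R]_k) : 'M[R]_(1 + k) :=
  block_mx (1 - \sum_i t 0 i)%:M t (const_mx (-1)) 1%:M.

Lemma det_frame_mx t : \det (frame_mx t) = 1.
Proof.
have : \det (frame_mx t *m block_mx 1%:M 0 (const_mx 1) 1%:M) = 1.
  rewrite mulmx_block !mulmx1 !mul1mx !mulmx0 !add0r.
  have -> : (1 - \sum_i t 0 i)%:M + t *m const_mx 1 = 1%:M :> 'M[R]_1.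
    apply/matrixP => i j; rewrite !ord1 !mxE eqxx !mulr1n.
    rewrite -[RHS](subrK (\sum_l t 0 l)); congr (_ + _).
    by apply: eq_bigr => l _; rewrite mxE mulr1.
  have -> : const_mx (-1) + const_mx 1 = 0 :> 'cV[R]_k.
    by apply/matrixP => i j; rewrite !mxE addNr.
  by rewrite det_ublock !det1 mulr1.
by rewrite det_mulmx det_lblock !det1 !mulr1.
Qed.

Lemma frame_points_mx t :
  frame_mx t *m points_mx = col_mx (simplex_point t) (\matrix_(i < k) e i).
Proof.
rewrite /frame_mx /block_mx mul_col_mx -/(barycentric t) -simplex_pointE; congr col_mx.
apply/matrixP => i j; rewrite !mxE big_split_ord big_ord1 row_mxEl !mxE /=.
rewrite mulN1r addrC (bigD1 i)//= big1 ?addr0 => [|l li].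
  by rewrite row_mxEr !mxE eqxx mul1r.
by rewrite row_mxEr !mxE eq_sym (negbTE li) mul0r.
Qed.

Lemma det_gram_simplex (t : 'rV[R]_k) :
  let x := simplex_point t in
  let v := \col_(i < k) form x (e i) in
  \det (block_mx (form x x)%:M v^T v (\matrix_(i < k, j < k) form (e i) (e j))) = \det gram.
Proof.
move=> x v.
suff -> : block_mx (form x x)%:M v^T v (\matrix_(i < k, j < k) form (e i) (e j)) =
    frame_mx t *m gram *m (frame_mx t)^T.
  by rewrite !det_mulmx det_tr det_frame_mx mul1r mulr1.
rewrite /gram !mulmxA frame_points_mx -mulmxA -trmx_mul frame_points_mx.
have row0E (y : V) : row 0 y = y by apply/rowP => l; rewrite mxE.
apply/matrixP => i j; rewrite gram_mxE.
case: (split_ordP i) => i' ->; case: (split_ordP j) => j' ->;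
  rewrite ?(block_mxEul, block_mxEur, block_mxEdl, block_mxEdr)
    ?(rowKu, rowKd) ?rowK.
- by rewrite !ord1 !row0E mxE eqxx mulr1n.
- by rewrite !ord1 row0E !mxE.
- by rewrite !ord1 row0E !mxE formC.
- by rewrite mxE.
Qed.

(** The Gram matrix of the partial derivatives is |x|^-2 times the Schur complement of <x,x> in the
    Gram matrix of x and the edges. The latter arises from [gram] by a unimodular change of vectors,
    so the determinant is [\det gram] divided by <x,x>, times |x|^(-2k). *)
Lemma curved_density (t : 'rV[R]_k) :
  let x := simplex_point t in
  form x x != 0 ->
  volume_density (fun t : 'rV[R]_k => normalize (simplex_point t)) t =
  Num.sqrt (Num.sg (form x x) * \det gram) * Num.sqrt `|form x x| ^- k.+1.
Proof.
move=> x x0; rewrite /volume_density.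
pose v := \col_(i < k) form x (e i).
have s0 : 0 < `|form x x| by rewrite normr_gt0.
have vn0 : vnorm x != 0 by rewrite gt_eqF// sqrtr_gt0.
have vn2 : vnorm x ^+ 2 = `|form x x| by rewrite sqr_sqrtr.
have sA : Num.sg (form x x) * form x x = vnorm x ^+ 2 by rewrite vn2 -normrEsg.
have sg2 : Num.sg (form x x) ^+ 2 = 1 by rewrite sqr_sg x0.
have fE : form x x = Num.sg (form x x) * vnorm x ^+ 2.
  by rewrite -sA mulrA -expr2 sg2 mul1r.
have -> : \matrix_(i, j) form ('D_'e_i (fun t : 'rV[R]_k => normalize (simplex_point t)) t)
     ('D_'e_j (fun t : 'rV[R]_k => normalize (simplex_point t)) t) =
   (vnorm x ^- 2) *: ((\matrix_(i < k, j < k) form (e i) (e j)) -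
      (form x x)^-1 *: (v *m v^T)).
  apply/matrixP => i j; rewrite mxE !derive_simplex_param//.
  rewrite form_tangent !mxE big_ord1 !mxE.
  exact: tangent_scalar.
rewrite detZ.
have -> : \det (\matrix_(i < k, j < k) form (e i) (e j) - (form x x)^-1 *: (v *m v^T)) =
  (form x x)^-1 * \det gram.
  by rewrite -(det_gram_simplex t) det_schur// mulrA mulVf// mul1r.
have -> : Num.sqrt `|form x x| ^- k.+1 = Num.sqrt (((vnorm x)^-1 ^+ k.+1) ^+ 2).
  rewrite sqrtr_sqr -exprVn [RHS]ger0_norm ?exprn_ge0 ?invr_ge0 ?sqrtr_ge0//.
rewrite [RHS]mulrC -sqrtrM ?sqr_ge0//; congr Num.sqrt.
have sgV : (Num.sg (form x x))^-1 = Num.sg (form x x).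
  by apply: (mulfI (x := Num.sg (form x x))); rewrite ?divff -?expr2 ?sg2// sgr_eq0.
have -> : (form x x)^-1 = Num.sg (form x x) * vnorm x ^- 2.
  by rewrite [in LHS]fE invfM sgV.
have -> : (vnorm x)^-1 ^+ k.+1 ^+ 2 = vnorm x ^- 2 ^+ k * vnorm x ^- 2.
  by rewrite -exprM mulnC exprM exprVn exprSr.
ring.
Qed.

End Curved.

End Density.

(** * Volumes as Gaussian integrals over cones *)

Section CurvedVolume.
Variables (R : realType) (X : geometry) (n : nat).
Hypothesis curved : X <> Euclidean.
Local Notation V := 'rV[R]_(ambient_dim X n).

Lemma fineZ (c : R) (x : \bar R) : 0 <= c -> fine (c%:E * x)%E = c * fine x.
Proof.
rewrite le_eqVlt => /predU1P[<-|c0]; first by rewrite mul0e mul0r.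
case: x => [x||] //=; rewrite mulr0.
  by rewrite gt0_muley ?lte_fin.
by rewrite gt0_muleNy ?lte_fin.
Qed.

Definition quad k (S : 'M[R]_k) (z : 'rV[R]_k) : R := (z *m S *m z^T) 0 0.

Lemma quadZ k (S : 'M[R]_k) c z : quad S (c *: z) = c ^+ 2 * quad S z.
Proof.
by rewrite /quad linearZ /= -!scalemxAl -scalemxAr !mxE mulrA.
Qed.

(** The Gaussian integral over a cone in the coordinates given by its generators, whose Gram matrix
    is [S]. The sign [eps] is 1 for the sphere and -1 for the Lobachevsky space, where cones over
    simplices are time-like. *)
Definition cone_integral (eps : R) k (S : 'M[R]_k) : R :=
  fine (row_integral (fun z : 'rV[R]_k =>
    (if orthant z then expR (- (eps * quad S z)) else 0)%:E)).

Lemma orthant_barycentric k (t : 'rV[R]_k) :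
  simplex_dom t -> orthant (barycentric t).
Proof.
move=> /andP[/forallP t0 t1]; apply/andP; split.
  apply/forallP => i; case: (split_ordP i) => j ->.
    by rewrite row_mxEl ord1 mxE eqxx mulr1n subr_ge0.
  by rewrite row_mxEr.
rewrite big_split_ord big_ord1 row_mxEl mxE eqxx mulr1n /=.
rewrite [X in _ + X](_ : _ = \sum_i t 0 i) ?subrK//.
by apply: eq_bigr => i _; rewrite row_mxEr.
Qed.

Lemma curved_volume_gram (eps : R) k (q : seq V) :
  (size q).-1 = k -> eps = 1 \/ eps = -1 ->
  (forall z, orthant z -> 0 < eps * quad (gram k q) z) ->
  fine (radial_integral k) * simplex_volume q =
  Num.sqrt (eps * \det (gram k q)) * cone_integral eps (gram k q).
Proof.
move=> kE epsE; subst k; set k := (size q).-1 => pos.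
pose rho z := eps * quad (gram k q) z.
have rho_meas : row_measurable rho.
  by apply: measurable_funM => //; exact: row_measurable_quadratic.
have rho_hom c x : rho (c *: x) = c ^+ 2 * rho x.
  by rewrite /rho quadZ mulrCA.
have rho_pos t : simplex_dom t -> 0 < rho (barycentric t).
  by move=> st; apply: pos; exact: orthant_barycentric.
pose g t := if simplex_dom t then Num.sqrt (rho (barycentric t)) ^- k.+1 else 0.
have VE : simplex_volume q =
    Num.sqrt (eps * \det (gram k q)) * fine (row_integral (fun t => (g t)%:E)).
  rewrite -fineZ ?sqrtr_ge0// /row_integral -ge0_iterated_integralZ ?lee_fin
    ?sqrtr_ge0//; last 2 first.
  - by apply/measurable_EFinP; exact: measurable_radial_density.
  - by move=> t; rewrite lee_fin /g; case: ifP => // _; rewrite invr_ge0 exprn_ge0// sqrtr_ge0.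
  rewrite /simplex_volume; congr fine; apply: eq_iterated_integral => tt.
  rewrite -/(row_of_tuple tt); move: (row_of_tuple tt) => t.
  rewrite /g -/(simplex_dom t); case: ifP => [st|_]; last by rewrite mule0.
  rewrite -EFinM; congr EFin.
  have /= x0 : rho (barycentric t) = eps * form (simplex_point q t) (simplex_point q t).
    by rewrite form_simplex_point.
  have := rho_pos t st; rewrite x0 => fpos.
  have fN0 : form (simplex_point q t) (simplex_point q t) != 0.
    by apply: contraTneq fpos => ->; rewrite mulr0 ltxx.
  have := curved_density curved fN0; rewrite -/k /simplex_param => ->.
  have [sgE nE] : Num.sg (form (simplex_point q t) (simplex_point q t)) = eps /\
     `|form (simplex_point q t) (simplex_point q t)| =
     eps * form (simplex_point q t) (simplex_point q t).
    case: epsE fpos => ->; rewrite ?mul1r ?mulN1r ?oppr_gt0 => fp.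
      by rewrite gtr0_sg// gtr0_norm.
    by rewrite ltr0_sg// ltr0_norm.
  by rewrite sgE nE.
rewrite VE mulrCA; congr (_ * _).
rewrite -fineZ; last first.
  by rewrite fine_ge0// ltW// radial_integral_gt0.
rewrite fineK; last first.
  by rewrite ge0_fin_numE ?radial_integral_lty// ltW// radial_integral_gt0.
by rewrite -radial_decomposition.
Qed.

Lemma orthant_perm k (s : 'S_k) (z : 'rV[R]_k) :
  orthant (z *m perm_mx s) = orthant z.
Proof.
have zs i : (z *m perm_mx s) 0 (s i) = z 0 i.
  by rewrite -[s in _ *m perm_mx s]invgK -col_permE mxE permK.
have sumE : \sum_i (z *m perm_mx s) 0 i = \sum_i z 0 i.
  by rewrite (reindex_inj (@perm_inj _ s)); apply: eq_bigr => i _; rewrite zs.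
rewrite /orthant sumE; congr andb.
apply/forallP/forallP => z0 i; first by rewrite -zs.
by rewrite -[i](permKV s) zs.
Qed.

Lemma quad_perm k (S : 'M[R]_k) (s : 'S_k) z :
  quad (perm_mx s *m S *m (perm_mx s)^T) z = quad S (z *m perm_mx s).
Proof. by rewrite /quad trmx_mul !mulmxA. Qed.

Lemma cone_integral_perm eps k (S : 'M[R]_k) (s : 'S_k) :
  cone_integral eps (perm_mx s *m S *m (perm_mx s)^T) = cone_integral eps S.
Proof.
pose F (z : 'rV[R]_k) := (if orthant z then expR (- (eps * quad S z)) else 0)%:E.
have mF : row_measurable F.
  apply/measurable_EFinP; apply: measurable_fun_ifT => //.
  - exact: row_measurable_orthant.
  - apply: measurable_fun_expR; apply: measurable_funN; apply: measurable_funM => //.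
    exact: row_measurable_quadratic.
have F0 x : (0 <= F x)%E by rewrite lee_fin; case: ifP => // _; exact: expR_ge0.
rewrite /cone_integral -(integral_rescalesT (unitmx_perm R s) mF F0).
rewrite det_perm normrX normrN1 expr1n mul1e; congr fine.
by apply: eq_row_integral => z; rewrite /F quad_perm orthant_perm.
Qed.

(** A face lists its vertices a_i before its vertices b_j. Reordering conjugates the Gram matrix by
    a permutation matrix, which affects neither its determinant nor the orthant. *)
Lemma curved_volume_family (eps : R) m (v : 'I_m -> V) (l : seq 'I_m) :
  let S := \matrix_(i, j) form (v i) (v j) in
  (0 < m)%N -> uniq l -> size l = m -> eps = 1 \/ eps = -1 ->
  (forall z, orthant z -> 0 < eps * quad S z) ->
  fine (radial_integral m.-1) * simplex_volume [seq v i | i <- l] =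
  Num.sqrt (eps * \det S) * cone_integral eps S.
Proof.
case: m v l => // m v l S _ ul sl epsE pos.
have nthl_inj : injective (fun i : 'I_m.+1 => nth ord0 l i).
  move=> i j /eqP; rewrite nth_uniq ?sl// => /eqP; exact: val_inj.
pose s := perm nthl_inj.
set q := [seq v i | i <- l].
have gE : gram m q = perm_mx s *m S *m (perm_mx s)^T.
  apply/matrixP => i j; rewrite gramE tr_perm_mx -col_permE -row_permE !mxE.
  by rewrite !permE !(nth_map ord0) ?sl.
have posq z : orthant z -> 0 < eps * quad (gram m q) z.
  by move=> oz; rewrite gE quad_perm; apply: pos; rewrite orthant_perm.
have sq : (size q).-1 = m by rewrite size_map sl.
have := curved_volume_gram sq epsE posq.
rewrite gE cone_integral_perm !det_mulmx det_tr mulrAC -expr2 det_perm sqrr_sign.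
by rewrite mul1r.
Qed.

End CurvedVolume.

(** * Signed coverings by a fan of cones *)

Section HalfLine.
Variables (R : realFieldType) (n : nat).

Definition strict_max (A : {set 'I_n}) (t : 'I_n -> R) (i : 'I_n) : bool :=
  (i \in A) && [forall j in A, (j != i) ==> (t j < t i)].

Lemma sum_strict_max (A : {set 'I_n}) (t : 'I_n -> R) :
  {in A &, injective t} ->
  \sum_i (strict_max A t i)%:R = (A != finset.set0)%:R :> R.
Proof.
move=> tinj; have [->|[i0 Ai0]] := set_0Vmem A.
  rewrite eqxx big1// => i _; rewrite /strict_max.
  by rewrite finset.in_set0.
have -> : (A != finset.set0) = true by apply/set0Pn; exists i0.
case: (arg_maxP t Ai0) => m Am tm; have {}Am : m \in A := Am.
have {}tm j : j \in A -> t j <= t m := tm j.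
rewrite (bigD1 m)//= [X in _ + X]big1 ?addr0 => [|i im].
  rewrite /strict_max Am /= (_ : [forall j in A, _]) //.
  apply/forall_inP => j Aj; apply/implyP => jm.
  rewrite lt_neqAle tm// andbT; apply: contra_neq jm; exact: tinj.
rewrite /strict_max; case: (boolP (i \in A)) => //= Ai.
case: forall_inP => // /(_ _ Am); rewrite eq_sym im /= => tmi.
by have := tm _ Ai; rewrite leNgt tmi.
Qed.

Variables x y : 'I_n -> R.

Definition crossing_time i : R := - x i / y i.

(** The ray meets the i-th wall at a positive time, in the relative interior of the corresponding
    facet of the orthant. *)
Definition crosses (i : 'I_n) : bool :=
  [&& y i != 0, 0 < crossing_time i &
   [forall j, (j != i) ==> (0 < x j + crossing_time i * y j)]].

(** The ray x + t y lies in the open orthant for all large t. *)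
Definition end_positive : bool :=
  [forall i, (0 < y i) || (y i == 0) && (0 < x i)].

(* Follow the ray [x + t y], [t > 0]: it leaves or enters the open orthant only
   at the walls counted by [crosses]. *)
Lemma halfline_crossing :
  (forall i, x i != 0) ->
  (forall i j, i != j -> (y i != 0) || (y j != 0) -> x i * y j != x j * y i) ->
  [forall i, 0 < x i]%:R - end_positive%:R =
  \sum_i - (Num.sg (y i) * (crosses i)%:R) :> R.
Proof.
move=> x0 xy; pose t := crossing_time.
(* A coordinate that is negative and does not increase keeps the ray outside the closed orthant
   forever: every term is zero. *)
have [[b /andP[yb xb]]|nobad] :=
    pselect (exists b, (y b <= 0) && (x b < 0)).
  have -> : [forall i, 0 < x i] = false.
    by apply/negbTE/forallPn; exists b; rewrite -leNgt ltW.
  have -> : end_positive = false.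
    by apply/negbTE/forallPn; exists b; rewrite negb_or -leNgt yb /= [0 < x b]ltNge ltW// andbF.
  rewrite subrr big1// => i _; apply/eqP; rewrite oppr_eq0; apply/eqP.
  rewrite (_ : crosses i = false) ?mulr0//; apply/negbTE/negP => /and3P[yi ti /forallP/(_ b)].
  have [bi|bi] /= := eqVneq b i.
    move: ti yi; rewrite /crossing_time -bi => tb yb0 _.
    have yb1 : y b < 0 by rewrite lt_neqAle yb0.
    move: tb; rewrite pmulr_rgt0 ?oppr_gt0// invr_gt0; lra.
  by move: yb xb ti; nra.
have bad i : x i < 0 -> 0 < y i.
  by move=> xi; rewrite ltNge; apply/negP => yi; apply: nobad; exists i; rewrite xi yi.
(* [L] collects the walls passed inwards, [U] those passed outwards; the other coordinates remain
   positive. The ray is inside between the last time of [L] and the first time of [U]. *)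
pose L := [set i | (0 < y i) && (x i < 0)].
pose U := [set i | (y i < 0) && (0 < x i)].
have tpos i : y i != 0 -> (0 < t i) = (i \in L) || (i \in U).
  move=> yi; rewrite !inE /t /crossing_time.
  case: (ltgtP (y i) 0) yi => // yi _; case: (ltgtP (x i) 0) (x0 i) => // xi _ /=.
  - by apply/negbTE; rewrite -leNgt mulNr oppr_le0 nmulr_rge0 // invr_le0 ltW.
  - by rewrite mulNr oppr_gt0 pmulr_rlt0// invr_lt0.
  - by rewrite mulNr oppr_gt0 nmulr_rlt0// invr_gt0.
  - by apply/negbTE; rewrite -leNgt mulNr oppr_le0 pmulr_rge0// invr_ge0 ltW.
have ty i : y i != 0 -> t i * y i = - x i by move=> yi; rewrite divfK.
have LU i j : i \in L -> j \in U -> i != j.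
  by rewrite !inE => /andP[yi _] /andP[yj _]; apply: contraTneq yi => ->; lra.
have tne i j : i != j -> y i != 0 -> y j != 0 -> t i != t j.
  move=> ij yi yj; apply: contra_neq (xy i j ij _); last by rewrite yi.
  move=> tij; have := ty i yi; have := ty j yj; rewrite -tij => h1 h2.
  have -> : x i = - (t i * y i) by rewrite h2 opprK.
  have -> : x j = - (t i * y j) by rewrite h1 opprK.
  ring.
have Lj j s : 0 < s -> j \in L -> (0 < x j + s * y j) = (t j < s).
  rewrite inE => _ /andP[yj _]; rewrite -[x j]opprK -ty ?gt_eqF// -mulNr -mulrDl.
  by rewrite pmulr_lgt0// addrC subr_gt0.
have Uj j s : 0 < s -> j \in U -> (0 < x j + s * y j) = (s < t j).
  rewrite inE => _ /andP[yj _]; rewrite -[x j]opprK -ty ?lt_eqF// -mulNr -mulrDl.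
  by rewrite nmulr_lgt0// addrC subr_lt0.
have Gj j s : 0 < s -> j \notin L -> j \notin U -> 0 < x j + s * y j.
  rewrite !inE => s0; case: (ltgtP (x j) 0) (x0 j) => // xj _; rewrite ?andbT ?andbF /=.
    by rewrite (bad _ xj).
  rewrite -leNgt => _ yj; by rewrite ltr_pwDl// mulr_ge0// ltW.
(* [Z] says that this time interval is nonempty. Then exactly one wall of [L] (the latest) and one
   of [U] (the earliest) is crossed on the boundary of the orthant, as far as these sets are
   nonempty; otherwise none is. *)
pose Z := [forall i in L, [forall j in U, t i < t j]].
have crossL i : i \in L -> crosses i = strict_max L t i && Z.
  move=> iL; have := iL; rewrite inE => /andP[yi xi].
  have yi0 : y i != 0 by rewrite gt_eqF.
  have ti : 0 < t i by rewrite tpos// iL.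
  rewrite /crosses yi0 -/(t i) ti /= /strict_max iL /=.
  apply/forallP/andP => [h|[/forall_inP hL /forall_inP hZ] j].
    have hL j : j \in L -> j != i -> t j < t i.
      by move=> jL ji; have := h j; rewrite ji /= Lj.
    have hU j : j \in U -> t i < t j.
      by move=> jU; have := h j; rewrite eq_sym (LU _ _ iL jU) /= Uj.
    split; first by apply/forall_inP => j jL; apply/implyP; exact: hL.
    apply/forall_inP => l lL; apply/forall_inP => j jU.
    have [->|li] := eqVneq l i; first exact: hU.
    exact: lt_trans (hL _ lL li) (hU _ jU).
  apply/implyP => ji; have [jL|jL] := boolP (j \in L).
    by rewrite Lj//; exact: (implyP (hL _ jL)).
  have [jU|jU] := boolP (j \in U); last exact: Gj.
  by rewrite Uj//; have /forall_inP := hZ _ iL; apply.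
have crossU i : i \in U -> crosses i = strict_max U (fun j => - t j) i && Z.
  move=> iU; have := iU; rewrite inE => /andP[yi xi].
  have yi0 : y i != 0 by rewrite lt_eqF.
  have ti : 0 < t i by rewrite tpos// iU orbT.
  rewrite /crosses yi0 -/(t i) ti /= /strict_max iU /=.
  apply/forallP/andP => [h|[/forall_inP hU /forall_inP hZ] j].
    have hU j : j \in U -> j != i -> t i < t j.
      by move=> jU ji; have := h j; rewrite ji /= Uj.
    have hL j : j \in L -> t j < t i.
      by move=> jL; have := h j; rewrite (LU _ _ jL iU) /= Lj.
    split; first by apply/forall_inP => j jU; apply/implyP; rewrite ltrN2; exact: hU.
    apply/forall_inP => l lL; apply/forall_inP => j jU.
    have [->|ji] := eqVneq j i; first exact: hL.
    exact: lt_trans (hL _ lL) (hU _ jU ji).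
  apply/implyP => ji; have [jL|jL] := boolP (j \in L).
    by rewrite Lj//; have /forall_inP := hZ _ jL; apply.
  have [jU|jU] := boolP (j \in U); last exact: Gj.
  by rewrite Uj//; have := implyP (hU _ jU) ji; rewrite ltrN2.
have termE i : - (Num.sg (y i) * (crosses i)%:R) =
    (strict_max U (fun j => - t j) i)%:R * Z%:R - (strict_max L t i)%:R * Z%:R :> R.
  rewrite -!natrM !mulnb.
  have [iL|iL] := boolP (i \in L).
    have iU : i \in U = false by apply/negbTE/negP => /(LU _ _ iL); rewrite eqxx.
    have sU : strict_max U (fun j => - t j) i = false by rewrite /strict_max iU.
    rewrite crossL// sU /= add0r.
    by move: iL; rewrite inE => /andP[yi _]; rewrite gtr0_sg// mul1r.
  have [iU|iU] := boolP (i \in U).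
    have sL : strict_max L t i = false by rewrite /strict_max (negbTE iL).
    rewrite crossU// sL /= subr0.
    by move: iU; rewrite inE => /andP[yi _]; rewrite ltr0_sg// mulN1r opprK.
  rewrite /strict_max (negbTE iL) (negbTE iU) /= subr0 /crosses.
  have [->|yi] := eqVneq (y i) 0; first by rewrite mulr0 oppr0.
  by rewrite -/(t i) tpos// (negbTE iL) (negbTE iU) mulr0 oppr0.
rewrite (eq_bigr _ (fun i _ => termE i)) sumrB -!mulr_suml !sum_strict_max; last 2 first.
- move=> i j; rewrite !inE => /andP[yi _] /andP[yj _] tij.
  by apply/eqP; apply: contraT => /tne; rewrite (gt_eqF yi) (gt_eqF yj) tij eqxx => /(_ isT isT).
- move=> i j; rewrite !inE => /andP[yi _] /andP[yj _] /oppr_inj tij.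
  by apply/eqP; apply: contraT => /tne; rewrite (lt_eqF yi) (lt_eqF yj) tij eqxx => /(_ isT isT).
have posE : [forall i, 0 < x i] = (L == finset.set0).
  apply/forallP/eqP => [h|L0 i].
    by apply/setP => i; rewrite !inE [x i < 0]ltNge ltW// andbF.
  rewrite ltNge le_eqVlt (negbTE (x0 i)) /=; apply/negP => xi.
  by have := finset.in_set0 i; rewrite -L0 inE bad// xi.
have endE : end_positive = (U == finset.set0).
  apply/forallP/eqP => [h|U0 i].
    apply/setP => i; rewrite !inE; apply/negbTE/negP => /andP[yi _].
    by have := h i; rewrite (lt_eqF yi) /= orbF ltNge ltW.
  have := finset.in_set0 i; rewrite -U0 inE => /negbT.
  rewrite negb_and -!leNgt => /orP[|].
    rewrite le_eqVlt => /orP[/eqP yi|->//]; rewrite -yi eqxx ltxx /=.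
    by case: (ltgtP (x i) 0) (x0 i) => // /bad; rewrite -yi ltxx.
  by rewrite le_eqVlt (negbTE (x0 i)) /= => /bad ->.
rewrite posE endE.
have [L0|L0] := eqVneq L finset.set0.
  have -> : Z = true.
    by apply/forall_inP => i; rewrite L0 finset.in_set0.
  by case: (U == _); rewrite /= ?(mul0r, mulr1, subr0, subrr).
have [U0|U0] := eqVneq U finset.set0; last by rewrite /= !subrr.
have -> : Z = true.
  apply/forall_inP => i _; apply/forall_inP => j; by rewrite U0 finset.in_set0.
by rewrite /= !(mul0r, mulr1, mul1r, subr0, subrr, sub0r).
Qed.

End HalfLine.

(** * Cancellation of wall crossings between adjacent cones *)

Section Fan.
Variables (R : realFieldType) (n : nat) (a b : 'I_n -> 'rV[R]_n).

Definition choice_mx (B : {set 'I_n}) : 'M[R]_n :=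
  \matrix_i (if i \in B then b i else a i).

Definition toggle (i : 'I_n) (B : {set 'I_n}) : {set 'I_n} :=
  if i \in B then B :\ i else i |: B.

Lemma toggleK i : involutive (toggle i).
Proof.
move=> B; rewrite /toggle; have [iB|iB] := boolP (i \in B).
  by rewrite finset.setD11 finset.setD1K.
by rewrite finset.setU11 finset.setU1K.
Qed.

Lemma sign_toggle i (B : {set 'I_n}) :
  (-1) ^+ #|toggle i B| = - (-1) ^+ #|B| :> R.
Proof.
rewrite /toggle; have [iB|iB] := boolP (i \in B).
  by rewrite [in RHS](cardsD1 i B) iB add1n exprS mulN1r opprK.
by rewrite cardsU1 iB add1n exprS mulN1r.
Qed.

Lemma row_choice_toggle i B j : j != i ->
  row j (choice_mx (toggle i B)) = row j (choice_mx B).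
Proof.
move=> ji; rewrite !rowK; suff -> : (j \in toggle i B) = (j \in B) by [].
rewrite /toggle; have [iB|iB] := boolP (i \in B).
  by rewrite finset.in_setD1 ji.
by rewrite finset.in_setU1 (negbTE ji).
Qed.

Lemma row'_choice_toggle i B : row' i (choice_mx (toggle i B)) = row' i (choice_mx B).
Proof.
apply/row_matrixP => k; rewrite !row_rowsub row_choice_toggle //.
by rewrite eq_sym neq_lift.
Qed.

Lemma invmx_coord (N : 'M[R]_n) (x : 'rV[R]_n) i : N \in unitmx ->
  (x *m invmx N) 0 i = (\det N)^-1 * (x *m \adj N) 0 i.
Proof. by move=> uN; rewrite /invmx uN -scalemxAr mxE. Qed.

(** Column i of the adjugate consists of cofactors along row i, which do not see that row. So, up to
    the determinant, the i-th coordinate is the same in the two cones sharing the facet opposite to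
    generator i. *)
Lemma adj_coord_toggle B (x : 'rV[R]_n) i :
  (x *m \adj (choice_mx (toggle i B))) 0 i = (x *m \adj (choice_mx B)) 0 i.
Proof.
rewrite !mxE; apply: eq_bigr => k _; rewrite !mxE /cofactor.
have rcE N : row' i (col' k N) = col' k (row' i N) :> 'M[R]_n.-1.
  by apply/matrixP => p q; rewrite !mxE.
by rewrite !rcE row'_choice_toggle.
Qed.

Hypothesis uN : forall B, choice_mx B \in unitmx.

Definition facet_coord B (x : 'rV[R]_n) : 'rV[R]_n := x *m invmx (choice_mx B).

Lemma facet_coordE B (x : 'rV[R]_n) i :
  (x *m col i (invmx (choice_mx B))) 0 0 = facet_coord B x 0 i.
Proof. by rewrite colE mulmxA -colE mxE. Qed.

Lemma facet_coord_toggle i B x : facet_coord B x 0 i = 0 ->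
  facet_coord (toggle i B) x = facet_coord B x.
Proof.
move=> xi; rewrite /facet_coord.
rewrite -[LHS](_ : facet_coord B x *m choice_mx B *m invmx (choice_mx (toggle i B)) = _).
  suff -> : facet_coord B x *m choice_mx B =
            facet_coord B x *m choice_mx (toggle i B) by rewrite mulmxK.
  rewrite !mulmx_sum_row; apply: eq_bigr => j _.
  have [->|ji] := eqVneq j i; first by rewrite xi !scale0r.
  by rewrite row_choice_toggle.
by rewrite /facet_coord mulmxKV.
Qed.

Definition facet_crosses (x y : 'rV[R]_n) B i :=
  crosses (facet_coord B x 0) (facet_coord B y 0) i.

(** Multiplied by the determinant, the i-th coordinates in the two cones agree, hence so do the
    oriented signs and the crossing times. At the crossing point the i-th coordinate is zero, so all
    other coordinates agree as well. *)
Lemma facet_crosses_toggle x y B i :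
  Num.sg (\det (choice_mx (toggle i B))) *
    (Num.sg (facet_coord (toggle i B) y 0 i) * (facet_crosses x y (toggle i B) i)%:R) =
  Num.sg (\det (choice_mx B)) *
    (Num.sg (facet_coord B y 0 i) * (facet_crosses x y B i)%:R) :> R.
Proof.
have d0 C : \det (choice_mx C) != 0 by rewrite -unitfE -unitmxE.
have sgE C : Num.sg (\det (choice_mx C)) * Num.sg (facet_coord C y 0 i) =
    Num.sg ((y *m \adj (choice_mx C)) 0 i).
  rewrite -sgrM /facet_coord invmx_coord// mulrA divff// mul1r.
  by [].
rewrite !mulrA (sgE B) (sgE (toggle i B)) (adj_coord_toggle B y).
congr (_ * _%:R); congr nat_of_bool.
have tE C : crossing_time (facet_coord C x 0) (facet_coord C y 0) i =
    - (x *m \adj (choice_mx C)) 0 i / (y *m \adj (choice_mx C)) 0 i.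
  rewrite /crossing_time /facet_coord !invmx_coord// invfM invrK.
  by rewrite -mulrN mulrACA mulVf// mul1r.
have y0E C : (facet_coord C y 0 i != 0) = ((y *m \adj (choice_mx C)) 0 i != 0).
  by rewrite /facet_coord invmx_coord// mulf_eq0 invr_eq0 (negbTE (d0 C)).
rewrite /facet_crosses /crosses (tE B) (tE (toggle i B)) (y0E B) (y0E (toggle i B)).
rewrite (adj_coord_toggle B x) (adj_coord_toggle B y).
have [//|yi /=] := eqVneq ((y *m \adj (choice_mx B)) 0 i) 0.
congr (_ && _); set t := - _ / _.
have coordE C j : facet_coord C x 0 j + t * facet_coord C y 0 j =
    facet_coord C (x + t *: y) 0 j.
  by rewrite /facet_coord mulmxDl -scalemxAl !mxE.
have z0 : facet_coord B (x + t *: y) 0 i = 0.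
  rewrite -coordE /t -tE /crossing_time divfK ?subrr//.
  by rewrite y0E.
apply: eq_forallb => j; rewrite !coordE.
by rewrite facet_coord_toggle.
Qed.

(** The first family keeps x off the walls of all cones. The second one, y_j x_i - y_i x_j in cone
    coordinates, makes the crossing times of two walls distinct, so that the ray avoids faces of
    codimension 2. *)
Definition generic_functionals (y : 'rV[R]_n) : seq ('cV[R]_n) :=
  [seq col p.2 (invmx (choice_mx p.1)) | p <- enum {: {set 'I_n} * 'I_n}] ++
  [seq facet_coord p.1 y 0 p.2.2 *: col p.2.1 (invmx (choice_mx p.1)) -
       facet_coord p.1 y 0 p.2.1 *: col p.2.2 (invmx (choice_mx p.1))
     | p <- enum {: {set 'I_n} * ('I_n * 'I_n)} & (p.2.1 != p.2.2) &&
       ((facet_coord p.1 y 0 p.2.1 != 0) || (facet_coord p.1 y 0 p.2.2 != 0))].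

Lemma col_invmx_comb B i j (c d : R) : i != j -> (c != 0) || (d != 0) ->
  c *: col i (invmx (choice_mx B)) + d *: col j (invmx (choice_mx B)) != 0.
Proof.
move=> ij cd; apply: contraTneq cd => H.
have E : c *: col i (1%:M : 'M[R]_n) + d *: col j 1%:M = 0.
  have := congr1 (mulmx (choice_mx B)) H.
  by rewrite mulmx0 mulmxDr -!scalemxAr !colE !mulmxA mulmxV// .
have := congr1 (fun M : 'cV[R]_n => M i 0) E.
have := congr1 (fun M : 'cV[R]_n => M j 0) E.
rewrite !mxE !eqxx (negbTE ij) eq_sym (negbTE ij) !mulr0 !mulr1 addr0 add0r.
by move=> -> ->; rewrite eqxx.
Qed.

Lemma generic_functionals_neq0 y w : w \in generic_functionals y -> w != 0.
Proof.
rewrite mem_cat => /orP[/mapP[[B i] _ ->]|/mapP[[B [i j]] + ->]] /=; last first.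
  rewrite mem_filter /= => /andP[/andP[ij yij] _].
  by rewrite -scaleNr; apply: col_invmx_comb => //; rewrite oppr_eq0 orbC.
apply/negP => /eqP H.
have := congr1 (mulmx (choice_mx B)) H.
rewrite mulmx0 colE mulmxA mulmxV// mul1mx => /(congr1 (fun M : 'cV[R]_n => M i 0)).
by rewrite !mxE !eqxx => /eqP; rewrite oner_eq0.
Qed.

Theorem fan_identity (x y : 'rV[R]_n) :
  (forall w, w \in generic_functionals y -> (x *m w) 0 0 != 0) ->
  \sum_(B : {set 'I_n}) (-1) ^+ #|B| * Num.sg (\det (choice_mx B)) *
    [forall i, 0 < facet_coord B x 0 i]%:R =
  \sum_(B : {set 'I_n}) (-1) ^+ #|B| * Num.sg (\det (choice_mx B)) *
    (end_positive (facet_coord B x 0) (facet_coord B y 0))%:R.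
Proof.
move=> gx; apply/eqP; rewrite -subr_eq0 -sumrB; apply/eqP.
have x0 B i : facet_coord B x 0 i != 0.
  have := gx (col i (invmx (choice_mx B))); rewrite facet_coordE; apply.
  by rewrite mem_cat; apply/orP; left; apply/mapP; exists (B, i); rewrite ?mem_enum.
have xy B i j : i != j -> (facet_coord B y 0 i != 0) || (facet_coord B y 0 j != 0) ->
    facet_coord B x 0 i * facet_coord B y 0 j != facet_coord B x 0 j * facet_coord B y 0 i.
  move=> ij yij.
  have := gx (facet_coord B y 0 j *: col i (invmx (choice_mx B)) -
       facet_coord B y 0 i *: col j (invmx (choice_mx B))).
  set w := (X in X \in _).
  have -> : (x *m w) 0 0 = facet_coord B y 0 j * facet_coord B x 0 i -
      facet_coord B y 0 i * facet_coord B x 0 j.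
    by rewrite /w mulmxBr -!scalemxAr -!facet_coordE !mxE.
  rewrite subr_eq0 ![_ * facet_coord B x 0 _]mulrC; apply.
  rewrite mem_cat; apply/orP; right; apply/mapP; exists (B, (i, j)) => //.
  by rewrite mem_filter mem_enum /= ij yij.
rewrite (eq_bigr (fun B : {set _} => \sum_i - ((-1) ^+ #|B| * (Num.sg (\det (choice_mx B)) *
  (Num.sg (facet_coord B y 0 i) * (facet_crosses x y B i)%:R))))); last first.
  move=> B _; rewrite -mulrBr (halfline_crossing (x0 B) (xy B)) mulr_sumr.
  by apply: eq_bigr => i _; rewrite mulrN -mulrA.
rewrite exchange_big big1//= => i _.
(* Toggling i preserves the oriented crossing and reverses the parity of |B|. *)
set S := \sum_B _; suff : S = - S by move=> /eqP; rewrite -addr_eq0 -mulr2n mulrn_eq0 => /eqP.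
rewrite {1}/S (reindex_inj (inv_inj (toggleK i))) -sumrN; apply: eq_bigr => B _.
by rewrite facet_crosses_toggle sign_toggle mulNr.
Qed.

End Fan.

(** * From pointwise signed identities to integrals *)

Section SignedIntegrals.
Context {R : realType}.

Lemma row_measurable_sumr k I (s : seq I) (P : pred I) (f : I -> 'rV[R]_k -> R) :
  (forall i, row_measurable (f i)) ->
  row_measurable (fun x => \sum_(i <- s | P i) f i x).
Proof.
move=> mf; elim: s => [|i s IH].
  rewrite /row_measurable (_ : (fun _ => _) = cst 0).
    exact: measurable_cst.
  by apply/funext => x; rewrite big_nil.
rewrite /row_measurable (_ : (fun _ => _) = if P i
   then (fun t => f i (row_of_tuple t) + \sum_(i <- s | P i) f i (row_of_tuple t))
   else (fun t => \sum_(i <- s | P i) f i (row_of_tuple t))).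
  by case: ifP => _; [exact: measurable_funD (mf i) IH|exact: IH].
by apply/funext => x; rewrite big_cons; case: ifP.
Qed.

Lemma ge0_row_integralD k (f h : 'rV[R]_k -> R) :
  row_measurable f -> row_measurable h -> (forall x, 0 <= f x) -> (forall x, 0 <= h x) ->
  row_integral (fun x => (f x)%:E + (h x)%:E)%E =
  (row_integral (fun x => (f x)%:E) + row_integral (fun x => (h x)%:E))%E.
Proof.
move=> mf mh f0 h0; rewrite /row_integral ge0_iterated_integralD//.
- by apply/measurable_EFinP.
- by apply/measurable_EFinP.
- by move=> t; rewrite lee_fin.
- by move=> t; rewrite lee_fin.
Qed.

Lemma row_integral_sum k I (s : seq I) (P : pred I) (f : I -> 'rV[R]_k -> R) :
  (forall i, row_measurable (f i)) -> (forall i x, 0 <= f i x) ->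
  row_integral (fun x => (\sum_(i <- s | P i) f i x)%:E) =
  (\sum_(i <- s | P i) row_integral (fun x => (f i x)%:E))%E.
Proof.
move=> mf f0; elim: s => [|i s IH].
  rewrite big_nil -[RHS](iterated_integral0 (R := R) k).
  by apply: eq_iterated_integral => t; rewrite big_nil.
rewrite big_cons; case: ifP => Pi; last first.
  by rewrite -IH; apply: eq_row_integral => x; rewrite big_cons Pi.
rewrite -IH /row_integral -ge0_iterated_integralD.
- by apply: eq_iterated_integral => t; rewrite big_cons Pi EFinD.
- by apply/measurable_EFinP; exact: mf.
- by apply/measurable_EFinP; exact: row_measurable_sumr.
- by move=> t; rewrite lee_fin.
- by move=> t; rewrite lee_fin sumr_ge0.
Qed.

(** The integral is additive on nonnegative functions only. The terms of sign -1 are moved to the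
    side of [h], the resulting equality is integrated, and finiteness allows them to be moved
    back. *)
Lemma signed_row_integral k (I : finType) (s : I -> R) (f : I -> 'rV[R]_k -> R)
    (h : 'rV[R]_k -> R) (L : seq 'cV[R]_k) :
  (forall i, s i = 1 \/ s i = -1) ->
  (forall i, row_measurable (f i)) -> row_measurable h ->
  (forall i x, 0 <= f i x) -> (forall x, 0 <= h x) ->
  (forall i, row_integral (fun x => (f i x)%:E) < +oo)%E ->
  (row_integral (fun x => (h x)%:E) < +oo)%E ->
  (forall w, w \in L -> w != 0) ->
  (forall x, (forall w, w \in L -> (x *m w) 0 0 != 0) ->
     \sum_i s i * f i x = h x) ->
  \sum_i s i * fine (row_integral (fun x => (f i x)%:E)) =
  fine (row_integral (fun x => (h x)%:E)).
Proof.
move=> s1 mf mh f0 h0 fy hy L0 sfh.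
have J0 i : (0 <= row_integral (fun x => (f i x)%:E))%E.
  by apply: row_integral_ge0 => x; rewrite lee_fin.
have H0 : (0 <= row_integral (fun x => (h x)%:E))%E.
  by apply: row_integral_ge0 => x; rewrite lee_fin.
pose J i := fine (row_integral (fun x => (f i x)%:E)).
have JE i : row_integral (fun x => (f i x)%:E) = (J i)%:E.
  by rewrite fineK// ge0_fin_numE.
have split_sum (F : I -> R) : \sum_i s i * F i =
    \sum_(i | s i == 1) F i - \sum_(i | s i != 1) F i.
  rewrite (bigID (fun i => s i == 1))/= -sumrN; congr (_ + _); apply: eq_bigr => i.
    by move=> /eqP ->; rewrite mul1r.
  by case: (s1 i) => ->; rewrite ?eqxx// mulN1r.
have E : row_integral (fun x => (\sum_(i | s i == 1) f i x)%:E) =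
    row_integral (fun x => (\sum_(i | s i != 1) f i x)%:E + (h x)%:E)%E.
  apply: (eq_row_integral_off_hyperplanes L0).
  - by apply/measurable_EFinP; exact: row_measurable_sumr.
  - apply: emeasurable_funD; apply/measurable_EFinP => //.
    exact: row_measurable_sumr.
  - by move=> x; rewrite lee_fin sumr_ge0.
  - by move=> x; rewrite -EFinD lee_fin addr_ge0 ?sumr_ge0.
  - by move=> x /sfh <-; rewrite split_sum -EFinD addrC subrK.
move: E; rewrite ge0_row_integralD//; last 2 first.
- exact: row_measurable_sumr.
- by move=> x; rewrite sumr_ge0.
rewrite !row_integral_sum//.
rewrite (eq_bigr _ (fun i _ => JE i)) [in RHS](eq_bigr _ (fun i _ => JE i)).
rewrite !sumEFin -[X in (_ + X)%E](@fineK _ (row_integral _)); last first.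
  by rewrite ge0_fin_numE.
rewrite -EFinD => -[] E.
by rewrite split_sum -/(J _) E addrC addKr.
Qed.

End SignedIntegrals.

Section FanIntegrals.
Context {R : realType}.
Variables (n : nat) (a b : 'I_n -> 'rV[R]_n) (S : 'M[R]_n) (eps : R).
Hypothesis n0 : (0 < n)%N.
Hypothesis uN : forall B, choice_mx a b B \in unitmx.
Local Notation N := (choice_mx a b).

Let g (x : 'rV[R]_n) : R := expR (- (eps * quad S x)).

Let mg : row_measurable g.
Proof.
apply: measurable_fun_expR; apply: measurable_funN; apply: measurable_funM => //.
exact: row_measurable_quadratic.
Qed.

(** All cones live in one common space with the fixed form [S]; passing to the coordinates of the
    cone of [B] yields [cone_integral]. *)
Definition facet_integrand B (x : 'rV[R]_n) : R :=
  if orthant (facet_coord a b B x) then expR (- (eps * quad S x)) else 0.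

Lemma facet_integrand_ge0 B x : 0 <= facet_integrand B x.
Proof. by rewrite /facet_integrand; case: ifP => // _; exact: expR_ge0. Qed.

Lemma row_measurable_facet_integrand B : row_measurable (facet_integrand B).
Proof.
apply: measurable_fun_ifT => //.
  exact: (row_measurable_mulmx _ (@row_measurable_orthant _ n)).
Qed.

Lemma row_integral_facet B :
  (row_integral (fun x => (facet_integrand B x)%:E) =
  `|\det (N B)|%:E *
   row_integral (fun z : 'rV[R]_n =>
    (if orthant z then expR (- (eps * quad (N B *m S *m (N B)^T) z)) else 0)%R%:E))%E.
Proof.
rewrite -(integral_rescalesT (uN B)); last 2 first.
- by apply/measurable_EFinP; exact: row_measurable_facet_integrand.
- by move=> x; rewrite lee_fin facet_integrand_ge0.
congr (_ * _)%E; apply: eq_row_integral => z.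
rewrite /facet_integrand /facet_coord mulmxK//.
by rewrite /quad trmx_mul !mulmxA.
Qed.

Lemma orthant_generic (y x : 'rV[R]_n) B :
  (forall w, w \in generic_functionals a b y -> (x *m w) 0 0 != 0) ->
  orthant (facet_coord a b B x) = [forall i, 0 < facet_coord a b B x 0 i].
Proof.
move=> gx.
have x0 i : facet_coord a b B x 0 i != 0.
  have := gx (col i (invmx (N B))); rewrite facet_coordE; apply.
  by rewrite mem_cat; apply/orP; left; apply/mapP; exists (B, i); rewrite ?mem_enum.
apply/andP/forallP => [[/forallP xi _] i|xi].
  by rewrite lt_neqAle eq_sym x0 xi.
split; first by apply/forallP => i; rewrite ltW.
rewrite (bigD1 (Ordinal n0))//= ltr_pwDl// sumr_ge0// => i _; exact: ltW.
Qed.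

(** [deg] is the signed number of cones over a generic point. The integral over the whole space is
    assumed finite only when [deg] holds, since it diverges for an indefinite form. *)
Theorem fan_integral (y : 'rV[R]_n) (deg : bool) :
  (forall B, row_integral (fun x => (facet_integrand B x)%:E) < +oo)%E ->
  (deg -> row_integral (fun x => (g x)%:E) < +oo)%E ->
  (forall x, \sum_(B : {set 'I_n}) (-1) ^+ #|B| * Num.sg (\det (N B)) *
    (end_positive (facet_coord a b B x 0) (facet_coord a b B y 0))%:R = deg%:R :> R) ->
  \sum_(B : {set 'I_n}) (-1) ^+ #|B| * Num.sg (\det (N B)) *
    fine (row_integral (fun x => (facet_integrand B x)%:E)) =
  deg%:R * fine (row_integral (fun x => (g x)%:E)).
Proof.
move=> fy gy yend.
have -> : deg%:R * fine (row_integral (fun x => (g x)%:E)) =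
    fine (row_integral (fun x => (deg%:R * g x)%:E)).
  rewrite -fineZ// /row_integral -ge0_iterated_integralZ ?lee_fin//.
  - by apply/measurable_EFinP.
  - by move=> t; rewrite lee_fin expR_ge0.
apply: (signed_row_integral (L := generic_functionals a b y)).
- move=> B; have : \det (N B) != 0 by rewrite -unitfE -unitmxE.
  rewrite -signr_odd; case: (odd _); case: sgrP => //= _ _;
    rewrite ?expr0 ?expr1 ?mulr1 ?mulN1r ?mul1r ?opprK; by [left|right].
- exact: row_measurable_facet_integrand.
- by apply: measurable_funM.
- exact: facet_integrand_ge0.
- by move=> x; rewrite mulr_ge0 ?expR_ge0.
- exact: fy.
- case: (deg) gy => [/(_ isT)|_].
    by congr (_ < _)%E; apply: eq_row_integral => x; rewrite mul1r.
  rewrite (eq_row_integral (H := fun=> 0%E)) ?/row_integral ?iterated_integral0//.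
  by move=> x; rewrite mul0r.
- exact: generic_functionals_neq0.
move=> x gx; rewrite -(yend x) -(fan_identity uN gx) mulr_suml; apply: eq_bigr => B _.
rewrite -[RHS]mulrA; congr (_ * _); rewrite /facet_integrand (orthant_generic B gx).
by case: ifP => _; rewrite ?mul1r ?mul0r.
Qed.

End FanIntegrals.

(** * Orientation signs *)

Section MatrixSigns.
Variables (R : realType) (n : nat).

(** Its determinant is the principal minor of [M] on [B]. *)
Definition partial_mx (M : 'M[R]_n) (B : {set 'I_n}) : 'M[R]_n :=
  \matrix_(i, j) if i \in B then M i j else (i == j)%:R.

(* Homotopy to the identity; nonnegativity of [z ^T M z] prevents the
   determinant from vanishing before the end. *)
Lemma det_partial_ge0 (M : 'M[R]_n) (B : {set 'I_n}) :
  (forall z : 'I_n -> R, 0 <= \sum_i \sum_j z i * M i j * z j) ->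
  0 <= \det (partial_mx M B).
Proof.
move=> M0; rewrite leNgt; apply/negP => detN.
pose K := partial_mx M B.
pose KP : 'M[{poly R}]_n :=
  \matrix_(i, j) ((1 - 'X) * ((i == j)%:R)%:P + 'X * (K i j)%:P).
pose p : {poly R} := \det KP.
have pE x : p.[x] = \det (\matrix_(i, j) ((1 - x) * (i == j)%:R + x * K i j)).
  rewrite /p -horner_evalE -det_map_mx; congr determinant.
  apply/matrixP => i j; by rewrite !mxE -[LHS]/(horner _ x) !hornerE.
have p1 : p.[1] = \det K.
  rewrite pE; congr determinant; apply/matrixP => i j.
  by rewrite !mxE subrr mul0r add0r mul1r.
have p0 : p.[0] = 1.
  rewrite pE -[RHS](det1 R n); congr determinant; apply/matrixP => i j.
  by rewrite !mxE subr0 mul1r mul0r addr0.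
(* The determinant is 1 at the identity and supposedly negative at the other end, so it vanishes at
   some x, and x < 1. *)
have [x /andP[x0 x1] rx] : exists2 x, 0 <= x <= 1 & root (- p) x.
  apply: poly_ivt; first exact: ler01.
  by rewrite !hornerN p0 p1 oppr_le0 ler01 oppr_ge0 ltW.
have {}rx : p.[x] = 0 by move: rx; rewrite /root hornerN oppr_eq0 => /eqP.
have {}x1 : x < 1.
  rewrite lt_neqAle x1 andbT; apply: contraTneq detN => xE.
  by rewrite -/K -p1 -xE rx ltxx.
pose A : 'M[R]_n := \matrix_(i, j) ((1 - x) * (i == j)%:R + x * K i j).
have [z z0 Kz] : exists2 z : 'cV[R]_n, z != 0 & A *m z = 0.
  have : \det A^T = 0 by rewrite det_tr -pE.
  move=> /eqP /det0P[w w0 wA]; exists w^T; first by rewrite trmx_eq0.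
  by rewrite -[A]trmxK -trmx_mul wA trmx0.
have rowz i : (1 - x) * z i 0 + x * (\sum_j K i j * z j 0) = 0.
  have := congr1 (fun M : 'cV[R]_n => M i 0) Kz.
  rewrite mxE [RHS]mxE => Ez; rewrite -[RHS]Ez.
  rewrite mulr_sumr -(_ : \sum_j (1 - x) * (i == j)%:R * z j 0 = (1 - x) * z i 0).
    by rewrite -big_split; apply: eq_bigr => j _ /=; rewrite [A i j]mxE; ring.
  rewrite (bigD1 i)//= eqxx mulr1 big1 ?addr0// => j ji.
  by rewrite eq_sym (negbTE ji) mulr0 mul0r.
have zB i : i \notin B -> z i 0 = 0.
  move=> iB; have := rowz i; rewrite (bigD1 i)//= big1 => [|j ji].
    by rewrite !mxE (negbTE iB) eqxx addr0 mul1r -mulrDl subrK mul1r.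
  by rewrite !mxE (negbTE iB) eq_sym (negbTE ji) mul0r.
(* A kernel vector z is supported on B, where K has the rows of M. Pairing with z gives (1 - x)
   |z|^2 + x z^T M z = 0, which forces z = 0. *)
have : \sum_i z i 0 * ((1 - x) * z i 0 + x * (\sum_j K i j * z j 0)) = 0.
  by rewrite big1// => i _; rewrite rowz mulr0.
have -> : \sum_i z i 0 * ((1 - x) * z i 0 + x * (\sum_j K i j * z j 0)) =
   (1 - x) * (\sum_i z i 0 ^+ 2) + x * (\sum_i \sum_j z i 0 * M i j * z j 0).
  rewrite !mulr_sumr -big_split; apply: eq_bigr => i _ /=.
  have [iB|/zB ->] := boolP (i \in B); last first.
    by rewrite expr0n /= !mul0r mulr0 big1 ?mulr0 ?addr0// => j _; rewrite !mul0r.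
  rewrite mulrDr; congr (_ + _); first by ring.
  rewrite mulrCA; congr (_ * _); rewrite mulr_sumr; apply: eq_bigr => j _.
  by rewrite mxE iB mulrA.
move=> E.
have sq0 : \sum_i z i 0 ^+ 2 = 0.
  have s0 : 0 <= \sum_i z i 0 ^+ 2 by apply: sumr_ge0 => i _; exact: sqr_ge0.
  have := M0 (fun i => z i 0); nra.
move: z0; apply/negP; rewrite negbK; apply/eqP/colP => i; rewrite mxE.
apply/eqP; rewrite -sqrf_eq0; apply/eqP.
by apply: (psumr_eq0P (P := xpredT) (F := fun i => z i 0 ^+ 2)) => // j _; exact: sqr_ge0.
Qed.

Variables (M : 'M[R]_n) (alpha beta : 'I_n -> R).
Hypothesis alpha0 : forall i, alpha i != 0.

Definition basis_row (i : 'I_n) : 'rV[R]_n := delta_mx 0 i.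

(** The coordinates of b_i = [beta i] sum_k [M i k] c_k with respect to a_k = [alpha k] c_k. In the
    Euclidean case they are barycentric coordinates, and [alpha k] is the signed altitude. *)
Definition moved_row (i : 'I_n) : 'rV[R]_n := \row_k (beta i * M i k / alpha k).

Local Notation N := (choice_mx basis_row moved_row).

Lemma choice_partial (B : {set 'I_n}) :
  N B = diag_mx (\row_i (if i \in B then beta i else alpha i)) *m
        partial_mx M B *m diag_mx (\row_k (alpha k)^-1).
Proof.
apply/matrixP => i j; rewrite mul_mx_diag mul_diag_mx !mxE.
case: ifP => _; first by rewrite !mxE.
rewrite !mxE eqxx /= eq_sym; have [->|ij] := eqVneq i j; last by rewrite mulr0 mul0r.
by rewrite mulr1 divff.
Qed.

Lemma det_choice (B : {set 'I_n}) :
  \det (N B) = \prod_(i in B) (beta i / alpha i) * \det (partial_mx M B).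
Proof.
rewrite choice_partial !det_mulmx !det_diag mulrAC -big_split /=.
congr (_ * _); rewrite [RHS]big_mkcond; apply: eq_bigr => i _; rewrite !mxE.
by case: ifP => // _; rewrite divff.
Qed.

(** Positive scalings of rows and columns multiply principal minors by positive factors. They are
    needed because the form is nonnegative only after weighting H by the squares of the lambda's;
    off B the left factor undoes the column scaling. *)
Lemma det_partial_scaled_ge0 (p q : 'I_n -> R) (B : {set 'I_n}) :
  (forall i, 0 < p i) -> (forall i, 0 < q i) ->
  (forall z : 'I_n -> R, 0 <= \sum_i \sum_j z i * (p i * M i j * q j) * z j) ->
  0 <= \det (partial_mx M B).
Proof.
move=> p0 q0 Mpos.
pose M' : 'M[R]_n := \matrix_(i, j) (p i * M i j * q j).
have : 0 <= \det (partial_mx M' B).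
  by apply: det_partial_ge0 => z; under eq_bigr do under eq_bigr do rewrite mxE.
have -> : partial_mx M' B = diag_mx (\row_i (if i \in B then p i else (q i)^-1)) *m
      partial_mx M B *m diag_mx (\row_k q k).
  apply/matrixP => i j; rewrite mul_mx_diag mul_diag_mx !mxE.
  case: ifP => // _; have [->|ij] := eqVneq i j; last by rewrite mulr0 mul0r.
  by rewrite mulr1 mulVf// gt_eqF.
rewrite !det_mulmx !det_diag pmulr_lge0 ?pmulr_rge0//.
  by apply: prodr_gt0 => i _; rewrite mxE; case: ifP => _; rewrite ?invr_gt0.
by apply: prodr_gt0 => i _; rewrite mxE.
Qed.

Lemma sg_prod_choice (B : {set 'I_n}) :
  Num.sg (\prod_(i in B) (beta i / alpha i)) =
  \prod_(i in B) (Num.sg (alpha i) * Num.sg (beta i)).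
Proof.
rewrite (big_morph _ (@sgrM R) (@sgr1 R)).
by apply: eq_bigr => i _; rewrite sgrM sgrV mulrC.
Qed.

Lemma sg_det_choice (p q : 'I_n -> R) (B : {set 'I_n}) :
  (forall i, 0 < p i) -> (forall i, 0 < q i) ->
  (forall z : 'I_n -> R, 0 <= \sum_i \sum_j z i * (p i * M i j * q j) * z j) ->
  N B \in unitmx ->
  Num.sg (\det (N B)) = \prod_(i in B) (Num.sg (alpha i) * Num.sg (beta i)).
Proof.
move=> p0 q0 Mpos; rewrite unitmxE unitfE det_choice mulf_eq0 negb_or => /andP[_ d0].
have d1 : 0 < \det (partial_mx M B).
  by rewrite lt_neqAle eq_sym d0 (det_partial_scaled_ge0 _ p0 q0 Mpos).
by rewrite sgrM (gtr0_sg d1) mulr1 sg_prod_choice.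
Qed.

(** Stated for the determinant and not for its sign, so that a flat Euclidean simplex is covered
    too. *)
Lemma norm_det_choice (p q : 'I_n -> R) (B : {set 'I_n}) :
  (forall i, 0 < p i) -> (forall i, 0 < q i) ->
  (forall z : 'I_n -> R, 0 <= \sum_i \sum_j z i * (p i * M i j * q j) * z j) ->
  \prod_(i in B) (Num.sg (alpha i) * Num.sg (beta i)) * \det (N B) = `|\det (N B)|.
Proof.
move=> p0 q0 Mpos; rewrite -sg_prod_choice det_choice normrM.
by rewrite (ger0_norm (det_partial_scaled_ge0 _ p0 q0 Mpos)) mulrA -normrEsg.
Qed.

Hypothesis beta0 : forall i, beta i != 0.

Definition tau i := Num.sg (alpha i) * Num.sg (beta i).

Lemma sign_tau (B : {set 'I_n}) (Y : {set 'I_n}) :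
  (forall i, tau i = if i \in Y then 1 else -1) ->
  (-1) ^+ #|B| * \prod_(i in B) tau i = (-1) ^+ #|B :&: Y| :> R.
Proof.
move=> tauY.
have -> : (-1) ^+ #|B| = \prod_(i in B) (-1) :> R by rewrite prodr_const.
rewrite -big_split /= (eq_bigr (fun i => if i \in Y then -1 else 1)); last first.
  by move=> i _; rewrite tauY; case: ifP => _; rewrite ?mulr1 // mulrNN mulr1.
rewrite -big_mkcondr /= (eq_bigl (fun i => i \in B :&: Y)) ?prodr_const// => i.
by rewrite finset.in_setI.
Qed.

Definition positive_definite :=
  forall z : 'rV[R]_n, (z *m M *m z^T) 0 0 <= 0 -> z = 0.

(** Locates the cones containing a direction x. With z_j = t_j [beta j] on B and 0 elsewhere, z^T M
    z is the sum over k in B of x_k [tau k] times nonnegative numbers, hence is at most 0.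
    Definiteness gives z = 0: no moved vertex takes part, and x is its own combination of the
    a_k. *)
Lemma nonneg_combination (x t : 'rV[R]_n) (B : {set 'I_n}) :
  positive_definite ->
  (forall j, 0 <= t 0 j) -> t *m N B = x ->
  (forall k, k \in B -> x 0 k * tau k <= 0) ->
  (forall k, k \in B -> x 0 k = 0 /\ t 0 k = 0) /\
  (forall k, k \notin B -> t 0 k = x 0 k).
Proof.
move=> Mpd t0 tN xk.
pose z : 'rV[R]_n := \row_j (if j \in B then t 0 j * beta j else 0).
have coord k : x 0 k * alpha k = (z *m M) 0 k + (if k \in B then 0 else t 0 k * alpha k).
  rewrite -tN mxE mulr_suml [in RHS]mxE.
  have inB l : l \in B -> t 0 l * N B l k * alpha k = z 0 l * M l k.
    by move=> lB; rewrite !mxE lB !mxE; field; exact: alpha0.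
  have notinB l : l \notin B -> t 0 l * N B l k * alpha k = t 0 l * (k == l)%:R * alpha k.
    by move=> lB; rewrite !mxE (negbTE lB) !mxE.
  have z0 l : l \notin B -> z 0 l = 0 by move=> lB; rewrite mxE (negbTE lB).
  have [kB|kB] := boolP (k \in B).
    rewrite addr0; apply: eq_bigr => l _; have [lB|lB] := boolP (l \in B); first exact: inB.
    rewrite notinB// z0// mul0r; case: eqP lB => [<-|_ _]; first by rewrite kB.
    by rewrite mulr0 mul0r.
  rewrite (bigD1 k)//= [X in _ = X + _](bigD1 k)//= addrC.
  rewrite notinB// z0// eqxx mulr1 mul0r add0r; congr (_ + _).
  apply: eq_bigr => l lk; have [lB|lB] := boolP (l \in B); first exact: inB.
  by rewrite notinB// z0// eq_sym (negbTE lk) mulr0 !mul0r.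
have zMz : (z *m M *m z^T) 0 0 = \sum_(k in B) x 0 k * alpha k * (t 0 k * beta k).
  rewrite mxE [RHS]big_mkcond; apply: eq_bigr => k _; rewrite [z^T k 0]mxE [z 0 k]mxE.
  case: ifP => kB; last by rewrite mulr0.
  by rewrite coord kB addr0.
have z0 : z = 0.
  apply: Mpd; rewrite zMz; apply: sumr_le0 => k kB.
  have -> : x 0 k * alpha k * (t 0 k * beta k) =
     (x 0 k * tau k) * (t 0 k * `|alpha k| * `|beta k|).
    rewrite /tau {1}[alpha k]numEsg {1}[beta k]numEsg; ring.
  by rewrite mulr_le0_ge0 ?xk// !mulr_ge0.
split=> k kB.
  have := coord k; rewrite z0 mul0mx mxE kB addr0 => /eqP.
  rewrite mulf_eq0 (negbTE (alpha0 k)) orbF => /eqP ->; split=> //.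
  have := congr1 (fun w : 'rV[R]_n => w 0 k) z0; rewrite !mxE kB => /eqP.
  by rewrite mulf_eq0 (negbTE (beta0 k)) orbF => /eqP.
have := coord k; rewrite z0 mul0mx mxE (negbTE kB) add0r.
by move=> /(mulIf (alpha0 k)).
Qed.

End MatrixSigns.

(** * Identities for the coefficients of the flex *)

Section Coefficients.
Variables (R : realType) (n : nat) (G : 'M[R]_n) (lam : 'I_n -> R).
Hypothesis Gsym : G^T = G.
Hypothesis Gdiag : forall i, G i i = 1.
Hypothesis lam0 : forall i, 0 < lam i.
Hypothesis lam_incr : forall i j : 'I_n, (i < j)%N -> lam i < lam j.

Lemma lam_sqrB i j : i != j -> lam i ^+ 2 - lam j ^+ 2 != 0.
Proof.
move=> ij; rewrite subr_sqr mulf_neq0 //; last by rewrite gt_eqF ?addr_gt0.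
rewrite subr_eq0.
have : (i != j :> nat) by [].
by rewrite neq_ltn => /orP[/lam_incr|/lam_incr] h; [rewrite (lt_eqF h)|rewrite (gt_eqF h)].
Qed.

Lemma G_sym i j : G i j = G j i.
Proof. by rewrite -[in RHS]Gsym mxE. Qed.

Local Notation h := (hcoef G lam).

Lemma hcoefii i : h i i = 1.
Proof. by rewrite /hcoef eqxx. Qed.

(** The symmetric part of H is G; this turns H at u = 0 into minus its transpose at u = oo. *)
Lemma hcoefD i j : h i j + h j i = 2 * G i j.
Proof.
have [->|ij] := eqVneq i j; first by rewrite hcoefii Gdiag; ring.
rewrite /hcoef [j == i]eq_sym (negbTE ij) [G j i]G_sym.
have := lam_sqrB ij; rewrite eq_sym in ij; have := lam_sqrB ij => d1 d2.
by field; rewrite d1 d2.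
Qed.

(** The symmetric part of the weighted matrix is the rank one matrix of products of lambda's, hence
    nonnegative. *)
Lemma hcoef_lam i j : h i j * lam j ^+ 2 + lam i ^+ 2 * h j i = 2 * (lam i * lam j).
Proof.
have [->|ij] := eqVneq i j; first by rewrite hcoefii; ring.
rewrite /hcoef [j == i]eq_sym (negbTE ij) [G j i]G_sym.
have := lam_sqrB ij; rewrite eq_sym in ij; have := lam_sqrB ij => d1 d2.
by field; rewrite d1 d2.
Qed.

(** Equivalently (ncoef - 1)^2 + mcoef^2 = 1: the vertex turns on a circle in a plane parallel to
    n_i and m. This makes <d_i, d_i> constant. *)
Lemma coef_norm l (u : option R) :
  2 * ncoef l u = ncoef l u ^+ 2 + mcoef l u ^+ 2.
Proof.
case: u => [x|] /=; last by ring.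
have : l ^+ 2 * x ^+ 2 + 1 != 0.
  by rewrite gt_eqF// ltr_wpDl// mulr_ge0// sqr_ge0.
by move=> d; field; rewrite exprMn.
Qed.

(** Makes <d_i, d_j> constant; it is the identity for which h_ij is designed. *)
Lemma coef_cross i j (u : option R) : i != j ->
  ncoef (lam j) u * h i j + ncoef (lam i) u * h j i =
  ncoef (lam i) u * ncoef (lam j) u * G i j + mcoef (lam i) u * mcoef (lam j) u.
Proof.
move=> ij; case: u => [x|] /=; last first.
  by rewrite mul0r addr0 -mulrDr hcoefD; ring.
have d l : l ^+ 2 * x ^+ 2 + 1 != 0.
  by rewrite gt_eqF// ltr_wpDl// mulr_ge0// sqr_ge0.
have di := d (lam i); have dj := d (lam j).
rewrite /hcoef [j == i]eq_sym (negbTE ij) [G j i]G_sym.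
have := lam_sqrB ij; rewrite eq_sym in ij; have := lam_sqrB ij => d1 d2.
by field; rewrite !exprMn di dj d1 d2.
Qed.

End Coefficients.

(** * The forms of the sphere and of the Lobachevsky space *)

Section SpaceForms.
Variable R : realType.

Lemma cauchy_schwarz_sum (I : finType) (x y : I -> R) :
  (\sum_i x i * y i) ^+ 2 <= (\sum_i x i ^+ 2) * (\sum_i y i ^+ 2).
Proof.
set A := \sum_i y i ^+ 2; set B := \sum_i x i * y i; set C := \sum_i x i ^+ 2.
have A0 : 0 <= A by apply: sumr_ge0 => i _; exact: sqr_ge0.
have : 0 <= \sum_i (A * x i - B * y i) ^+ 2.
  by apply: sumr_ge0 => i _; exact: sqr_ge0.
have -> : \sum_i (A * x i - B * y i) ^+ 2 = A * (C * A - B ^+ 2).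
  rewrite (eq_bigr (fun i => A ^+ 2 * x i ^+ 2 + (- (2 * A * B)) * (x i * y i)
    + B ^+ 2 * y i ^+ 2)) => [|i _]; last by ring.
  by rewrite !big_split /= -!mulr_sumr -/A -/B -/C; ring.
move: A0; rewrite le_eqVlt => /orP[/eqP A0 _|A0]; last first.
  by rewrite pmulr_rge0// subr_ge0.
have y0 i : y i = 0.
  apply/eqP; rewrite -sqrf_eq0; apply/eqP.
  by apply: (psumr_eq0P (P := xpredT) (F := fun i => y i ^+ 2)) => // j _; exact: sqr_ge0.
by rewrite /B big1 ?expr0n -?A0 ?mulr0// => i _; rewrite y0 mulr0.
Qed.

Variable n : nat.

Lemma form_spherical (x y : 'rV[R]_(ambient_dim Spherical n)) :
  form x y = \sum_k x 0 k * y 0 k.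
Proof. by apply: eq_bigr => k _; rewrite mul1r. Qed.

Lemma form_lobachevsky (x y : 'rV[R]_(ambient_dim Lobachevsky n)) :
  form x y = - (x 0 ord0 * y 0 ord0) +
    \sum_(k < n) x 0 (lift ord0 k) * y 0 (lift ord0 k).
Proof.
rewrite /form /= big_ord_recl /= mulN1r; congr (_ + _).
by apply: eq_bigr => k _; rewrite mul1r.
Qed.

Lemma form_spherical_ge0 (x : 'rV[R]_(ambient_dim Spherical n)) : 0 <= form x x.
Proof. by rewrite form_spherical sumr_ge0// => k _; rewrite -expr2 sqr_ge0. Qed.

Lemma form_spherical_eq0 (x : 'rV[R]_(ambient_dim Spherical n)) :
  form x x = 0 -> x = 0.
Proof.
rewrite form_spherical => x0; apply/rowP => k; rewrite mxE.
apply/eqP; rewrite -sqrf_eq0 expr2; apply/eqP.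
by apply: (psumr_eq0P (P := xpredT) (F := fun k => x 0 k * x 0 k)) => // j _;
  rewrite -expr2 sqr_ge0.
Qed.

Lemma on_lobachevsky (p : 'rV[R]_(ambient_dim Lobachevsky n)) :
  on_space p -> form p p = -1 /\ 0 < p 0 ord0.
Proof. by move=> [? h]; split => //; exact: h. Qed.

(** Cauchy-Schwarz for the space-like coordinates: their product cannot exceed the product of the
    time coordinates, which are positive. *)
Lemma form_lobachevsky_le0 (p q : 'rV[R]_(ambient_dim Lobachevsky n)) :
  on_space p -> on_space q -> form p q <= 0.
Proof.
move=> /on_lobachevsky[fp p0] /on_lobachevsky[fq q0].
move: fp fq; rewrite !form_lobachevsky.
have := cauchy_schwarz_sum (fun k => p 0 (lift ord0 k)) (fun k => q 0 (lift ord0 k)).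
under [X in _ <= X * _]eq_bigr do rewrite expr2.
under [X in _ <= _ * X]eq_bigr do rewrite expr2.
set A := \sum_k p 0 _ * p 0 _; set B := \sum_k q 0 _ * q 0 _; set C := \sum_k _.
set a := p 0 ord0 in p0 *; set b := q 0 ord0 in q0 *.
move=> cs fp fq.
rewrite addrC subr_le0 leNgt; apply/negP => abC.
have A_E : A = a * a - 1 by lra.
have B_E : B = b * b - 1 by lra.
have : (a * b) ^+ 2 < C ^+ 2 by rewrite ltr_pXn2r// ?nnegrE;
  [exact/ltW/mulr_gt0|exact/ltW/(lt_trans _ abC)/mulr_gt0].
have A0 : 0 <= A by apply: sumr_ge0 => k _; rewrite -expr2 sqr_ge0.
move: cs; rewrite A_E B_E; rewrite A_E in A0; nra.
Qed.

(** In both spaces the form is positive definite on the orthogonal complement of a point of the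
    space. *)
Lemma orthogonal_isotropic (X : geometry) (p y : 'rV[R]_(ambient_dim X n)) :
  X <> Euclidean -> on_space p -> form y p = 0 -> form y y = 0 -> y = 0.
Proof.
case: X p y => // p y _.
  by move=> _ _; exact: form_spherical_eq0.
move=> /on_lobachevsky[fp p0]; move: fp; rewrite !form_lobachevsky.
have := cauchy_schwarz_sum (fun k => y 0 (lift ord0 k)) (fun k => p 0 (lift ord0 k)).
under [X in _ <= X * _]eq_bigr do rewrite expr2.
under [X in _ <= _ * X]eq_bigr do rewrite expr2.
set A := \sum_k y 0 _ * y 0 _; set B := \sum_k p 0 _ * p 0 _; set C := \sum_k _.
move: p0; set b := p 0 ord0; set a := y 0 ord0.
move=> b0 cs fp yp yy.
have A_E : A = a * a by lra.
have B_E : B = b * b - 1 by lra.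
have C_E : C = a * b by lra.
have a0 : a = 0.
  apply/eqP; rewrite -sqrf_eq0; apply/eqP; apply/le_anti; rewrite sqr_ge0 andbT.
  by move: cs; rewrite A_E B_E C_E; nra.
apply/rowP => k; rewrite mxE; have [->|[j ->]] : k = ord0 \/ exists j, k = lift ord0 j.
- by case: (unliftP ord0 k) => [j ->|->]; [right; exists j|left].
- exact: a0.
apply/eqP; rewrite -sqrf_eq0 expr2; apply/eqP.
apply: (psumr_eq0P (P := xpredT) (F := fun k => y 0 (lift ord0 k) * y 0 (lift ord0 k))) => //.
  by move=> i _; rewrite -expr2 sqr_ge0.
by rewrite -/A A_E a0 mul0r.
Qed.

End SpaceForms.

(** * Facets of the cross-polytope as choices of one vertex from each pair *)

Section Choice.
Variable n : nat.

Definition choice_vertex (B : {set 'I_n}) (i : 'I_n) : vertex n :=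
  if i \in B then inr i else inl i.

Lemma choice_vertex_inj B : injective (choice_vertex B).
Proof.
by rewrite /choice_vertex => i j; case: ifP => _; case: ifP => _ // [].
Qed.

Definition choice_simplex (B : {set 'I_n}) : {set vertex n} :=
  [set choice_vertex B i | i in [set: 'I_n]].

Lemma choice_simplex_cross B : (0 < n)%N -> choice_simplex B \in cross_complex n.
Proof.
move=> n0; rewrite /cross_complex inE; apply/andP; split.
  by apply/set0Pn; exists (choice_vertex B (Ordinal n0)); apply/imsetP; exists (Ordinal n0).
apply/forallP => i; apply/negP => /andP[/imsetP[j _ +] /imsetP[k _ +]].
rewrite /choice_vertex; case: ifP => // jB [ij]; case: ifP => // kB [ik].
by rewrite -ij ik kB in jB.
Qed.

Lemma sum_disjoint_covers (R : realType) (F : {set 'I_n} -> {set 'I_n} -> R) :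
  \sum_(AB : {set 'I_n} * {set 'I_n}
         | [disjoint AB.1 & AB.2] && (AB.1 :|: AB.2 == [set: 'I_n]))
     F AB.1 AB.2 = \sum_(B : {set 'I_n}) F (~: B) B.
Proof.
rewrite (reindex_onto (fun B : {set 'I_n} => (~: B, B)) snd) /=; last first.
  move=> [A B] /= /andP[dAB /eqP UAB]; congr (_, _).
  apply/setP => i; rewrite finset.in_setC.
  have := finset.in_setT i; rewrite -UAB finset.in_setU.
  have [iB _|iB] := boolP (i \in B); last by rewrite orbF => ->.
  apply/esym/negbTE; apply/negP => iA; move: dAB.
  by rewrite disjoint_sym => /disjointFr/(_ iB); rewrite iA.
apply: eq_bigl => B; rewrite eqxx andbT finset.setUC finset.setUCr eqxx andbT.
by rewrite finset.disjoints_subset fintype.subxx.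
Qed.

Lemma perm_enum_setC (B : {set 'I_n}) :
  uniq (enum (~: B) ++ enum B) /\ size (enum (~: B) ++ enum B) = n.
Proof.
split; last by rewrite size_cat -!cardE addnC cardsC card_ord.
rewrite cat_uniq !enum_uniq andbT /=; apply/hasPn => i.
by rewrite !mem_enum finset.in_setC => ->.
Qed.

Lemma face_volume_choice (R : realType) (X : geometry)
    (p : vertex n -> 'rV[R]_(ambient_dim X n)) (B : {set 'I_n}) :
  face_volume p (~: B) B =
  simplex_volume [seq p (choice_vertex B i) | i <- enum (~: B) ++ enum B].
Proof.
rewrite /face_volume map_cat; congr (simplex_volume (_ ++ _)); apply/eq_in_map => i.
  by rewrite mem_enum finset.in_setC /choice_vertex => /negbTE ->.
by rewrite mem_enum /choice_vertex => ->.
Qed.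

Lemma exists_nondegenerate (R : realType) (X : geometry)
    (P : option R -> vertex n -> 'rV[R]_(ambient_dim X n)) :
  finite_set (fun u => ~ nondegenerate (P u)) ->
  exists u, nondegenerate (P u).
Proof.
move=> fin; apply: contrapT => /forallNP bad; apply: infinite_nat.
(* The natural numbers provide infinitely many parameters, too many to be all exceptional. *)
have inj : injective (fun m : nat => Some (m%:R : R)).
  by move=> i j [] /eqP; rewrite eqr_nat => /eqP.
have := finite_preimage (in2W inj) fin.
by congr finite_set; apply/seteqP; split => // i _; exact: bad.
Qed.

Lemma independent_choice (R : realType) (X : geometry)
    (p : vertex n -> 'rV[R]_(ambient_dim X n)) (B : {set 'I_n}) (w : 'I_n -> R) :
  (0 < n)%N -> nondegenerate p ->
  \sum_i w i *: p (choice_vertex B i) = 0 ->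
  (if X is Euclidean then \sum_i w i = 0 else True) ->
  forall i, w i = 0.
Proof.
move=> n0 [ind _] wp ws i.
pose c (v : vertex n) : R := match v with inl j => w j | inr j => w j end.
have cE j : c (choice_vertex B j) = w j by rewrite /choice_vertex; case: ifP.
have sumE (V : nmodType) (F : vertex n -> V) :
    \sum_(v in choice_simplex B) F v = \sum_j F (choice_vertex B j).
  rewrite big_imset /=; last by move=> ? ? _ _; exact: choice_vertex_inj.
  by apply: eq_bigl => j; rewrite finset.in_setT.
have := ind _ (choice_simplex_cross B n0) c.
rewrite !sumE => /(_ _ _ (choice_vertex B i)); rewrite cE; apply.
- by rewrite -[RHS]wp; apply: eq_bigr => j _; rewrite cE.
- move: ws; case: (X) => // ws; rewrite -[RHS]ws.
  by apply: eq_bigr => j _; rewrite cE.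
- by apply/imsetP; exists i.
Qed.

End Choice.

(** * Flexible cross-polytopes in the sphere and the Lobachevsky space *)

Section CurvedFamily.
Variables (R : realType) (X : geometry) (n : nat) (G : 'M[R]_n).
Variables (lam s s' : 'I_n -> R) (P : option R -> vertex n -> 'rV[R]_(ambient_dim X n)).
Hypothesis curved : X <> Euclidean.
Hypothesis n0 : (0 < n)%N.
Hypothesis adm : admissible_data X G lam s s'.
Local Notation V := 'rV[R]_(ambient_dim X n).
Local Notation h := (hcoef G lam).
Variables (nn c : 'I_n -> V) (m : V).
Hypothesis frame : normal_frame G nn m.
Hypothesis dual_span : forall i, (c i <= \matrix_j nn j)%MS.
Hypothesis dual : forall i j, form (c i) (nn j) = (i == j)%:R.
Local Notation d := (dvec G lam nn c m).
Hypothesis PE : forall u i,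
  P u (inl i) = (s i / vnorm (c i)) *: c i /\
  P u (inr i) = (s' i / vnorm (d i u)) *: d i u.
Hypothesis space : forall u v, on_space (P u v).

Let Gsym : G^T = G. Proof. by case: adm. Qed.
Let Gdiag i : G i i = 1. Proof. by case: adm. Qed.
Let lam0 i : 0 < lam i. Proof. by case: adm => _ _ _ _ []. Qed.
Let lamI (i j : 'I_n) : (i < j)%N -> lam i < lam j.
Proof. by case: adm => _ _ _ _ [_ H _]; exact: H. Qed.

Lemma span_combination (x : V) : (x <= \matrix_j nn j)%MS ->
  exists w : 'I_n -> R, x = \sum_j w j *: nn j.
Proof.
move=> /submxP[D ->]; exists (fun j => D 0 j).
by rewrite mulmx_sum_row; apply: eq_bigr => j _; rewrite rowK.
Qed.

Let Dv i : V := \sum_j h i j *: c j.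

Lemma form_m_dual i : form m (c i) = 0.
Proof.
have [w ->] := span_combination (dual_span i); have [_ mn _] := frame.
by rewrite form_sumr big1// => j _; rewrite formZr mn mulr0.
Qed.

Lemma form_base_normal i j : form (Dv i) (nn j) = h i j.
Proof.
rewrite form_suml (bigD1 j)//= formZl dual eqxx mulr1 big1 ?addr0// => k kj.
by rewrite formZl dual (negbTE kj) mulr0.
Qed.

Lemma form_base_m i : form (Dv i) m = 0.
Proof. by rewrite form_suml big1// => k _; rewrite formZl formC form_m_dual mulr0. Qed.

Lemma form_combination (x y p q w : V) (a a' b b' : R) :
  form (x - a *: p + b *: w) (y - a' *: q + b' *: w) =
  form x y - a' * form x q + b' * form x w - a * form y p + a * a' * form p q
  - a * b' * form w p + b * form y w - b * a' * form w q + b * b' * form w w.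
Proof.
rewrite !(formDl, formDr, formNl, formNr, formZl, formZr).
by rewrite [form p y]formC [form p w]formC [form w y]formC; ring.
Qed.

Lemma form_dvec i j u : form (d i u) (d j u) = form (Dv i) (Dv j).
Proof.
have [nnG mn mm] := frame.
rewrite /dvec -!/(Dv _) form_combination !form_base_normal !form_base_m !mn mm nnG.
have [->|ij] := eqVneq i j.
  have := coef_norm (lam j) u; rewrite hcoefii Gdiag; move: (ncoef _ _) (mcoef _ _) => A B.
  by move=> H; lra.
have := coef_cross Gsym Gdiag lam0 lamI u ij.
move: (ncoef _ _) (ncoef _ _) (mcoef _ _) (mcoef _ _) => A A' B B' H.
by lra.
Qed.

Lemma form_dvec_dual i j u : i != j -> form (d i u) (c j) = form (Dv i) (c j).
Proof.
move=> ij; rewrite /dvec formDl formBl !formZl form_m_dual mulr0 addr0.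
by rewrite [form (nn i) _]formC dual eq_sym (negbTE ij) mulr0 subr0.
Qed.

Lemma vnorm_dvec i u : vnorm (d i u) = vnorm (Dv i).
Proof. by rewrite /vnorm form_dvec. Qed.

(** Only the product of a_i with b_i of the same index may vary with u, and these two vertices never
    belong to one face. *)
Lemma choice_gram_const (B : {set 'I_n}) i j u u' :
  form (P u (choice_vertex B i)) (P u (choice_vertex B j)) =
  form (P u' (choice_vertex B i)) (P u' (choice_vertex B j)).
Proof.
rewrite /choice_vertex; case: ifP => iB; case: ifP => jB;
  have [Pui Pui'] := PE u i; have [Puj Puj'] := PE u j;
  have [Qui Qui'] := PE u' i; have [Quj Quj'] := PE u' j.
- by rewrite Pui' Puj' Qui' Quj' !vnorm_dvec !(formZl, formZr) !form_dvec.
- have ij : i != j by apply: contraTneq iB => ->; rewrite jB.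
  by rewrite Pui' Puj Qui' Quj !vnorm_dvec !(formZl, formZr) !form_dvec_dual.
- have ij : j != i by apply: contraTneq jB => ->; rewrite iB.
  rewrite Pui Puj' Qui Quj' !vnorm_dvec !(formZl, formZr) ![form (c i) _]formC.
  by rewrite !form_dvec_dual.
- by rewrite Pui Puj Qui Quj.
Qed.

(** Transports independence from a nondegenerate parameter [u0] to any [u]. The coefficients of a
    relation at [u], used at [u0], give a vector orthogonal to all vertices of the facet, hence
    isotropic and orthogonal to a point of the space, hence zero. *)
Lemma choice_free u0 u (B : {set 'I_n}) (w : 'I_n -> R) :
  nondegenerate (P u0) ->
  \sum_i w i *: P u (choice_vertex B i) = 0 -> forall i, w i = 0.
Proof.
move=> nd wu; apply: (independent_choice (B := B) n0 nd); last first.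
  by case: (X) curved.
set y := \sum_i _.
have yv j : form y (P u0 (choice_vertex B j)) = 0.
  transitivity (form (\sum_i w i *: P u (choice_vertex B i)) (P u (choice_vertex B j))).
    rewrite !form_suml; apply: eq_bigr => i _; rewrite !formZl.
    by rewrite (choice_gram_const B i j u0 u).
  by rewrite wu form0l.
apply: (orthogonal_isotropic curved (space u0 (choice_vertex B (Ordinal n0)))) => //.
by rewrite {2}/y form_sumr big1// => i _; rewrite formZr yv mulr0.
Qed.

(** The difference of the two sides lies in the span of the normals and is orthogonal to all of
    them, while G is invertible. *)
Lemma normal_dual_expansion i : \det G != 0 -> nn i = \sum_j G i j *: c j.
Proof.
move=> G0; have [nnG _ _] := frame; apply/eqP; rewrite -subr_eq0; apply/eqP.
set y := _ - _.
have yn k : form y (nn k) = 0.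
  rewrite /y formBl nnG form_suml (bigD1 k)//= formZl dual eqxx mulr1 big1 ?addr0 ?subrr//.
  by move=> j jk; rewrite formZl dual (negbTE jk) mulr0.
have ysub : (y <= \matrix_j nn j)%MS.
  apply: addmx_sub; first by rewrite -[nn i](rowK nn) row_sub.
  by rewrite eqmx_opp summx_sub// => j _; exact: scalemx_sub.
have [w yw] := span_combination ysub.
have wG : (\row_j w j) *m G = 0.
  apply/rowP => k; rewrite !mxE -[RHS](yn k) yw form_suml; apply: eq_bigr => j _.
  by rewrite !mxE formZl nnG.
have w0 : \row_j w j = 0.
  have uG : G \in unitmx by rewrite unitmxE unitfE.
  by rewrite -[LHS](mulmxK uG) wG mul0mx.
rewrite yw big1// => j _; have := congr1 (fun r : 'rV_n => r 0 j) w0.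
by rewrite !mxE => ->; rewrite scale0r.
Qed.

Lemma dvec_zero i : d i (Some 0) = \sum_j h i j *: c j.
Proof.
by rewrite /dvec /= expr0n /= !mulr0 !mul0r scale0r subr0 scale0r addr0.
Qed.

Lemma dvec_infty i : \det G != 0 -> d i None = \sum_j (- h j i) *: c j.
Proof.
move=> G0; rewrite /dvec /= scale0r addr0 normal_dual_expansion// scaler_sumr -sumrB.
apply: eq_bigr => j _; rewrite scalerA -scalerBl; congr (_ *: _).
by rewrite -(hcoefD Gsym Gdiag lam0 lamI); ring.
Qed.

End CurvedFamily.

(** * The signed sum of volumes in a collapsed position *)

Section CurvedCore.
Variables (R : realType) (X : geometry) (n : nat).
Hypothesis curved : X <> Euclidean.
Hypothesis n0 : (0 < n)%N.
Local Notation V := 'rV[R]_(ambient_dim X n).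

(* [Q] is the collapsed cross-polytope (u = 0 or u = oo), whose vertices lie in
   the span of the [c k]; [v] is the flexed one, with the same Gram matrices. *)
Variables (v Q : vertex n -> V) (c : 'I_n -> V).
Variables (M : 'M[R]_n) (alpha beta : 'I_n -> R) (Y : {set 'I_n}).
Hypothesis gram_const : forall (B : {set 'I_n}) i j,
  form (v (choice_vertex B i)) (v (choice_vertex B j)) =
  form (Q (choice_vertex B i)) (Q (choice_vertex B j)).
Hypothesis Q_free : forall (B : {set 'I_n}) (w : 'I_n -> R),
  \sum_i w i *: Q (choice_vertex B i) = 0 -> forall i, w i = 0.
Hypothesis alpha0 : forall i, alpha i != 0.
Hypothesis QlE : forall i, Q (inl i) = alpha i *: c i.
Hypothesis QrE : forall i, Q (inr i) = \sum_k (beta i * M i k) *: c k.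
Hypothesis tauY : forall i, tau alpha beta i = if i \in Y then 1 else -1.
Variables p q : 'I_n -> R.
Hypothesis p0 : forall i, 0 < p i.
Hypothesis q0 : forall i, 0 < q i.
Hypothesis Mpos : forall z : 'I_n -> R, 0 <= \sum_i \sum_j z i * (p i * M i j * q j) * z j.

Local Notation N := (choice_mx (@basis_row R n) (moved_row M alpha beta)).

Definition collapsed_gram : 'M[R]_n := \matrix_(i, j) form (Q (inl i)) (Q (inl j)).

Lemma choice_rowE B i :
  Q (choice_vertex B i) = \sum_k N B i k *: Q (inl k).
Proof.
rewrite /choice_vertex; case: ifP => iB.
  rewrite QrE; apply: eq_bigr => k _; rewrite QlE scalerA !mxE iB !mxE.
  by rewrite divfK.
rewrite (bigD1 i)//= big1 ?addr0 => [|k ki].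
  by rewrite !mxE iB !mxE !eqxx scale1r.
by rewrite !mxE iB !mxE (negbTE ki) andbF scale0r.
Qed.

Lemma choice_combination B (w : 'rV[R]_n) :
  \sum_i w 0 i *: Q (choice_vertex B i) = \sum_k (w *m N B) 0 k *: Q (inl k).
Proof.
under eq_bigr do rewrite choice_rowE scaler_sumr.
rewrite exchange_big /=; apply: eq_bigr => k _.
by rewrite mxE scaler_suml; apply: eq_bigr => i _; rewrite scalerA.
Qed.

Lemma choice_unit B : N B \in unitmx.
Proof.
rewrite unitmxE unitfE; apply/negP => /det0P[w w0 wN].
move: w0; apply/negP; rewrite negbK; apply/eqP/rowP => i; rewrite mxE.
apply: (Q_free (B := B) (w := fun i => w 0 i)); rewrite choice_combination wN.
by rewrite big1// => k _; rewrite mxE scale0r.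
Qed.

Definition choice_gram B : 'M[R]_n :=
  \matrix_(i, j) form (Q (choice_vertex B i)) (Q (choice_vertex B j)).

Lemma choice_gramE B : choice_gram B = N B *m collapsed_gram *m (N B)^T.
Proof.
apply/matrixP => i j; rewrite !mxE choice_rowE form_suml.
under eq_bigr => k _ do rewrite formZl choice_rowE form_sumr mulr_sumr.
rewrite exchange_big /=; apply: eq_bigr => l _.
rewrite [in RHS]mxE [_^T _ _]mxE mulr_suml; apply: eq_bigr => k _.
by rewrite formZr [collapsed_gram _ _]mxE; ring.
Qed.

Lemma quad_choice_gram B z :
  quad (choice_gram B) z =
  form (\sum_i z 0 i *: Q (choice_vertex B i)) (\sum_i z 0 i *: Q (choice_vertex B i)).
Proof.
rewrite /quad mxE form_sumr; apply: eq_bigr => j _.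
rewrite formZr mxE form_suml mulrC [_^T _ _]mxE; congr (_ * _).
by apply: eq_bigr => i _; rewrite formZl mxE.
Qed.

Variable eps : R.
Hypothesis epsE : eps = 1 \/ eps = -1.
Hypothesis quad_pos : forall B z, orthant z -> 0 < eps * quad (choice_gram B) z.

(** The factor |det N_B| in the root of the Gram determinant is the Jacobian of the cone
    coordinates. What remains in front of the integral does not depend on B, so the volumes may be
    added as integrals over cones in one space. *)
Lemma volume_facet_integral (B : {set 'I_n}) :
  fine (radial_integral n.-1) * face_volume v (~: B) B =
  Num.sqrt (eps * \det collapsed_gram) *
  fine (row_integral (fun x => (facet_integrand (@basis_row R n)
     (moved_row M alpha beta) collapsed_gram eps B x)%:E)).
Proof.
have [ul sl] := perm_enum_setC B.
have SE : \matrix_(i, j) form (v (choice_vertex B i)) (v (choice_vertex B j)) = choice_gram B.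
  by apply/matrixP => i j; rewrite !mxE gram_const.
rewrite face_volume_choice (@curved_volume_family _ _ _ curved eps n)//; last first.
  by rewrite SE; exact: quad_pos.
rewrite SE row_integral_facet; last exact: choice_unit.
rewrite fineZ// choice_gramE -/(cone_integral _ _) mulrA; congr (_ * _).
rewrite !det_mulmx det_tr.
have -> : eps * (\det (N B) * \det collapsed_gram * \det (N B)) =
  (\det (N B)) ^+ 2 * (eps * \det collapsed_gram) by ring.
by rewrite sqrtrM ?sqr_ge0// sqrtr_sqr mulrC.
Qed.

(** Two situations in one statement: for [deg] false the direction y lies in no closed cone; for
    [deg] true it is interior to the cone of the a_i and lies in no other closed cone. *)
Theorem signed_volume_sum (y : 'rV[R]_n) (deg : bool) :
  (forall B, row_integral (fun x => (facet_integrand (@basis_row R n)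
     (moved_row M alpha beta) collapsed_gram eps B x)%:E) < +oo)%E ->
  (deg -> row_integral (fun x : 'rV[R]_n =>
     (expR (- (eps * quad collapsed_gram x)))%:E) < +oo)%E ->
  (forall (B : {set 'I_n}) (t : 'rV[R]_n), (forall j, 0 <= t 0 j) -> t *m N B = y ->
     deg && (B == finset.set0)) ->
  (deg -> forall j, 0 < y 0 j) ->
  fine (radial_integral n.-1) *
    \sum_(B : {set 'I_n}) (-1) ^+ #|B :&: Y| * face_volume v (~: B) B =
  Num.sqrt (eps * \det collapsed_gram) * (deg%:R *
    fine (row_integral (fun x : 'rV[R]_n =>
     (expR (- (eps * quad collapsed_gram x)))%:E))).
Proof.
move=> finB finT hend ypos.
rewrite mulr_sumr.
rewrite (eq_bigr (fun B : {set 'I_n} => Num.sqrt (eps * \det collapsed_gram) *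
   ((-1) ^+ #|B| * Num.sg (\det (N B)) *
  fine (row_integral (fun x => (facet_integrand (@basis_row R n)
     (moved_row M alpha beta) collapsed_gram eps B x)%:E))))); last first.
  move=> B _; rewrite mulrCA volume_facet_integral mulrCA; congr (_ * (_ * _)).
  rewrite (sg_det_choice alpha0 p0 q0 Mpos (choice_unit B)).
  by rewrite (sign_tau B tauY).
rewrite -mulr_sumr (fan_integral n0 choice_unit (y := y) finB finT)//.
have endF (x : 'rV[R]_n) (B : {set 'I_n}) : B != finset.set0 \/ deg = false ->
   end_positive (facet_coord (@basis_row R n) (moved_row M alpha beta) B x 0)
    (facet_coord (@basis_row R n) (moved_row M alpha beta) B y 0) = false.
  move=> Bd; apply/negbTE/negP => /forallP e.
  have := hend B (facet_coord (@basis_row R n) (moved_row M alpha beta) B y).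
  rewrite /facet_coord mulmxKV ?choice_unit// => /(_ _ erefl).
  case: Bd => [/negbTE ->|->]; rewrite ?andbF /= => H; apply: notF; apply: H => j;
  by have := e j => /orP[/ltW//|/andP[/eqP -> _]].
case: deg hend ypos finT endF => [hend /(_ isT) ypos|_ _] _ endF x; last first.
  by rewrite big1// => B _; rewrite endF ?mulr0//; right.
rewrite (bigD1 finset.set0)//= big1 ?addr0 => [|B B0]; last first.
  by rewrite endF ?mulr0//; left.
have N1 : N finset.set0 = 1%:M.
  by apply/row_matrixP => i; rewrite rowK finset.in_set0 row1.
rewrite cards0 expr0 N1 det1 sgr1 !mul1r /facet_coord N1 invmx1 !mulmx1.
by rewrite (_ : end_positive _ _ = true)//; apply/forallP => j; rewrite ypos.
Qed.

End CurvedCore.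

Section LobachevskyCore.
Variables (R : realType) (n : nat).
Hypothesis n0 : (0 < n)%N.
Local Notation V := 'rV[R]_(ambient_dim Lobachevsky n).
Variables (v Q : vertex n -> V) (c : 'I_n -> V).
Variables (M : 'M[R]_n) (alpha beta : 'I_n -> R) (Y : {set 'I_n}).
Hypothesis gram_const : forall (B : {set 'I_n}) i j,
  form (v (choice_vertex B i)) (v (choice_vertex B j)) =
  form (Q (choice_vertex B i)) (Q (choice_vertex B j)).
Hypothesis Q_free : forall (B : {set 'I_n}) (w : 'I_n -> R),
  \sum_i w i *: Q (choice_vertex B i) = 0 -> forall i, w i = 0.
Hypothesis alpha0 : forall i, alpha i != 0.
Hypothesis QlE : forall i, Q (inl i) = alpha i *: c i.
Hypothesis QrE : forall i, Q (inr i) = \sum_k (beta i * M i k) *: c k.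
Hypothesis tauY : forall i, tau alpha beta i = if i \in Y then 1 else -1.
Variables p q : 'I_n -> R.
Hypothesis p0 : forall i, 0 < p i.
Hypothesis q0 : forall i, 0 < q i.
Hypothesis Mpos : forall z : 'I_n -> R, 0 <= \sum_i \sum_j z i * (p i * M i j * q j) * z j.
Hypothesis Q_space : forall w, on_space (Q w).

(** The diagonal products of vertices are -1 and the others are at most 0. Besides positivity this
    bounds the integrand over a cone by the standard Gaussian, which gives finiteness. *)
Lemma lobachevsky_quad_le B (z : 'rV[R]_n) :
  (forall i, 0 <= z 0 i) -> \sum_i z 0 i ^+ 2 <= -1 * quad (choice_gram Q B) z.
Proof.
move=> z0; rewrite quad_choice_gram mulN1r form_suml -sumrN; apply: ler_sum => i _.
rewrite formZl form_sumr (bigD1 i)//= formZr.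
have [-> _] := on_lobachevsky (Q_space (choice_vertex B i)).
rewrite mulrDr opprD !mulrN mulr1 opprK expr2 lerDl oppr_ge0.
rewrite mulr_ge0_le0// sumr_le0// => j _; rewrite formZr mulr_ge0_le0//.
exact: form_lobachevsky_le0.
Qed.

Lemma orthant_sumsq_gt0 k (z : 'rV[R]_k) : orthant z -> 0 < \sum_i z 0 i ^+ 2.
Proof.
move=> /andP[_ zs]; rewrite lt_neqAle sumr_ge0 ?andbT => [|i _]; last exact: sqr_ge0.
apply: contraTneq zs => /esym z2; rewrite big1 ?ltxx// => i _.
apply/eqP; rewrite -sqrf_eq0; apply/eqP.
by apply: (psumr_eq0P (P := xpredT) (F := fun i => z 0 i ^+ 2)) => // j _; exact: sqr_ge0.
Qed.

Lemma lobachevsky_core :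
  \sum_(B : {set 'I_n}) (-1) ^+ #|B :&: Y| * face_volume v (~: B) B = 0.
Proof.
have radial0 : 0 < fine (@radial_integral R n.-1).
  by rewrite fine_gt0// radial_integral_gt0 radial_integral_lty.
have uN := choice_unit Q_free alpha0 QlE QrE.
have curved : Lobachevsky <> Euclidean by [].
have epsE : (-1 : R) = 1 \/ (-1 : R) = -1 by right.
have qpos B z : orthant z -> 0 < -1 * quad (choice_gram Q B) z.
  move=> oz; apply: lt_le_trans (orthant_sumsq_gt0 oz) _.
  by apply: lobachevsky_quad_le => i; case/andP: oz => /forallP.
have finB B : (row_integral (fun x => (facet_integrand (@basis_row R n)
     (moved_row M alpha beta) (collapsed_gram Q) (-1) B x)%:E) < +oo)%E.
  rewrite row_integral_facet//.
  suff : (row_integral (fun z : 'rV[R]_n => (if orthant z then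
      expR (- (-1 * quad (choice_gram Q B) z)) else 0)%R%:E) < +oo)%E.
    rewrite (choice_gramE alpha0 QlE QrE); move: (row_integral _) => J Jy.
    case: J Jy => [x| |] //= _; first by rewrite -EFinM ltry.
    have : \det (choice_mx (basis_row R (n:=n)) (moved_row M alpha beta) B) != 0.
      by rewrite -unitfE -unitmxE.
    by move=> d0; rewrite gt0_muleNy// lte_fin normr_gt0.
  apply: (@le_lt_trans _ _ (row_integral (fun x : 'rV[R]_n =>
     (expR (- \sum_i x 0 i ^+ 2))%:E))).
    apply: ge0_le_iterated_integral.
    - apply/measurable_EFinP; apply: measurable_fun_ifT => //.
        exact: row_measurable_orthant.
      apply: measurable_fun_expR; apply: measurable_funN; apply: measurable_funM => //.
      exact: row_measurable_quadratic.
    - by apply/measurable_EFinP; exact: measurable_fun_sumsq.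
    - by move=> t; rewrite lee_fin; case: ifP => // _; exact: expR_ge0.
    - move=> t; rewrite lee_fin; case: ifP => [/andP[/forallP t0 _]|_]; last exact: expR_ge0.
      by rewrite ler_expR lerN2 lobachevsky_quad_le.
  by rewrite row_integral_gauss ltry.
have hend (B : {set 'I_n}) (t : 'rV[R]_n) : (forall j, 0 <= t 0 j) ->
    t *m choice_mx (@basis_row R n) (moved_row M alpha beta) B =
    - delta_mx 0 (Ordinal n0) -> false && (B == finset.set0).
  move=> t0 tN.
  have := choice_combination alpha0 QlE QrE B t; rewrite tN.
  have -> : \sum_l (- delta_mx 0 (Ordinal n0) : 'rV[R]_n) 0 l *: Q (inl l) =
      - Q (inl (Ordinal n0)).
    rewrite (bigD1 (Ordinal n0))//= big1 => [|l ki].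
      by rewrite addr0 !mxE !eqxx scaleN1r.
    by rewrite !mxE (negbTE ki) andbF oppr0 scale0r.
  (* Compare time coordinates: positive for every vertex, so nonnegative for points of a cone, but
     negative for - a_0. *)
  move=> /(congr1 (fun y : V => y 0 ord0)).
  have [_ Q0] := on_lobachevsky (Q_space (inl (Ordinal n0))).
  move=> E; have : 0 <= - Q (inl (Ordinal n0)) 0 ord0.
    rewrite -[- _](_ : (- Q (inl (Ordinal n0))) 0 ord0 = _); last by rewrite mxE.
    rewrite -E summxE sumr_ge0// => i _; rewrite mxE mulr_ge0// ltW//.
    by have [] := on_lobachevsky (Q_space (choice_vertex B i)).
  by rewrite oppr_ge0 leNgt Q0.
have := signed_volume_sum curved n0 gram_const Q_free alpha0 QlE QrE tauY p0 q0 Mpos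
  epsE qpos (y := - delta_mx 0 (Ordinal n0)) (deg := false) finB _ hend _.
rewrite mul0r mulr0 => /(_ _ _)/eqP; rewrite mulf_eq0 (gt_eqF radial0) /=.
by move=> H; apply/eqP; apply: H.
Qed.

End LobachevskyCore.

Section SphericalCore.
Variables (R : realType) (n : nat).
Hypothesis n2 : (2 <= n)%N.
Local Notation V := 'rV[R]_(ambient_dim Spherical n).
Variables (v Q : vertex n -> V) (c : 'I_n -> V).
Variables (M : 'M[R]_n) (alpha beta : 'I_n -> R) (Y : {set 'I_n}).
Hypothesis gram_const : forall (B : {set 'I_n}) i j,
  form (v (choice_vertex B i)) (v (choice_vertex B j)) =
  form (Q (choice_vertex B i)) (Q (choice_vertex B j)).
Hypothesis Q_free : forall (B : {set 'I_n}) (w : 'I_n -> R),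
  \sum_i w i *: Q (choice_vertex B i) = 0 -> forall i, w i = 0.
Hypothesis alpha0 : forall i, alpha i != 0.
Hypothesis beta0 : forall i, beta i != 0.
Hypothesis QlE : forall i, Q (inl i) = alpha i *: c i.
Hypothesis QrE : forall i, Q (inr i) = \sum_k (beta i * M i k) *: c k.
Hypothesis tauY : forall i, tau alpha beta i = if i \in Y then 1 else -1.
Variables p q : 'I_n -> R.
Hypothesis p0 : forall i, 0 < p i.
Hypothesis q0 : forall i, 0 < q i.
Hypothesis Mpos : forall z : 'I_n -> R, 0 <= \sum_i \sum_j z i * (p i * M i j * q j) * z j.
Hypothesis Mpd : positive_definite M.
Variable m : V.
Hypothesis mm : form m m = 1.
Hypothesis mc : forall i, form m (c i) = 0.

Let S := collapsed_gram Q.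

Let quad_S z : quad S z = form (\sum_i z 0 i *: Q (inl i)) (\sum_i z 0 i *: Q (inl i)).
Proof.
have -> : S = choice_gram Q finset.set0.
  by apply/matrixP => i j; rewrite !mxE /choice_vertex !finset.in_set0.
rewrite quad_choice_gram; congr form; apply: eq_bigr => i _;
by rewrite /choice_vertex finset.in_set0.
Qed.

(** The unit vector [m], orthogonal to the collapsed polytope, completes the n vertices to a square
    matrix. *)
Let A : 'M[R]_(1 + n) := col_mx (m : 'rV[R]_(1 + n)) (\matrix_i (Q (inl i) : 'rV[R]_(1 + n))).

Let AA : A *m A^T = block_mx 1%:M 0 0 S.
Proof.
have formmx : form_mx R Spherical n = 1%:M.
  rewrite /form_mx -diag_const_mx; congr diag_mx; apply/rowP => i; by rewrite !mxE.
have AE i j : (A *m A^T) i j = form (row i A : V) (row j A : V).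
  by rewrite -(gram_mxE (X := Spherical) (n := n) A A) formmx mulmx1.
have row0E (y : V) : row 0 y = y by apply/rowP => l; rewrite mxE.
have mQ i : form m (Q (inl i)) = 0 by rewrite QlE formZr mc mulr0.
apply/matrixP => i j; rewrite AE.
case: (split_ordP i) => i' ->; case: (split_ordP j) => j' ->;
  rewrite ?(block_mxEul, block_mxEur, block_mxEdl, block_mxEdr)
    ?(rowKu, rowKd) ?rowK ?ord1 ?row0E ?mxE ?eqxx //.
by rewrite formC.
Qed.

Let det_S : 0 < \det S.
Proof.
have detAA : \det S = \det A ^+ 2.
  have := congr1 determinant AA.
  by rewrite det_mulmx det_tr det_ublock det1 mul1r expr2.
rewrite detAA lt_neqAle sqr_ge0 andbT eq_sym sqrf_eq0.
rewrite -sqrf_eq0 -detAA; apply/negP => /det0P[w w0 wS].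
move: w0; apply/negP; rewrite negbK; apply/eqP/rowP => i; rewrite mxE.
apply: (Q_free (B := finset.set0) (w := fun i => w 0 i)).
apply: form_spherical_eq0.
have := quad_S w; rewrite /quad wS mul0mx mxE => ->.
by congr form; apply: eq_bigr => j _; rewrite /choice_vertex finset.in_set0.
Qed.

Let gauss_S : (row_integral (fun y : 'rV[R]_n => (expR (- (1 * quad S y)))%:E) < +oo)%E /\
  Num.sqrt (1 * \det S) *
    fine (row_integral (fun y : 'rV[R]_n => (expR (- (1 * quad S y)))%:E)) =
  Num.sqrt pi ^+ n.
Proof.
have := row_integral_gauss_gram det_S AA.
rewrite (eq_row_integral (H := fun y : 'rV[R]_n => (expR (- (1 * quad S y)))%:E)); last first.
  by move=> y; rewrite mul1r.
move: (row_integral _) => J E; split.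
  case: J E => [x _|/=|//]; first by rewrite ltry.
  by rewrite gt0_muley// lte_fin sqrtr_gt0.
by rewrite mul1r -fineZ ?sqrtr_ge0// E.
Qed.

Lemma spherical_core :
  \sum_(B : {set 'I_n}) (-1) ^+ #|B :&: Y| * face_volume v (~: B) B =
  if Y == finset.set0 then sphere_volume R n.-1 else 0.
Proof.
have radial0 : 0 < fine (@radial_integral R n.-1).
  by rewrite fine_gt0// radial_integral_gt0 radial_integral_lty.
have uN := choice_unit Q_free alpha0 QlE QrE.
have n0 : (0 < n)%N by exact: ltnW.
have curved : Spherical <> Euclidean by [].
have epsE : (1 : R) = 1 \/ (1 : R) = -1 by left.
have [gy gE] := gauss_S.
have qpos B z : orthant z -> 0 < 1 * quad (choice_gram Q B) z.
  move=> /andP[_ zs]; rewrite mul1r quad_choice_gram lt_neqAle form_spherical_ge0 andbT.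
  apply: contraTneq zs => /esym/form_spherical_eq0/Q_free z0.
  by rewrite big1 ?ltxx// => i _; rewrite z0.
have finB B : (row_integral (fun x => (facet_integrand (@basis_row R n)
     (moved_row M alpha beta) (collapsed_gram Q) 1 B x)%:E) < +oo)%E.
  apply: le_lt_trans gy; apply: ge0_le_iterated_integral.
  - apply/measurable_EFinP; exact: row_measurable_facet_integrand.
  - apply/measurable_EFinP; apply: measurable_fun_expR; apply: measurable_funN.
    apply: measurable_funM => //; exact: row_measurable_quadratic.
  - by move=> t; rewrite lee_fin facet_integrand_ge0.
  - by move=> t; rewrite lee_fin /facet_integrand; case: ifP => // _; exact: expR_ge0.
have [Y0|[i0 Yi0]] := set_0Vmem Y.
  have hend (B : {set 'I_n}) (t : 'rV[R]_n) : (forall j, 0 <= t 0 j) ->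
      t *m choice_mx (@basis_row R n) (moved_row M alpha beta) B = const_mx 1 ->
      true && (B == finset.set0).
    move=> t0 tN.
    (* For empty Y every [tau k] is -1, so the all-ones vector, interior to the cone of the a_i,
       satisfies the sign condition for every B. *)
    have [|h _] := nonneg_combination alpha0 beta0 Mpd t0 tN.
      by move=> l _; rewrite mxE tauY Y0 finset.in_set0 mul1r lerN10.
    apply/eqP/setP => l; rewrite finset.in_set0; apply/negbTE/negP => /h[+ _].
    by rewrite mxE => /eqP; rewrite oner_eq0.
  have ypos : true -> forall j, 0 < (const_mx 1 : 'rV[R]_n) 0 j.
    by move=> _ j; rewrite mxE.
  have := signed_volume_sum curved n0 gram_const Q_free alpha0 QlE QrE tauY p0 q0 Mpos
    epsE qpos finB (fun _ => gy) hend ypos.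
  rewrite -/S [true%:R * _]mul1r gE Y0 eqxx => E.
  (* The relation to Gamma is stated at (k+2)/2; it is used with k = n - 2. *)
  have n1 : n.-2.+1 = n.-1 by rewrite prednK// -ltnS prednK.
  have nn : n.-1.+1 = n by rewrite prednK.
  have := @Gamma_radial R n.-2; rewrite n1 nn => Gr.
  rewrite /sphere_volume nn Gr.
  have -> : pi `^ (n%:R / 2) = Num.sqrt pi ^+ n :> R.
    by rewrite -powR12_sqrt ?pi_ge0// -powR_mulrn ?powR_ge0// -powRrM mulrC.
  by rewrite -E; field; rewrite gt_eqF.
have -> : (Y == finset.set0) = false by apply/negbTE/set0Pn; exists i0.
have hend (B : {set 'I_n}) (t : 'rV[R]_n) : (forall j, 0 <= t 0 j) ->
    t *m choice_mx (@basis_row R n) (moved_row M alpha beta) B = - delta_mx 0 i0 ->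
    false && (B == finset.set0).
  move=> t0 tN.
  (* The only nonzero coordinate of the direction is -1 at i0, where [tau] is 1. A cone containing
     it would have i0 outside B and coefficient -1 there. *)
  have [|h h'] := nonneg_combination alpha0 beta0 Mpd t0 tN.
    move=> l _; rewrite !mxE tauY /=; have [->|_] := eqVneq l i0.
      by rewrite Yi0 mulr1 lerN10.
    by rewrite oppr0 mul0r.
  have [iB|iB] := boolP (i0 \in B).
    by have [+ _] := h _ iB; rewrite !mxE !eqxx => /eqP; rewrite oppr_eq0 oner_eq0.
  by have := t0 i0; rewrite h'// !mxE !eqxx ler0N1.
have := signed_volume_sum curved n0 gram_const Q_free alpha0 QlE QrE tauY p0 q0 Mpos
  epsE qpos (y := - delta_mx 0 i0) (deg := false) finB _ hend _.
rewrite mul0r mulr0 => H; apply/eqP.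
have /eqP : fine (radial_integral n.-1) *
   (\sum_(B : {set 'I_n}) (-1) ^+ #|B :&: Y| * face_volume v (~: B) B) = 0 by exact: H.
by rewrite mulf_eq0 (gt_eqF radial0).
Qed.

End SphericalCore.

(** * The matrix H and its transpose *)

Section HMatrix.
Variables (R : realType) (n : nat) (G : 'M[R]_n) (lam : 'I_n -> R).
Hypothesis Gsym : G^T = G.
Hypothesis Gdiag : forall i, G i i = 1.
Hypothesis lam0 : forall i, 0 < lam i.
Hypothesis lamI : forall i j : 'I_n, (i < j)%N -> lam i < lam j.

Definition hmx : 'M[R]_n := \matrix_(i, j) hcoef G lam i j.

Lemma hmx_lam_ge0 (z : 'I_n -> R) :
  0 <= \sum_i \sum_j z i * (1 * hmx i j * lam j ^+ 2) * z j.
Proof.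
set S := (X in 0 <= X).
have E : S + S = 2 * (\sum_i lam i * z i) ^+ 2.
  rewrite {2}/S exchange_big /= -big_split /= expr2 mulr_suml mulr_sumr.
  apply: eq_bigr => i _; rewrite -big_split /= !mulr_sumr; apply: eq_bigr => j _.
  rewrite ![hmx _ _]mxE.
  have -> : z i * (1 * hcoef G lam i j * lam j ^+ 2) * z j +
     z j * (1 * hcoef G lam j i * lam i ^+ 2) * z i =
     (hcoef G lam i j * lam j ^+ 2 + lam i ^+ 2 * hcoef G lam j i) * (z i * z j) by ring.
  by rewrite (hcoef_lam Gsym lam0 lamI); ring.
have := sqr_ge0 (\sum_i lam i * z i); lra.
Qed.

Lemma hmx_tr_lam_ge0 (z : 'I_n -> R) :
  0 <= \sum_i \sum_j z i * (lam i ^+ 2 * hmx^T i j * 1) * z j.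
Proof.
rewrite exchange_big /= [X in 0 <= X](_ : _ =
  \sum_i \sum_j z i * (1 * hmx i j * lam j ^+ 2) * z j); first exact: hmx_lam_ge0.
by apply: eq_bigr => i _; apply: eq_bigr => j _; rewrite !mxE; ring.
Qed.

Lemma quad_tr (M : 'M[R]_n) z : quad M^T z = quad M z.
Proof.
by rewrite /quad -[RHS]trace_mx11 -mxtrace_tr !trmx_mul trmxK mulmxA trace_mx11.
Qed.

(** On the sphere G is a Gram matrix of independent vectors, so H and its transpose are positive
    definite although not symmetric. *)
Lemma quad_hmx z : quad hmx z = quad G z.
Proof.
have E : hmx + hmx^T = 2 *: G.
  by apply/matrixP => i j; rewrite !mxE hcoefD.
have : quad (hmx + hmx^T) z = 2 * quad G z.
  by rewrite E /quad -scalemxAr -scalemxAl mxE.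
have -> : quad (hmx + hmx^T) z = quad hmx z + quad hmx^T z.
  by rewrite /quad mulmxDr mulmxDl mxE.
rewrite quad_tr; lra.
Qed.

End HMatrix.

Section Signs.
Variable R : realType.

Lemma sg_sign (a : R) : is_sign a -> Num.sg a = a.
Proof. by case=> ->; rewrite ?sgrN sgr1. Qed.

Lemma sg_sign_div (a b : R) : is_sign a -> 0 <= b -> a / b != 0 -> Num.sg (a / b) = a.
Proof.
move=> sa; rewrite le_eqVlt => /predU1P[<-|b0 _]; first by rewrite invr0 mulr0 eqxx.
by rewrite sgrM sgrV (gtr0_sg b0) mulr1 sg_sign.
Qed.

Variables (n : nat) (s s' : 'I_n -> R).
Hypothesis signs : forall i, is_sign (s i) /\ is_sign (s' i).

Lemma sign_mul_cases i : s i * s' i = 1 \/ s i * s' i = -1.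
Proof.
by case: (signs i) => -[->|->] [->|->];
  rewrite ?mulrNN ?mulN1r ?mulr1 ?mul1r; [left|right|right|left].
Qed.

Lemma sign_indicator i : s i * s' i = if i \in [set i | s i * s' i == 1] then 1 else -1.
Proof.
rewrite inE; case: (sign_mul_cases i) => ->; first by rewrite eqxx.
by rewrite (_ : (-1 == 1 :> R) = false)// lt_eqF.
Qed.

Lemma sign_indicatorN i :
  - (s i * s' i) = if i \in [set i | s i * s' i == -1] then 1 else -1.
Proof.
rewrite inE; case: (sign_mul_cases i) => ->; last by rewrite eqxx opprK.
by rewrite (_ : (1 == -1 :> R) = false)// gt_eqF.
Qed.

End Signs.

Section CurvedTheorem.
Variables (R : realType) (X : geometry) (n : nat) (G : 'M[R]_n).
Variables (lam s s' : 'I_n -> R) (P : option R -> vertex n -> 'rV[R]_(ambient_dim X n)).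
Hypothesis curved : X <> Euclidean.
Hypothesis n0 : (0 < n)%N.
Hypothesis adm : admissible_data X G lam s s'.
Local Notation V := 'rV[R]_(ambient_dim X n).
Variables (nn c : 'I_n -> V) (m : V).
Hypothesis frame : normal_frame G nn m.
Hypothesis dual_span : forall i, (c i <= \matrix_j nn j)%MS.
Hypothesis dual : forall i j, form (c i) (nn j) = (i == j)%:R.
Local Notation d := (dvec G lam nn c m).
Hypothesis PE : forall u i,
  P u (inl i) = (s i / vnorm (c i)) *: c i /\
  P u (inr i) = (s' i / vnorm (d i u)) *: d i u.
Hypothesis space : forall u v, on_space (P u v).

Let Gsym : G^T = G. Proof. by case: adm. Qed.
Let Gdiag i : G i i = 1. Proof. by case: adm. Qed.
Let lam0 i : 0 < lam i. Proof. by case: adm => _ _ _ _ []. Qed.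
Let lamI (i j : 'I_n) : (i < j)%N -> lam i < lam j.
Proof. by case: adm => _ _ _ _ [_ H _]; exact: H. Qed.
Let signs i : is_sign (s i) /\ is_sign (s' i).
Proof. by case: adm => _ _ _ _ [_ _ H]; exact: H. Qed.

Lemma det_G_neq0 : \det G != 0.
Proof.
case: adm => _ _ _ + _; case: (X) curved => // _ d0; first by rewrite gt_eqF.
by rewrite lt_eqF.
Qed.

Lemma on_space_neq0 (y : V) : on_space y -> y <> 0.
Proof.
move=> /[swap] ->; case: (X) curved => // _ /=; rewrite form0l.
  by move=> /esym/eqP; rewrite oner_eq0.
by case=> /esym/eqP; rewrite oppr_eq0 oner_eq0.
Qed.

Definition alpha_of i : R := s i / vnorm (c i).
Definition beta_of u i : R := s' i / vnorm (d i u).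

Lemma alpha_of_neq0 i : alpha_of i != 0.
Proof.
apply/eqP => a0; have [E _] := PE None i.
by apply: (on_space_neq0 (space None (inl i))); rewrite E -/(alpha_of i) a0 scale0r.
Qed.

Lemma beta_of_neq0 u i : beta_of u i != 0.
Proof.
apply/eqP => b0; have [_ E] := PE u i.
by apply: (on_space_neq0 (space u (inr i))); rewrite E -/(beta_of u i) b0 scale0r.
Qed.

Lemma tau_of u i : tau alpha_of (beta_of u) i = s i * s' i.
Proof.
have [ss ss'] := signs i.
by rewrite /tau !sg_sign_div ?sqrtr_ge0 ?alpha_of_neq0 ?beta_of_neq0.
Qed.

Lemma beta_minus_neq0 i : - beta_of None i != 0.
Proof. by rewrite oppr_eq0 beta_of_neq0. Qed.

Lemma tau_plus i :
  tau alpha_of (beta_of (Some 0)) i = if i \in [set i | s i * s' i == 1] then 1 else -1.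
Proof. by rewrite tau_of sign_indicator. Qed.

(** The minus sign of the collapsed position at u = oo is absorbed into beta, which reverses every
    [tau] and exchanges the roles of the two choices of Y. *)
Lemma tau_minus i :
  tau alpha_of (fun i => - beta_of None i) i =
  if i \in [set i | s i * s' i == -1] then 1 else -1.
Proof.
by rewrite /tau sgrN mulrN -/(tau alpha_of (beta_of None) i) tau_of sign_indicatorN.
Qed.

Lemma collapsed_left u i : P u (inl i) = alpha_of i *: c i.
Proof. by have [-> _] := PE u i. Qed.

Lemma collapsed_zero i :
  P (Some 0) (inr i) = \sum_k (beta_of (Some 0) i * hmx G lam i k) *: c k.
Proof.
have [_ ->] := PE (Some 0) i; rewrite -/(beta_of (Some 0) i) dvec_zero scaler_sumr.
by apply: eq_bigr => k _; rewrite scalerA mxE.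
Qed.

Lemma collapsed_infty i :
  P None (inr i) = \sum_k (- beta_of None i * (hmx G lam)^T i k) *: c k.
Proof.
have [_ ->] := PE None i; rewrite -/(beta_of None i).
rewrite (dvec_infty adm frame dual_span dual _ det_G_neq0) scaler_sumr.
by apply: eq_bigr => k _; rewrite scalerA !mxE mulrN mulNr.
Qed.

End CurvedTheorem.

Lemma curved_theorem (R : realType) (X : geometry) (n : nat) (G : 'M[R]_n)
    (lam s s' : 'I_n -> R) (P : option R -> vertex n -> 'rV[R]_(ambient_dim X n))
    (Y : {set 'I_n}) u :
  X <> Euclidean -> (2 <= n)%N -> admissible_data X G lam s s' ->
  simplest_curved G lam s s' P -> finite_set (fun u => ~ nondegenerate (P u)) ->
  Y = [set i | s i * s' i == 1] \/ Y = [set i | s i * s' i == -1] ->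
  \sum_(B : {set 'I_n}) (-1) ^+ #|B :&: Y| * face_volume (P u) (~: B) B =
  if X is Spherical then if Y == finset.set0 then sphere_volume R n.-1 else 0 else 0.
Proof.
move=> curved n2 adm [nn [c [m [frame [dual_span dual] _ PE space]]]] fin hY.
have n0 : (0 < n)%N by exact: ltnW.
have [u0 nd] := exists_nondegenerate fin.
have Gsym : G^T = G by case: adm.
have Gdiag i : G i i = 1 by case: adm => _ H _ _ _; exact: H.
have lam0 i : 0 < lam i by case: adm => _ _ _ _ [H _ _]; exact: H.
have lamI (i j : 'I_n) : (i < j)%N -> lam i < lam j.
  by case: adm => _ _ _ _ [_ H _]; exact: H.
have lam2 i : 0 < lam i ^+ 2 by rewrite exprn_gt0.
have gram u' B i j := choice_gram_const adm frame dual_span dual PE B i j u u'.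
have free u' B w := choice_free (u := u') (B := B) (w := w)
  curved n0 adm frame dual_span dual PE space nd.
have alpha0 := alpha_of_neq0 curved PE space.
have beta0 u' := beta_of_neq0 curved PE space u'.
have betaN := beta_minus_neq0 curved PE space.
have QlE u' := collapsed_left PE u'.
have Q0 := collapsed_zero PE.
have Qoo := collapsed_infty curved adm frame dual_span dual PE.
have tauP := tau_plus curved adm PE space.
have tauM := tau_minus curved adm PE space.
have one0 (i : 'I_n) : 0 < (1 : R) by exact: ltr01.
have mc i : form m (c i) = 0 := form_m_dual frame dual_span i.
have mm : form m m = 1 by case: frame.
have Mp := hmx_lam_ge0 Gsym lam0 lamI.
have Mm := hmx_tr_lam_ge0 Gsym lam0 lamI.
have pd : X = Spherical -> positive_definite (hmx G lam).
  move=> XS z; rewrite -/(quad _ z) quad_hmx// => zG.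
  have [nnG _ _] := frame.
  have yE : quad G z = form (\sum_i z 0 i *: nn i) (\sum_i z 0 i *: nn i).
    rewrite /quad mxE form_sumr; apply: eq_bigr => j _.
    rewrite formZr mxE form_suml mulrC [_^T _ _]mxE; congr (_ * _).
    by apply: eq_bigr => i _; rewrite formZl nnG.
  have y0 : \sum_i z 0 i *: nn i = 0.
    move: zG; rewrite yE; move: (\sum_i _) => y; clear -XS; subst X => y0.
    by apply: form_spherical_eq0; apply/le_anti; rewrite y0 form_spherical_ge0.
  have uG : G \in unitmx by rewrite unitmxE unitfE (det_G_neq0 curved adm).
  rewrite -[LHS](mulmxK uG) (_ : z *m G = 0) ?mul0mx//.
  apply/rowP => j; rewrite !mxE -[RHS](form0l (nn j)) -y0 form_suml.
  by apply: eq_bigr => i _; rewrite formZl nnG.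
have pdT : X = Spherical -> positive_definite (hmx G lam)^T.
  by move=> /pd H z; rewrite -/(quad _ z) quad_tr; exact: H.
case: X P curved adm nn c m frame dual_span dual PE space fin nd gram free alpha0
  beta0 betaN QlE Q0 Qoo
  tauP tauM mc mm pd pdT => // P curved adm nn c m frame dual_span dual PE space fin nd
  gram free alpha0 beta0 betaN QlE Q0 Qoo tauP tauM mc mm pd pdT.
(* At u = 0 the matrix is H with weights 1 on rows and lambda squared on columns; at u = oo it is
   the transpose, with the weights exchanged. *)
- case: hY => ->.
    exact: (spherical_core n2 (gram (Some 0)) (free (Some 0)) alpha0 (beta0 (Some 0))
      (QlE (Some 0)) Q0 tauP one0 lam2 Mp (pd erefl) mm mc).
  exact: (spherical_core n2 (gram None) (free None) alpha0 betaN
    (QlE None) Qoo tauM lam2 one0 Mm (pdT erefl) mm mc).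
- case: hY => ->.
    exact: (lobachevsky_core n0 (gram (Some 0)) (free (Some 0)) alpha0
      (QlE (Some 0)) Q0 tauP one0 lam2 Mp (space (Some 0))).
  exact: (lobachevsky_core n0 (gram None) (free None) alpha0
    (QlE None) Qoo tauM lam2 one0 Mm (space None)).
Qed.

(** * Flexible cross-polytopes in Euclidean space *)

Section SimplexDifferences.
Variables (R : comNzRingType) (k : nat).

Definition difference_mx : 'M[R]_(k, 1 + k) := row_mx (const_mx (-1)) 1%:M.

Lemma difference_mxE p (A : 'M[R]_(1 + k, p)) i j :
  (difference_mx *m A) i j = A (lift ord0 i) j - A ord0 j.
Proof.
rewrite mxE big_split_ord big_ord1 row_mxEl mxE mulN1r addrC (bigD1 i)//= big1.
  rewrite addr0 row_mxEr mxE eqxx mul1r; rewrite (_ : rshift 1 i = lift ord0 i); last exact/val_inj.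
  by rewrite (_ : lshift k 0 = ord0) //; exact/val_inj.
by move=> l li; rewrite row_mxEr mxE eq_sym (negbTE li) mul0r.
Qed.

Lemma row_sum0_factor (A : 'M[R]_(k, 1 + k)) :
  (forall i, \sum_j A i j = 0) -> A = rsubmx A *m difference_mx.
Proof.
move=> A0; rewrite mul_mx_row mulmx1 -{1}[A]hsubmxK; congr row_mx.
apply/matrixP => i j; rewrite ord1 !mxE; have := A0 i.
rewrite big_split_ord big_ord1 => /eqP; rewrite addr_eq0 => /eqP ->.
by rewrite -sumrN; apply: eq_bigr => l _; rewrite !mxE mulrN1.
Qed.

(* Subtracting the first row and adding all columns to the first one turns [N]
   into [block_mx 1 * 0 S]. *)
Lemma det_differences (N : 'M[R]_(1 + k)) :
  (forall i, \sum_j N i j = 1) -> \det (rsubmx (difference_mx *m N)) = \det N.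
Proof.
move=> N1; pose L : 'M[R]_(1 + k) := block_mx 1%:M 0 (const_mx (-1)) 1%:M.
pose T : 'M[R]_(1 + k) := block_mx 1%:M 0 (const_mx 1) 1%:M.
have -> : \det N = \det (L *m N *m T).
  by rewrite !det_mulmx !det_lblock !det1 !mulr1 !mul1r.
have sumT p (A : 'M[R]_(p, 1 + k)) :
    A *m T = row_mx (\col_i \sum_j A i j) (rsubmx A).
  rewrite -{1}[A]hsubmxK /T /block_mx mul_row_col !mul_mx_row !mulmx1 !mulmx0 add_row_mx add0r.
  congr row_mx; apply/matrixP => i j; rewrite ord1 !mxE big_split_ord big_ord1.
  by congr (_ + _); apply: eq_bigr => l _; rewrite !mxE mulr1.
rewrite /L /block_mx mul_col_mx mul_col_mx !sumT -/difference_mx.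
rewrite [X in col_mx (row_mx X _) _](_ : _ = 1%:M); last first.
  apply/matrixP => i j; rewrite !ord1 !mxE eqxx -[RHS](N1 ord0).
  apply: eq_bigr => l _; rewrite mxE big_split_ord big_ord1 row_mxEl mxE eqxx mul1r big1.
    by rewrite (_ : lshift k 0 = ord0) ?[LHS]addr0 //; exact/val_inj.
  by move=> x _; rewrite row_mxEr mxE mul0r.
rewrite [X in col_mx _ (row_mx X _)](_ : _ = 0).
  by rewrite -/(block_mx _ _ _ _) det_ublock det1 mul1r.
apply/matrixP => i j; rewrite !mxE.
by under eq_bigr do rewrite difference_mxE; rewrite sumrB !N1 subrr.
Qed.

End SimplexDifferences.

(** Multilinear expansion of the determinant of the differences in its rows. *)
Lemma sum_sign_det_choice (R : comNzRingType) n (a b : 'I_n -> 'rV[R]_n) :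
  \sum_(B : {set 'I_n}) (-1) ^+ #|B| * \det (\matrix_i (if i \in B then b i else a i)) =
  \det (\matrix_i (a i - b i)).
Proof.
rewrite /determinant; under eq_bigr do rewrite mulr_sumr.
rewrite exchange_big; apply: eq_bigr => s _ /=.
under eq_bigr do rewrite mulrCA.
rewrite -mulr_sumr; congr (_ * _).
rewrite [RHS](eq_bigr (fun i => - b i 0 (s i) + a i 0 (s i))) => [|i _]; last first.
  by rewrite !mxE addrC.
rewrite bigA_distr /=; apply: eq_big => // B _.
rewrite -prodr_const big_mkcond -big_split; apply: eq_bigr => i _ /=.
by rewrite mxE; case: ifP => _; rewrite ?mulN1r ?mul1r.
Qed.

(** * Euclidean volumes: dependence on edge lengths and on barycentric coordinates *)

Section EuclideanVolume.
Variables (R : realType) (n : nat).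
Local Notation V := 'rV[R]_(ambient_dim Euclidean n).

Definition edge_gram k (q : seq V) : 'M[R]_k :=
  \matrix_(i, j) form (q`_i.+1 - q`_0) (q`_j.+1 - q`_0).

(** The value 1/k! is left unevaluated: it is a common factor of a sum that vanishes. *)
Definition standard_simplex_volume k : R :=
  fine (row_integral (fun t : 'rV[R]_k => (if simplex_dom t then 1 else 0)%:E)).

Lemma derive_simplex_point k (q : seq V) (t : 'rV[R]_k) i :
  'D_'e_i (simplex_point q) t = q`_i.+1 - q`_0.
Proof.
rewrite derive_line.
have dj l j : is_derive (0 : R) (1 : R)
    (fun h : R => simplex_point q (t + h *: 'e_i) l j) ((q`_i.+1 - q`_0) l j).
  rewrite (_ : (fun _ => _) =
    horner ((simplex_point q t l j)%:P + ((q`_i.+1 - q`_0) l j) *: 'X)); last first.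
    by apply/funext => h; rewrite simplex_point_line !hornerE !mxE [h * _]mulrC.
  apply: (is_derive_eq (is_derive_poly _ 0)).
  by rewrite derivD derivC derivZ derivX !hornerE.
rewrite derive_mx; last first.
  by apply/derivable_mxP => l j; have [] := dj l j.
by apply/matrixP => l j; rewrite mxE; have [_ ->] := dj l j.
Qed.

Lemma euclidean_volume k (q : seq V) : (size q).-1 = k ->
  simplex_volume q = Num.sqrt (\det (edge_gram k q)) * standard_simplex_volume k.
Proof.
move=> kE; subst k; rewrite -fineZ ?sqrtr_ge0// /row_integral.
rewrite -ge0_iterated_integralZ ?lee_fin ?sqrtr_ge0//; last 2 first.
- apply/measurable_EFinP; apply: measurable_fun_ifT => //.
  exact: row_measurable_simplex.
- by move=> t; rewrite lee_fin; case: ifP.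
rewrite /simplex_volume; congr fine; apply: eq_iterated_integral => tt.
rewrite -/(row_of_tuple tt); move: (row_of_tuple tt) => t.
rewrite -/(simplex_dom t); case: ifP => _; last by rewrite mule0.
rewrite mule1; congr (Num.sqrt (\det _))%:E.
by apply/matrixP => i j; rewrite !mxE !derive_simplex_point.
Qed.

Lemma form_polarization (x y z : V) :
  form (x - z) (y - z) =
  (form (x - z) (x - z) + form (y - z) (y - z) - form (x - y) (x - y)) / 2.
Proof.
rewrite !(formBl, formBr) [form y x]formC [form z x]formC [form z y]formC.
by field.
Qed.

(** By polarization the Gram matrix of the edges at one vertex is determined by the squared edge
    lengths. *)
Lemma euclidean_volume_isometric k (v w : 'I_k -> V) (l : seq 'I_k) :
  (0 < size l)%N ->
  (forall i j, form (v i - v j) (v i - v j) = form (w i - w j) (w i - w j)) ->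
  simplex_volume [seq v i | i <- l] = simplex_volume [seq w i | i <- l].
Proof.
move=> l0 vw; rewrite !(@euclidean_volume (size l).-1) ?size_map//.
congr (Num.sqrt (\det _) * _); apply/matrixP => i j; rewrite !mxE.
rewrite form_polarization [RHS]form_polarization.
case: l l0 i j => // x l _ i j.
by rewrite /= !(nth_map x)// !vw.
Qed.

(** Rows of sum 1 have differences of sum 0, so the edge vectors are transformed by a k x k matrix,
    whose determinant is that of [N] up to the sign of the reordering [l]. *)
Lemma euclidean_volume_affine k (a : 'I_k.+1 -> V) (N : 'M[R]_k.+1) (l : seq 'I_k.+1) :
  uniq l -> size l = k.+1 -> (forall i, \sum_j N i j = 1) ->
  simplex_volume [seq \sum_j N i j *: a j | i <- l] =
  `|\det N| * (Num.sqrt (\det (edge_gram k (codom a))) * standard_simplex_volume k).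
Proof.
move=> ul sl N1; rewrite (@euclidean_volume k) ?size_map ?sl// mulrA; congr (_ * _).
have nthl_inj : injective (fun i : 'I_k.+1 => nth ord0 l i).
  move=> i j /eqP; rewrite nth_uniq ?sl// => /eqP; exact: val_inj.
pose s := perm nthl_inj.
pose A : 'M[R]_(1 + k, ambient_dim Euclidean n) := \matrix_(i, j) a i 0 j.
pose N' : 'M[R]_(1 + k) := perm_mx s *m N.
have N'E i j : N' i j = N (s i) j by rewrite /N' -row_permE mxE.
have N'1 i : \sum_j N' i j = 1.
  by under eq_bigr do rewrite N'E; rewrite N1.
pose L := difference_mx R k; pose S := rsubmx (L *m N').
have edgeE (q : seq V) (Q : 'M[R]_(1 + k, ambient_dim Euclidean n)) :
    (forall i : 'I_(1 + k), q`_i = row i Q) ->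
    edge_gram k q = (L *m Q) *m form_mx R Euclidean n *m (L *m Q)^T.
  move=> qQ; apply/matrixP => i j; rewrite gram_mxE mxE.
  by congr form; apply/rowP => c; rewrite [RHS]mxE difference_mxE
    (qQ (lift ord0 _)) (qQ ord0) !mxE.
have -> : edge_gram k [seq \sum_j N i j *: a j | i <- l] =
    S *m edge_gram k (codom a) *m S^T.
  rewrite (edgeE _ (N' *m A)) => [|i]; last first.
    rewrite (nth_map ord0) ?sl//; apply/rowP => c; rewrite summxE !mxE.
    by apply: eq_bigr => j _; rewrite N'E permE !mxE.
  rewrite (edgeE _ A) => [|i]; last first.
    rewrite (nth_map ord0) ?size_enum_ord// nth_ord_enum.
    by apply/rowP => c; rewrite !mxE.
  rewrite [L *m (N' *m A)]mulmxA [L *m N']row_sum0_factor -/S -/L; last first.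
    by move=> i; under eq_bigr do rewrite difference_mxE; rewrite sumrB !N'1 subrr.
  by rewrite !trmx_mul !mulmxA.
rewrite !det_mulmx det_tr mulrAC -expr2 sqrtrM ?sqr_ge0// sqrtr_sqr.
congr (_ * _); rewrite det_differences// det_mulmx det_perm normrM normrX normrN1 expr1n mul1r//.
Qed.

End EuclideanVolume.

Lemma sum_basis_row (R : realType) n (W : lmodType R) (f : 'I_n -> W) (i : 'I_n) :
  \sum_j basis_row R i 0 j *: f j = f i.
Proof.
rewrite (bigD1 i)//= !mxE !eqxx scale1r big1 ?addr0// => j ji.
by rewrite !mxE (negbTE ji) andbF scale0r.
Qed.

Lemma sum_basis_row1 (R : realType) n (i : 'I_n) : \sum_j basis_row R i 0 j = 1 :> R.
Proof.
rewrite -[RHS](sum_basis_row (fun=> 1 : R^o) i).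
by apply: eq_bigr => j _; rewrite -[RHS]/(_ * 1) mulr1.
Qed.

Section EuclideanCore.
Variables (R : realType) (k : nat).
Local Notation n := k.+1.
Local Notation V := 'rV[R]_(ambient_dim Euclidean n).
Variables (a : 'I_n -> V) (Q : vertex n -> V).
Variables (M : 'M[R]_n) (alpha beta : 'I_n -> R) (Y : {set 'I_n}) (p q : 'I_n -> R).
Hypothesis alpha0 : forall i, alpha i != 0.
Hypothesis QlE : forall i, Q (inl i) = a i.
Hypothesis QrE : forall i, Q (inr i) = \sum_j moved_row M alpha beta i 0 j *: a j.
Hypothesis row1 : forall i, \sum_j moved_row M alpha beta i 0 j = 1.
Hypothesis tauY : forall i, tau alpha beta i = if i \in Y then 1 else -1.
Hypothesis p0 : forall i, 0 < p i.
Hypothesis q0 : forall i, 0 < q i.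
Hypothesis Mpos : forall z : 'I_n -> R,
  0 <= \sum_i \sum_j z i * (p i * M i j * q j) * z j.

Local Notation N := (choice_mx (basis_row R (n := n)) (moved_row M alpha beta)).

Lemma euclidean_core :
  \sum_(B : {set 'I_n}) (-1) ^+ #|B :&: Y| * face_volume Q (~: B) B = 0.
Proof.
pose W := Num.sqrt (\det (edge_gram k (codom a))) * standard_simplex_volume R k.
have N1 B i : \sum_j N B i j = 1.
  under eq_bigr do rewrite mxE; case: ifP => _; [exact: row1|exact: sum_basis_row1].
have volE B : face_volume Q (~: B) B = `|\det (N B)| * W.
  rewrite face_volume_choice; have [ul sl] := perm_enum_setC B.
  rewrite -(euclidean_volume_affine _ ul sl (N1 B)); congr simplex_volume.
  apply: eq_map => i; rewrite /choice_vertex.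
  under eq_bigr do rewrite mxE; case: ifP => _; first exact: QrE.
  by rewrite QlE sum_basis_row.
(* The sign turns the absolute value of the determinant into the determinant itself, and the sum
   becomes polynomial in the vertices. *)
have termE B : (-1) ^+ #|B :&: Y| * face_volume Q (~: B) B =
    (-1) ^+ #|B| * \det (N B) * W.
  rewrite volE -(norm_det_choice beta alpha0 B p0 q0 Mpos) mulrA; congr (_ * W).
  have sgn := sign_tau B tauY; rewrite -sgn mulrA; congr (_ * _).
  rewrite -mulrA -[RHS]mulr1; congr (_ * _).
  have : ((-1) ^+ #|B| * \prod_(i in B) tau alpha beta i) ^+ 2 = 1 by rewrite sgn sqrr_sign.
  by rewrite exprMn sqrr_sign mul1r expr2.
under eq_bigr do rewrite termE.
rewrite -mulr_suml sum_sign_det_choice -det_tr.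
suff /eqP -> : \det (\matrix_i (basis_row R i - moved_row M alpha beta i))^T == 0.
  by rewrite mul0r.
apply/det0P; exists (const_mx 1).
  by apply/eqP => /rowP/(_ ord0)/eqP; rewrite !mxE oner_eq0.
apply/rowP => i; rewrite !mxE.
rewrite (eq_bigr (fun j => basis_row R i 0 j - moved_row M alpha beta i 0 j)).
  by rewrite sumrB sum_basis_row1 row1 subrr.
by move=> j _; rewrite !mxE mul1r.
Qed.

End EuclideanCore.

(** * Normals and altitudes of the Euclidean simplex *)

Section EuclideanFrame.
Variables (R : realType) (n : nat) (G : 'M[R]_n) (s alt : 'I_n -> R).
Local Notation V := 'rV[R]_(ambient_dim Euclidean n).
Variables (nn a : 'I_n -> V) (m : V) (r : R).
Hypothesis n2 : (2 <= n)%N.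
Hypothesis Gdiag : forall i, G i i = 1.
Hypothesis frame : normal_frame G nn m.
Hypothesis height : forall i, form m (a i) = r.
Hypothesis indep : independent a [set: 'I_n].
Hypothesis facet : forall i j k, j != i -> k != i -> form (nn i) (a j - a k) = 0.
Hypothesis sides : forall i, facet_sign s a nn i.
Hypothesis altP : forall i, is_altitude a i (alt i).

Lemma exists_other (i : 'I_n) : exists j, j != i.
Proof.
have [i0|i0] := eqVneq i (Ordinal (ltnW n2)); last by exists (Ordinal (ltnW n2)); rewrite eq_sym.
by exists (Ordinal n2); rewrite i0.
Qed.

(** The simplex lies at height r along [m]. Moved to height 1, its affinely independent vertices
    become a linear basis, in which the coefficient sum of a vector is its product with [m]. *)
Lemma orthogonal_combination (y : V) : form m y = 0 ->
  exists c : 'I_n -> R, \sum_j c j = 0 /\ y = \sum_j c j *: a j.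
Proof.
have [_ _ mm] := frame; move=> my.
pose A : 'M[R]_n := \matrix_j (a j + (1 - r) *: m : 'rV_n).
have mulA (w : 'rV[R]_n) : w *m A = \sum_j w 0 j *: a j + ((1 - r) * \sum_j w 0 j) *: m.
  rewrite mulmx_sum_row mulr_sumr scaler_suml -big_split; apply: eq_bigr => j _ /=.
  by rewrite rowK scalerDr scalerA [w 0 j * _]mulrC.
have mA (w : 'rV[R]_n) : form m (w *m A : V) = \sum_j w 0 j.
  rewrite mulA formDr formZr mm form_sumr; under eq_bigr do rewrite formZr height.
  by rewrite -mulr_suml; ring.
have comb (w : 'rV[R]_n) : \sum_j w 0 j = 0 -> w *m A = \sum_j w 0 j *: a j.
  by move=> w0; rewrite mulA w0 mulr0 scale0r addr0.
have uA : A \in unitmx.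
  rewrite unitmxE unitfE; apply/negP => /det0P[w w0 wA].
  have sw : \sum_j w 0 j = 0 by rewrite -mA wA form0r.
  move/negP: w0; apply; apply/eqP/rowP => j; rewrite mxE.
  apply: (indep (c := fun j => w 0 j)) => //.
    by rewrite (eq_bigl predT) => [|i]; rewrite ?finset.in_setT// -comb.
  by rewrite -[RHS]sw; apply: eq_bigl => i; rewrite finset.in_setT.
pose w : 'rV[R]_n := (y : 'rV_n) *m invmx A.
have wy : w *m A = y by rewrite mulmxKV.
have sw : \sum_j w 0 j = 0 by rewrite -mA wy.
by exists (fun j => w 0 j); split; rewrite // -comb.
Qed.

Lemma form_combination_opposite (y : V) (c : 'I_n -> R) i j : j != i ->
  (forall k, k != i -> form y (a k - a j) = 0) -> \sum_k c k = 0 ->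
  form y (\sum_k c k *: a k) = c i * form y (a i - a j).
Proof.
move=> ji ya c0.
have -> : \sum_k c k *: a k = \sum_k c k *: (a k - a j).
  under [RHS]eq_bigr do rewrite scalerBr.
  by rewrite sumrB -scaler_suml c0 scale0r subr0.
rewrite form_sumr (bigD1 i)//= formZr big1 ?addr0// => k ki.
by rewrite formZr ya// mulr0.
Qed.

(* Both the normal and the altitude vector are orthogonal to the facet, and
   the coefficient of [nn i] at [a i] is the inverse of [form (nn i) (a i - a j)]. *)
Lemma form_normal_edge i j : j != i -> form (nn i) (a i - a j) = s i * alt i.
Proof.
move=> ji; have [f [[w [w1 fE]] perp ->]] := altP i.
have [nnG mn _] := frame.
set kap := form (nn i) (a i - a j); set g := a i - f.
(* A vector orthogonal to the facet pairs equally with the altitude vector and with any edge from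
   a_i, since the foot is an affine combination of the facet's vertices. *)
have foot y : (forall k, k != i -> form y (a k - a j) = 0) ->
    form y g = form y (a i - a j).
  move=> ya; have -> : g = (a i - a j) - \sum_(l | l != i) w l *: (a l - a j).
    under eq_bigr do rewrite scalerBr.
    by rewrite sumrB -scaler_suml w1 scale1r -fE opprB addrA subrK.
  rewrite [LHS]formBr form_sumr big1 ?subr0// => l li.
  by rewrite formZr ya// mulr0.
have gperp k : k != i -> form g (a k - a j) = 0 by move=> ki; exact: perp.
have nperp k : k != i -> form (nn i) (a k - a j) = 0 by move=> ki; exact: facet.
have [c [c0 nc]] := orthogonal_combination (mn i).
have c1 : c i * kap = 1.
  by rewrite -(form_combination_opposite ji nperp c0) -nc nnG Gdiag.
have kapg : kap = c i * form g g.
  rewrite {2}/g -/g foot// -(form_combination_opposite ji gperp c0) -nc formC.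
  by rewrite foot.
(* From c_i kap = 1 and kap = c_i <g,g>. Hence kap is the altitude up to sign, and the sign is that
   of the chosen normal. *)
have gg : form g g = kap ^+ 2.
  by rewrite -[LHS]mul1r -c1 mulrAC -kapg expr2.
rewrite /vnorm gg ger0_norm ?sqr_ge0// sqrtr_sqr.
case: (sides i) => -[-> /(_ _ ji)]; rewrite -/kap => sg.
  by rewrite gtr0_norm// mul1r.
by rewrite ltr0_norm// mulrNN mul1r.
Qed.

Lemma altitude_neq0 i : s i * alt i != 0.
Proof.
have [j ji] := exists_other i; rewrite -(form_normal_edge ji).
by case: (sides i) => -[_ /(_ _ ji)] sg; [rewrite gt_eqF|rewrite lt_eqF].
Qed.

Lemma form_normal_combination i (c : 'I_n -> R) : \sum_j c j = 0 ->
  form (nn i) (\sum_j c j *: a j) = c i * (s i * alt i).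
Proof.
move=> c0; have [j ji] := exists_other i; rewrite -(form_normal_edge ji).
by apply: form_combination_opposite => // k ki; exact: facet.
Qed.

(** The Euclidean counterpart of n_i = sum_j g_ij c_j, with a_j divided by its signed altitude in
    place of c_j: pairing with n_j isolates the coefficient of a_j. The coefficients sum to 0
    because n_i is parallel to the hyperplane of the simplex. *)
Lemma normal_expansion i :
  \sum_j G i j / (s j * alt j) = 0 /\
  nn i = \sum_j (G i j / (s j * alt j)) *: a j.
Proof.
have [nnG mn _] := frame.
have [c [c0 nc]] := orthogonal_combination (mn i).
have cE j : G i j / (s j * alt j) = c j.
  rewrite -nnG formC {1}nc form_normal_combination// mulfK//; exact: altitude_neq0.
by split; under eq_bigr do rewrite cE.
Qed.

End EuclideanFrame.

(** * The Euclidean flex: collapsed positions and constancy of distances *)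

Section EuclideanFamily.
Variables (R : realType) (n : nat) (G : 'M[R]_n) (lam s s' alt : 'I_n -> R).
Local Notation V := 'rV[R]_(ambient_dim Euclidean n).
Variables (P : option R -> vertex n -> V) (nn a : 'I_n -> V) (m : V) (r : R).
Hypothesis n2 : (2 <= n)%N.
Hypothesis adm : admissible_data Euclidean G lam s s'.
Hypothesis frame : normal_frame G nn m.
Hypothesis height : forall i, form m (a i) = r.
Hypothesis indep : independent a [set: 'I_n].
Hypothesis facet : forall i j k, j != i -> k != i -> form (nn i) (a j - a k) = 0.
Hypothesis sides : forall i, facet_sign s a nn i.
Hypothesis altP : forall i, is_altitude a i (alt i).
Local Notation h := (hcoef G lam).
Local Notation alpha := (fun i => s i * alt i).

Definition opposite_scale i := (\sum_j h i j / (s j * alt j))^-1.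
Local Notation b := opposite_scale.

Hypothesis b0 : forall i, \sum_j h i j / (s j * alt j) != 0.
Hypothesis PE : forall u i,
  P u (inl i) = a i /\
  P u (inr i) = b i *: (\sum_j (h i j / (s j * alt j)) *: a j
            - ncoef (lam i) u *: nn i + mcoef (lam i) u *: m).

Let Gsym : G^T = G. Proof. by case: adm. Qed.
Let Gdiag i : G i i = 1. Proof. by case: adm. Qed.
Let lam0 i : 0 < lam i. Proof. by case: adm => _ _ _ _ []. Qed.
Let lamI (i j : 'I_n) : (i < j)%N -> lam i < lam j.
Proof. by case: adm => _ _ _ _ [_ H _]; exact: H. Qed.
Let alpha0 i : s i * alt i != 0.
Proof. exact: altitude_neq0 n2 Gdiag frame height indep facet sides altP i. Qed.

Local Notation N B := (choice_mx (basis_row R (n := n)) (moved_row (hmx G lam) alpha b) B).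

Lemma sum_moved_row i : \sum_j moved_row (hmx G lam) alpha b i 0 j = 1.
Proof.
rewrite -[RHS](mulVf (b0 i)) -/(b i) mulr_sumr.
by apply: eq_bigr => j _; rewrite !mxE mulrA.
Qed.

(** Replacing -h_ji by h_ij - 2 g_ij leaves the row sum at u = 0 minus a multiple of the coefficient
    sum of n_i, which is 0. *)
Lemma sum_moved_row_tr i : \sum_j moved_row (hmx G lam)^T alpha (fun i => - b i) i 0 j = 1.
Proof.
have [c0 _] := normal_expansion n2 Gdiag frame height indep facet sides altP i.
transitivity (\sum_j (moved_row (hmx G lam) alpha b i 0 j -
    2 * b i * (G i j / (s j * alt j)))).
  apply: eq_bigr => j _; rewrite !mxE.
  have -> : h j i = 2 * G i j - h i j.
    by rewrite -(hcoefD Gsym Gdiag lam0 lamI); ring.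
  ring.
by rewrite sumrB sum_moved_row -mulr_sumr c0 mulr0 subr0.
Qed.

Lemma collapsed_euclidean_zero i :
  P (Some 0) (inr i) = \sum_j moved_row (hmx G lam) alpha b i 0 j *: a j.
Proof.
have [_ ->] := PE (Some 0) i.
rewrite /= expr0n /= !mulr0 !mul0r scale0r subr0 scale0r addr0 scaler_sumr.
by apply: eq_bigr => j _; rewrite scalerA !mxE mulrA.
Qed.

Lemma collapsed_euclidean_infty i :
  P None (inr i) =
  \sum_j moved_row (hmx G lam)^T alpha (fun i => - b i) i 0 j *: a j.
Proof.
have [_ ->] := PE None i; rewrite /= scale0r addr0.
have [_ nE] := normal_expansion n2 Gdiag frame height indep facet sides altP i.
rewrite {1}nE !scaler_sumr -sumrB scaler_sumr; apply: eq_bigr => j _.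
rewrite scalerA -scalerBl scalerA !mxE; congr (_ *: _).
have -> : h j i = 2 * G i j - h i j.
  by rewrite -(hcoefD Gsym Gdiag lam0 lamI); ring.
ring.
Qed.

Definition collapsed_point B i : V := \sum_j N B i j *: a j.
(** Zero for the vertices a_i, so that fixed and moving vertices share one formula. *)
Definition choice_scale (B : {set 'I_n}) i := if i \in B then b i else 0.
Definition choice_motion u i : V := mcoef (lam i) u *: m - ncoef (lam i) u *: nn i.

Lemma choice_base u B i :
  P u (choice_vertex B i) = collapsed_point B i + choice_scale B i *: choice_motion u i.
Proof.
rewrite /choice_vertex /collapsed_point /choice_scale /choice_motion; under eq_bigr do rewrite mxE.
case: ifP => _; last by rewrite sum_basis_row scale0r addr0; have [] := PE u i.
have [_ ->] := PE u i; rewrite -addrA [- _ + _]addrC scalerDr; congr (_ + _).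
by rewrite scaler_sumr; apply: eq_bigr => j _; rewrite scalerA !mxE mulrA.
Qed.

Lemma sum_choice_row B i : \sum_j N B i j = 1.
Proof.
under eq_bigr do rewrite mxE; case: ifP => _; first exact: sum_moved_row.
exact: sum_basis_row1.
Qed.

Lemma form_base_m0 B i j : form (collapsed_point B i - collapsed_point B j) m = 0.
Proof.
rewrite /collapsed_point formBl !form_suml.
have E l : \sum_k form (N B l k *: a k) m = r.
  under eq_bigr do rewrite formZl formC height.
  by rewrite -mulr_suml sum_choice_row mul1r.
by rewrite !E subrr.
Qed.

(** Pairing with n_i reads off the i-th barycentric coordinate times the signed altitude. The factor
    in front makes the identity trivial when vertex i is fixed. *)
Lemma form_base_normal0 B i j : i != j ->
  choice_scale B i * form (collapsed_point B i - collapsed_point B j) (nn i) =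
  choice_scale B i * (choice_scale B i - choice_scale B j * h j i).
Proof.
move=> ij; rewrite /choice_scale; case: ifP => iB; last by rewrite !mul0r.
congr (_ * _); rewrite formC /collapsed_point -sumrB; under eq_bigr do rewrite -scalerBl.
rewrite (form_normal_combination n2 Gdiag frame height indep facet sides altP); last first.
  by rewrite sumrB !sum_choice_row subrr.
have := alpha0 i.
rewrite ![choice_mx _ _ _ _ _]mxE iB; case: ifP => _; rewrite !mxE hcoefii;
  move: (s i * alt i) => x x0; first by field.
by rewrite ?(negbTE ij) ?[i == j](negbTE ij) ?andbF /=; field.
Qed.

Lemma choice_dist u B i j :
  form (P u (choice_vertex B i) - P u (choice_vertex B j))
       (P u (choice_vertex B i) - P u (choice_vertex B j)) =
  form (collapsed_point B i - collapsed_point B j) (collapsed_point B i - collapsed_point B j).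
Proof.
have [<-|ij] := eqVneq i j; first by rewrite !subrr.
rewrite !choice_base opprD addrACA; set D := collapsed_point B i - collapsed_point B j.
have [nnG mn mm] := frame.
have Dm : form D m = 0 by exact: form_base_m0.
have Di := form_base_normal0 B ij; rewrite -/D in Di.
have Dj := form_base_normal0 B (i := j) (j := i); rewrite eq_sym ij in Dj.
have {}Dj := Dj isT; rewrite -(opprB (collapsed_point B i)) -/D formNl in Dj.
clearbody D; have nm k : form (nn k) m = 0 by rewrite formC mn.
have ci := coef_norm (lam i) u; have cj := coef_norm (lam j) u.
have cij := coef_cross Gsym Gdiag lam0 lamI u ij.
rewrite /choice_motion; move: (choice_scale B i) (choice_scale B j) Di Dj => x y Di Dj.
move: ci cj cij; set Ni := ncoef (lam i) u; set Nj := ncoef (lam j) u.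
set Mi := mcoef (lam i) u; set Mj := mcoef (lam j) u => ci cj cij.
rewrite !(formDl, formDr, formNl, formNr, formZl, formZr) !nm !mn mm !nnG !Gdiag.
rewrite ![form m D]formC ![form (nn _) D]formC Dm [G j i](G_sym Gsym).
(* Regrouped so that every bracket after the first term vanishes: two by the circle relation, one by
   the cross relation, two by the products of [D] with the normals. *)
transitivity (form D D + x ^+ 2 * (Ni ^+ 2 + Mi ^+ 2 - 2 * Ni)
    + y ^+ 2 * (Nj ^+ 2 + Mj ^+ 2 - 2 * Nj)
    + 2 * x * y * (Nj * h i j + Ni * h j i - (Ni * Nj * G i j + Mi * Mj))
    - 2 * Ni * (x * form D (nn i) - x * (x - y * h j i))
    - 2 * Nj * (y * - form D (nn j) - y * (y - x * h i j))).
  ring.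
by rewrite Di Dj cij ci cj !subrr !mulr0 !addr0 !subr0.
Qed.

End EuclideanFamily.

Lemma euclidean_theorem (R : realType) (n : nat) (G : 'M[R]_n)
    (lam s s' : 'I_n -> R) (P : option R -> vertex n -> 'rV[R]_(ambient_dim Euclidean n))
    (Y : {set 'I_n}) u :
  (2 <= n)%N -> admissible_data Euclidean G lam s s' ->
  simplest_euclidean G lam s s' P ->
  Y = [set i | s i * s' i == 1] \/ Y = [set i | s i * s' i == -1] ->
  \sum_(B : {set 'I_n}) (-1) ^+ #|B :&: Y| * face_volume (P u) (~: B) B = 0.
Proof.
case: n G lam s s' P Y => // k G lam s s' P Y n2 adm.
move=> [nn [a [m [alt [frame [[r height] indep facet] [sides altP] bs PE]]]]] hY.
have Gsym : G^T = G by case: adm.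
have Gdiag i : G i i = 1 by case: adm => _ H _ _ _; exact: H.
have lam0 i : 0 < lam i by case: adm => _ _ _ _ [H _ _]; exact: H.
have lamI (i j : 'I_k.+1) : (i < j)%N -> lam i < lam j.
  by case: adm => _ _ _ _ [_ H _]; exact: H.
have signs i : is_sign (s i) /\ is_sign (s' i).
  by case: adm => _ _ _ _ [_ _ H]; exact: H.
have lam2 i : 0 < lam i ^+ 2 by rewrite exprn_gt0.
have one0 (i : 'I_k.+1) : 0 < (1 : R) by exact: ltr01.
have alpha0 i : s i * alt i != 0.
  exact: altitude_neq0 n2 Gdiag frame height indep facet sides altP i.
have b0 i := (bs i).1.
pose b := opposite_scale G lam s alt.
(* An altitude is a norm and is nonzero, hence positive; the sign of b_i is s'_i by hypothesis. *)
have tauE i : tau (fun i => s i * alt i) b i = s i * s' i.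
  rewrite /tau (bs i).2; congr (_ * _).
  have alt0 : 0 < alt i.
    have [f [_ _ altE]] := altP i; rewrite lt_neqAle eq_sym {2}altE sqrtr_ge0 andbT.
    by have := alpha0 i; rewrite mulf_eq0 negb_or => /andP[].
  by rewrite sgrM (gtr0_sg alt0) mulr1 sg_sign//; case: (signs i).
have tauP i : tau (fun i => s i * alt i) b i = if i \in [set i | s i * s' i == 1] then 1 else -1.
  by rewrite tauE sign_indicator.
have tauM i : tau (fun i => s i * alt i) (fun i => - b i) i =
    if i \in [set i | s i * s' i == -1] then 1 else -1.
  by rewrite -sign_indicatorN// -tauE /tau sgrN mulrN.
have volE u' B : face_volume (P u) (~: B) B = face_volume (P u') (~: B) B.
  have [_ sl] := perm_enum_setC B.
  rewrite !face_volume_choice.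
  apply: (euclidean_volume_isometric (v := fun i => P u (choice_vertex B i))
    (w := fun i => P u' (choice_vertex B i))) => [|i j]; first by rewrite sl.
  by rewrite !(choice_dist n2 adm frame height indep facet sides altP b0 PE).
have QlE u' i : P u' (inl i) = a i by have [] := PE u' i.
case: hY => ->.
- under eq_bigr do rewrite (volE (Some 0)).
  apply: (euclidean_core alpha0 (QlE (Some 0)) (collapsed_euclidean_zero PE) _ tauP one0 lam2
    (hmx_lam_ge0 Gsym lam0 lamI)) => i.
  exact: sum_moved_row.
- under eq_bigr do rewrite (volE None).
  apply: (euclidean_core alpha0 (QlE None)
    (collapsed_euclidean_infty n2 adm frame height indep facet sides altP PE) _
    tauM lam2 one0 (hmx_tr_lam_ge0 Gsym lam0 lamI)) => i.
  exact: (sum_moved_row_tr n2 adm frame height indep facet sides altP b0).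
Qed.

Theorem theorem7p2 (R : realType) (X : geometry) (n : nat) (hn : (2 <= n)%N)
    (G : 'M[R]_n) (lam s s' : 'I_n -> R)
    (P : option R -> vertex n -> 'rV[R]_(ambient_dim X n))
    (hP : flexible_simplest_type G lam s s' P)
    (Y : {set 'I_n})
    (hY : Y = [set i | s i * s' i == 1] \/ Y = [set i | s i * s' i == -1])
    (u : option R) :
  \sum_(AB : {set 'I_n} * {set 'I_n}
         | [disjoint AB.1 & AB.2] && (AB.1 :|: AB.2 == [set: 'I_n]))
      (-1) ^+ #|AB.2 :&: Y| * face_volume (P u) AB.1 AB.2
  = match X with
    | Euclidean | Lobachevsky => 0
    | Spherical => if Y == finset.set0 then sphere_volume R n.-1 else 0
    end.
Proof.
rewrite (sum_disjoint_covers (fun A B => (-1) ^+ #|B :&: Y| * face_volume (P u) A B)).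
case: hP => adm; case: X P adm => P adm simp fin.
- exact: euclidean_theorem hn adm simp hY.
- by rewrite (curved_theorem u _ hn adm simp fin hY).
- by rewrite (curved_theorem u _ hn adm simp fin hY).
Qed.
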